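(* Let $d\ge2$, $1\le q\le p<\infty$ and $w\in\mathcal A_q(\mathbb R^d)$. Suppose that $\inf_{z\in\mathbb N}w(Q\times[z,z+1])>0$ for every cube $Q\subset\mathbb R^{d-1}$. If $qd-d+1<p<d$, then the following two conditions are equivalent: (1) For every $u\in\dot W^{1,p}(\mathbb R^d,w)$ there exists a constant $c\in\mathbb R$ such that $\lim_{z\to\infty,\,z\in\mathbb N}u_{Q\times[z,z+1]}=c$ for each cube $Q\subset\mathbb R^{d-1}$ of unit edge length. (2) Every $u\in\dot W^{1,p}(\mathbb R^d,w)$ has a unique almost sure vertical limit.
   Context: Muckenhoupt weights: a non-negative $w\in L^1_{\mathrm{loc}}(\mathbb R^d)$ belongs to $\mathcal A_q(\mathbb R^d)$, $1<q<\infty$, if $w>0$ a.e. and there is $C\ge1$ such that for every ball $B$, $\left(\frac1{|B|}\int_B w\,dx\right)\left(\frac1{|B|}\int_B w^{-1/(q-1)}dx\right)^{q-1}\le C$; it belongs to $\mathcal A_1(\mathbb R^d)$ if $w>0$ a.e. and there is $C\ge1$ such that for every ball $B$, $\frac1{|B|}\int_B w\,dx\le C\,w(y)$ for a.e. $y\in B$. One has $\mathcal A_q\subset\mathcal A_p$ for $q\le p$. We write $w(A)=\int_Aw\,dx$ and $u_A=\frac1{w(A)}\int_Au\,w\,dx$. Sobolev space (for $w\in\mathcal A_p(\mathbb R^d)$): $\dot W^{1,p}(\mathbb R^d,w)$ consists of the functions $u\in L^p_{\mathrm{loc}}(\mathbb R^d,w)$ (these lie in $L^1_{\mathrm{loc}}(\mathbb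 R^d)$) whose distributional gradient satisfies $|\nabla u|\in L^p(\mathbb R^d,w)$. Every such $u$ is always taken to be its Lebesgue representative with respect to Lebesgue measure: $u(x)=\limsup_{r\to0}\frac1{|B(x,r)|}\int_{B(x,r)}u(y)\,dy$ for every $x$. Identify $\mathbb R^d=\mathbb R^{d-1}\times\mathbb R$. A function $u$ has a unique almost sure vertical limit if there is a finite constant $c\in\mathbb R$ such that $\lim_{t\to\infty}u(\overline x,t)=c$ for Lebesgue-almost every $\overline x\in\mathbb R^{d-1}$. Cubes are closed with edges parallel to the coordinate axes. *)

(* Defs.v *)
From HB Require Import structures.
From mathcomp Require Import all_boot all_order all_algebra.
From mathcomp Require Import all_classical all_reals all_analysis.
From mathcomp Require Import measurable_realfun.

Set Implicit Arguments.
Unset Strict Implicit.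
Unset Printing Implicit Defensive.

Import Order.TTheory GRing.Theory Num.Theory.
Import numFieldNormedType.Exports.

Local Open Scope classical_set_scope.
Local Open Scope ring_scope.

(* R^d is 'rV[R]_d; its measurable sets are generated by the coordinate maps,
   as the library does for tuples. *)
Definition measure_rV_display : measure_display.
Proof. exact: default_measure_display. Qed.

Section measurable_rV.
Context (R : realType) (n : nat).

Let coors : 'I_n -> 'rV[R]_n -> measurableTypeR R := fun i x => x ord0 i.

Let rV_set0 : g_sigma_preimage coors set0.
Proof. exact: sigma_algebra0. Qed.

Let rV_setC A : g_sigma_preimage coors A -> g_sigma_preimage coors (~` A).
Proof. exact: sigma_algebraC. Qed.

Let rV_bigcup (F : _^nat) : (forall i, g_sigma_preimage coors (F i)) ->
  g_sigma_preimage coors (\bigcup_i (F i)).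
Proof. exact: sigma_algebra_bigcup. Qed.

HB.instance Definition _ := @isMeasurable.Build measure_rV_display
  'rV[R]_n (g_sigma_preimage coors) rV_set0 rV_setC rV_bigcup.

Lemma measurable_coord (i : 'I_n) :
  measurable_fun [set: 'rV[R]_n] (fun x => x ord0 i : measurableTypeR R).
Proof.
move=> _ Y mY; rewrite setTI; apply: sub_sigma_algebra => /=.
rewrite -bigcup_seq/=; exists i => /=; first by rewrite mem_index_enum.
by exists Y => //; rewrite setTI.
Qed.

Lemma measurable_fun_rV d1 (T1 : measurableType d1) (f : T1 -> 'rV[R]_n) :
  (forall i, measurable_fun [set: T1] (fun x => f x ord0 i : measurableTypeR R)) ->
  measurable_fun [set: T1] f.
Proof.
move=> mf _ A mA; rewrite setTI.
suff : g_sigma_preimage (fun i => coors i \o f) `<=` measurable.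
  by apply; rewrite g_sigma_preimage_comp; exists A => //; rewrite setTI.
apply: smallest_sub; first exact: sigma_algebra_measurable.
rewrite -bigcup_seq/= => B [i _ [Y mY <-]].
exact: mf.
Qed.

End measurable_rV.

Section euclidean_space.
Context {R : realType}.

(* The identification of R^(d-1) x R with R^d: (vcat x t) = (x, t). *)
Definition vcat d (x : 'rV[R]_d.-1) (t : R) : 'rV[R]_d :=
  \row_(i < d) oapp (x ord0) t (insub (val i)).

Lemma measurable_vcat d :
  measurable_fun [set: 'rV[R]_d.-1 * measurableTypeR R]
    (fun p => vcat p.1 p.2 : 'rV[R]_d).
Proof.
apply: measurable_fun_rV => i; rewrite /vcat.
under eq_fun do rewrite mxE.
case: insubP => [j _ _|_] /=; last exact: measurable_snd.
by apply: (measurableT_comp (measurable_coord j)); exact: measurable_fst.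
Qed.

Definition vcat_measure n (m : {measure set 'rV[R]_n -> \bar R})
    (A : set 'rV[R]_n.+1) : \bar R :=
  (m \x (@lebesgue_measure R))%E [set p | A (@vcat n.+1 p.1 p.2)].

Section vcat_measure_is_measure.
Local Open Scope ereal_scope.
Context n (m : {measure set 'rV[R]_n -> \bar R}).

Let vcatp (p : 'rV[R]_n * measurableTypeR R) : 'rV[R]_n.+1 := @vcat n.+1 p.1 p.2.

Let measurable_vcatp : measurable_fun [set: 'rV[R]_n * measurableTypeR R] vcatp.
Proof. exact: (@measurable_vcat n.+1). Qed.

Let vcat_measure0 : vcat_measure m set0 = 0.
Proof. exact: measure0. Qed.

Let vcat_measure_ge0 A : 0 <= vcat_measure m A.
Proof. exact: measure_ge0. Qed.

Let vcat_measure_sigma_additive : semi_sigma_additive (vcat_measure m).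
Proof.
move=> F mF tF mUF.
have mp (A : set 'rV[R]_n.+1) : measurable A -> measurable (vcatp @^-1` A).
  by move=> mA; rewrite -[X in measurable X]setTI; exact: measurable_vcatp.
rewrite /vcat_measure -[X in (_ \x _) X]/(vcatp @^-1` \bigcup_k F k).
rewrite preimage_bigcup; apply: measure_semi_sigma_additive.
- by move=> k; exact: mp.
- apply/trivIsetP => /= i j _ _ ij; rewrite -preimage_setI.
  by move/trivIsetP : tF => /(_ _ _ _ _ ij) ->//; rewrite preimage_set0.
- by rewrite -preimage_bigcup; exact: mp.
Qed.

HB.instance Definition _ := isMeasure.Build _ _ _ (vcat_measure m)
  vcat_measure0 vcat_measure_ge0 vcat_measure_sigma_additive.

End vcat_measure_is_measure.

Fixpoint lebesgue_rV d : {measure set 'rV[R]_d -> \bar R} :=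
  if d is n.+1 then vcat_measure (lebesgue_rV n) else \d_(0 : 'rV[R]_0).

Definition enorm d (x : 'rV[R]_d) : R := Num.sqrt (\sum_(i < d) x ord0 i ^+ 2).

(* The library's [ball] is the one of the sup norm. *)
Definition eball d (x : 'rV[R]_d) (r : R) : set 'rV[R]_d :=
  [set y | enorm (y - x) < r].

(* Measurability with respect to the Lebesgue (completed) sigma-algebra. On such
   functions the library integral, a supremum over Borel simple functions, is
   the Lebesgue integral. *)
Definition lebesgue_measurable d (f : 'rV[R]_d -> \bar R) : Prop :=
  exists2 g : 'rV[R]_d -> \bar R, measurable_fun [set: 'rV[R]_d] g &
    {ae lebesgue_rV d, forall x, f x = g x}.

Section integrability.
Local Open Scope ereal_scope.
Context (d : nat).
Implicit Types (u : 'rV[R]_d -> \bar R) (w : 'rV[R]_d -> R) (A : set 'rV[R]_d).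
Local Notation mu := (lebesgue_rV d).

Definition L1_loc u : Prop := lebesgue_measurable u /\
  forall K, compact K -> \int[mu]_(x in K) `|u x| < +oo.

Definition average u A : \bar R :=
  ((fine (mu A))^-1)%:E * \int[mu]_(x in A) u x.

Definition weighted_measure w A : \bar R := \int[mu]_(x in A) (w x)%:E.

Definition weighted_average w u A : \bar R :=
  ((fine (weighted_measure w A))^-1)%:E * \int[mu]_(x in A) (u x * (w x)%:E).

Definition Lp_loc (p : R) w u : Prop := lebesgue_measurable u /\
  forall K, compact K -> \int[mu]_(x in K) (`|u x| `^ p * (w x)%:E) < +oo.

(* [(w x) `^ (- _)] takes the junk value 0 where w vanishes; this is a null set
   in the definition of [muckenhoupt]. *)
Definition Aq_bound (q : R) w : Prop :=
  exists2 C : R, (1 <= C)%R & forall (x : 'rV[R]_d) (r : R), (0 < r)%R ->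
    average (EFin \o w) (eball x r) *
    average (fun y => ((w y) `^ (- (q - 1)^-1))%R%:E) (eball x r) `^ (q - 1)
      <= C%:E.

Definition A1_bound w : Prop :=
  exists2 C : R, (1 <= C)%R & forall (x : 'rV[R]_d) (r : R), (0 < r)%R ->
    {ae mu, forall y, eball x r y ->
      average (EFin \o w) (eball x r) <= (C * w y)%:E}.

Definition muckenhoupt (q : R) w : Prop :=
  [/\ forall x, (0 <= w x)%R, L1_loc (EFin \o w),
      {ae mu, forall x, (0 < w x)%R} &
      if q == 1%R then A1_bound w else Aq_bound q w].

End integrability.

Definition partial d (i : 'I_d) (f : 'rV[R]_d -> R^o) : 'rV[R]_d -> R^o :=
  fun x => 'D_(delta_mx ord0 i) f x.

(* C^oo_c(R^d): differentiability of all the iterated partial derivatives also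
   makes them continuous. *)
Definition test_function d (f : 'rV[R]_d -> R^o) : Prop :=
  (forall (s : seq 'I_d) x, differentiable (foldr (@partial d) f s) x) /\
  compact (closure [set x | f x != 0]).

Definition distributional_gradient d (u : 'rV[R]_d -> \bar R)
    (g : 'rV[R]_d -> 'rV[R]_d) : Prop :=
  [/\ L1_loc u,
      forall i, L1_loc (fun x => (g x ord0 i)%:E) &
      forall (f : 'rV[R]_d -> R^o) (i : 'I_d), test_function f ->
        (\int[lebesgue_rV d]_x (u x * (partial i f x)%:E)
         = - \int[lebesgue_rV d]_x (g x ord0 i * f x)%:E)%E].

(* u is extended real-valued because this limsup may be infinite on a null set. *)
Definition lebesgue_representative d (u : 'rV[R]_d -> \bar R) : Prop :=
  forall x, u x = limf_esup (fun r : R => average u (eball x r)) 0^'+.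

Definition sobolev d (p : R) (w : 'rV[R]_d -> R) (u : 'rV[R]_d -> \bar R) : Prop :=
  [/\ Lp_loc p w u,
      exists2 g, distributional_gradient u g &
        (\int[lebesgue_rV d]_x ((enorm (g x)) `^ p * w x)%R%:E < +oo)%E &
      lebesgue_representative u].

Definition cube n (a : 'rV[R]_n) (l : R) : set 'rV[R]_n :=
  [set x | forall i, a ord0 i <= x ord0 i <= a ord0 i + l].

Definition vblock d (Q : set 'rV[R]_d.-1) (z : nat) : set 'rV[R]_d :=
  [set y | exists x t, [/\ Q x, z%:R <= t <= z%:R + 1 & y = vcat x t]].

Definition unique_ae_vertical_limit d (u : 'rV[R]_d -> \bar R) : Prop :=
  exists c : R, {ae lebesgue_rV d.-1, forall x,
    u (vcat x t) @[t --> +oo] --> c%:E}.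

End euclidean_space.

(* Main.v *)
Require Import Defs.
From HB Require Import structures.
From mathcomp Require Import all_boot all_order all_algebra.
From mathcomp Require Import all_classical all_reals all_analysis.
From mathcomp Require Import measurable_realfun.
From mathcomp Require Import ring lra.

(** Write [d = n + 1] and let [m a z] be the plain average of [u] over the cube of
    radius [2] centred at [(a, z)], which contains the unit block with base
    [cube a 1] between the heights [z] and [z + 1]. Both limits in the theorem are
    limits of these numbers. More precisely, as [z] tends to infinity,
    - the weighted average of [u] over the block is close to [m a z]
      ([weighted_close]);
    - for almost every [xb], the value of [u] at [(xb, t)] is close to [m a z]
      whenever [xb] is in [cube a 1] and [z <= t <= z + 1] ([vertical_avg]).
    The equivalence follows ([block_comparison]): given the limit of the
    block averages, the line over [xb] is compared with the blocks whose base has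
    the corner [xb]; given the limits on vertical lines, each base contains a good
    [xb], because almost all of its points are good.

    Both facts rest on one bound. A chain of Poincare inequalities on dyadic cubes
    bounds the distance from the averages of [u] over small balls at [x] to the
    average over the cube [Q(x, 1)] of centre [x] and radius [1] by the dyadic
    Riesz potential [sum_k r_k^(1-d) int_(Q(x, r_k)) |grad u|] with [r_k = 2^-k]
    ([avgB_bound]).
    Since [u] is the limsup of these averages at every point, the bound reaches the
    values of [u] on vertical lines ([sobolev_gradient_bound]).

    The gradient is then traded for the energy [|grad u|^p w], whose integral is
    finite, by Hoelder's inequality and the Muckenhoupt condition
    ([weighted_holder]): for [E] and [F] in a ball [B], up to constants,
    [(int_E |grad u|)^p w(F) <= |E|^(p-q) |B|^q int_E |grad u|^p w].

    On vertical lines, [E] is a small cube and [F] is the whole block, whose weight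
    is bounded below by hypothesis. The Riesz potential at [(xb, t)] is then small
    as soon as [r_k^(-beta) int_(Q((xb, t), r_k)) |grad u|^p w] is small uniformly
    in [k], for some [beta > d q - p]. If moreover [beta < d - 1], Tonelli's theorem
    shows that these quantities tend to [0] with [1/t] for almost every [xb]
    ([small_cubes_ae]). The condition [q d - d + 1 < p] says exactly that such a
    [beta] exists.

    For weighted averages, [F] is the cube twice as large as [E]. The k-th term of
    the Riesz potential is then [r_k] times a p-th root of a quotient of energy by
    weight, and integrating that quotient against [w] over the block returns the
    energy of an enlarged block ([integral_ratio_le]), which tends to [0].

    The Poincare inequality comes from the weak gradient by halving boxes: testing
    against a product of a tent and of indicators bounds the difference of the
    integrals of [u] over the two halves of a box ([half_box_le]), and iterating
    this along a binary tree of boxes, then passing to the limit, gives the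
    inequality for boxes and open sets ([poincare_hbox], [poincare_open]). Tents and
    indicators are limits of smooth functions built from [exp (-1/t)]. *)

Set Implicit Arguments.
Unset Strict Implicit.
Unset Printing Implicit Defensive.

Import Order.TTheory GRing.Theory Num.Theory.
Import numFieldNormedType.Exports.

Local Open Scope classical_set_scope.
Local Open Scope ring_scope.

(** * Lebesgue measure of coordinate boxes *)

Definition rect {R : realType} d (J : 'I_d -> set R) : set 'rV[R]_d :=
  [set x | forall i, J i (x ord0 i)].

Section lebesgue_boxes.
Context {R : realType}.

Lemma measurable_rect d (J : 'I_d -> set R) :
  (forall i, measurable (J i : set (measurableTypeR R))) -> measurable (rect J).
Proof.
move=> mJ; rewrite (_ : rect J = \big[setI/setT]_(i < d)
    ((fun x : 'rV[R]_d => x ord0 i) @^-1` J i)); last first.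
  rewrite -bigcap_seq; apply/seteqP; split => x /= xJ i //=.
  by apply: xJ; rewrite /= mem_index_enum.
apply: bigsetI_measurable => i _.
by rewrite -[X in measurable X]setTI; exact: (measurable_coord i).
Qed.

Lemma lebesgue_rect d (J : 'I_d -> set R) :
  (forall i, measurable (J i : set (measurableTypeR R))) ->
  lebesgue_rV d (rect J) = (\prod_(i < d) lebesgue_measure (J i))%E.
Proof.
elim: d J => [|n IH] J mJ.
  rewrite big_ord0 /= /dirac indicE mem_set//=.
  by move=> i; case: i.
rewrite big_ord_recr/= /vcat_measure.
rewrite (_ : [set p | _] =
   rect (fun i : 'I_n => J (widen_ord (leqnSn n) i)) `*` J ord_max); last first.
  apply/seteqP; split => -[x t] /=.
    move=> xJ; split => [i|/=].
      have /= := xJ (widen_ord (leqnSn n) i).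
      rewrite /vcat mxE/= insubT//= => lt.
      by congr (J _ _); congr (x _ _); apply/val_inj.
    have := xJ ord_max; rewrite /vcat mxE/= insubF//= ltnn//.
  move=> [/= xJ Jt] i; rewrite /vcat mxE.
  case: insubP => [j _ ji|] /=.
    have := xJ j; rewrite (_ : widen_ord _ j = i)//.
    by apply/val_inj.
  rewrite -leqNgt => ni; rewrite (_ : i = ord_max)//.
  by apply/val_inj/eqP; rewrite eqn_leq/= ni -ltnS ltn_ord.
rewrite product_measure1E//; last exact: measurable_rect.
by rewrite IH.
Qed.

Lemma compact_closed_box d (a b : 'rV[R]_d) :
  compact (rect (fun i => `[a ord0 i, b ord0 i]%classic)).
Proof. by apply: rV_compact => i; exact: segment_compact. Qed.

End lebesgue_boxes.

(** * Almost everywhere equality, half-open boxes and Tonelli's theorem *)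

Section integral_ae.
Context d (T : measurableType d) (R : realType).
Variable mu : {measure set T -> \bar R}.
Local Open Scope ereal_scope.
Import HBNNSimple.

Let le_integral_ae (f g : T -> \bar R) :
  (forall x, 0 <= f x) -> (forall x, 0 <= g x) ->
  {ae mu, forall x, f x = g x} -> \int[mu]_x f x <= \int[mu]_x g x.
Proof.
move=> f0 g0 [N [mN N0 fgN]]; rewrite !ge0_integralTE//.
apply: ge_ereal_sup => _ [h /= hf <-].
have mNc : measurable (~` N) by exact: measurableC.
apply: ereal_sup_ubound => /=; exists (proj_nnsfun h mNc) => /=.
  move=> x; rewrite /mindic indicE; have [xN|xN] := boolP (x \in ~` N).
    rewrite mulr1; have [fgx|fgx] := pselect (f x = g x).
      by rewrite -fgx; exact: hf.
    by exfalso; move: xN; rewrite inE => xN; apply: xN; apply: fgN.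
  by rewrite mulr0; exact: g0.
rewrite -!integralT_nnsfun; apply: ge0_ae_eq_integral => //.
- exact/measurable_EFinP.
- exact/measurable_EFinP.
- by move=> x _; rewrite lee_fin.
- by move=> x _; rewrite lee_fin.
exists N; split => //; rewrite -[X in _ `<=` X]setCK; apply: subsetC.
move=> x Nx _ /=; congr EFin.
by rewrite /mindic indicE mem_set//= mulr1.
Qed.

(** No measurability is assumed: the integral of a nonnegative function is a
    supremum over simple functions, and removing a null set from a simple
    function below [f] does not change its integral. This is what lets merely
    Lebesgue measurable data be replaced by Borel functions. *)
Lemma integral_ae_eq_gen (D : set T) (f g : T -> \bar R) :
  {ae mu, forall x, f x = g x} -> \int[mu]_(x in D) f x = \int[mu]_(x in D) g x.
Proof.
move=> fg; rewrite integral_mkcond [RHS]integral_mkcond integralE [RHS]integralE.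
have fgD : {ae mu, forall x, (f \_ D) x = (g \_ D) x}.
  by apply: filterS fg => x fgx; rewrite /patch; case: ifP.
by congr (_ - _); apply/eqP; rewrite eq_le; apply/andP; split;
   apply: le_integral_ae => //; apply: filterS fgD => x /= fgx;
   rewrite !(funeposE, funenegE) fgx.
Qed.

Lemma EFin_Rintegral (f : T -> R) (A : set T) : measurable A ->
  mu.-integrable A (EFin \o f) -> \int[mu]_(y in A) (f y)%:E = (Rintegral mu A f)%:E.
Proof. by move=> mA fi; rewrite /Rintegral fineK//; exact: integrable_fin_num. Qed.

End integral_ae.

Section lebesgue_sigma_finite.
Context {R : realType}.

(** Half-open, so that a box cut along a hyperplane is the disjoint union of
    two boxes of the same kind. *)
Definition hbox d (a b : 'rV[R]_d) : set 'rV[R]_d :=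
  rect (fun i => `[a ord0 i, b ord0 i[%classic).

Lemma hboxP d (a b x : 'rV[R]_d) :
  hbox a b x <-> forall i, a ord0 i <= x ord0 i < b ord0 i.
Proof.
by split => xab i; have := xab i; rewrite /= in_itv/=.
Qed.

Lemma measurable_hbox d (a b : 'rV[R]_d) : measurable (hbox a b).
Proof. by apply: measurable_rect => i; exact: measurable_itv. Qed.

Lemma lebesgue_hbox d (a b : 'rV[R]_d) : (forall i, a ord0 i <= b ord0 i) ->
  lebesgue_rV d (hbox a b) = (\prod_(i < d) (b ord0 i - a ord0 i))%:E.
Proof.
move=> ab; rewrite lebesgue_rect; last by move=> i; exact: measurable_itv.
rewrite -prodEFin; apply: eq_bigr => i _.
rewrite lebesgue_measure_itv/= lte_fin.
by case: ltP => // ba; rewrite [b _ _](@le_anti _ _ _ (a ord0 i)) ?subrr// ba ab.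
Qed.

Definition Qb d (x : 'rV[R]_d) (r : R) : set 'rV[R]_d :=
  hbox (\row_i (x ord0 i - r)) (\row_i (x ord0 i + r)).

Lemma QbP d (x y : 'rV[R]_d) r :
  Qb x r y <-> forall i, x ord0 i - r <= y ord0 i < x ord0 i + r.
Proof.
by rewrite /Qb hboxP; split => h i; have := h i; rewrite !mxE.
Qed.

Lemma measurable_Qb d (x : 'rV[R]_d) r : measurable (Qb x r).
Proof. exact: measurable_hbox. Qed.

Lemma lebesgue_Qb d (x : 'rV[R]_d) r : 0 <= r ->
  lebesgue_rV d (Qb x r) = ((2 * r) ^+ d)%:E.
Proof.
move=> r0; rewrite lebesgue_hbox; last first.
  by move=> i; rewrite !mxE lerBlDr -addrA lerDl addr_ge0.
congr EFin; rewrite (eq_bigr (fun=> 2 * r)) ?prodr_const ?card_ord// => i _.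
by rewrite !mxE; ring.
Qed.

Lemma lebesgue_rV_sigma_finite d : sigma_finite [set: 'rV[R]_d] (lebesgue_rV d).
Proof.
exists (fun n : nat => Qb 0 (n%:R : R)); last first.
  move=> n; split; first exact: measurable_Qb.
  by rewrite lebesgue_Qb ?ltry.
apply/esym/seteqP; split => // x _.
have : exists n : nat, forall i, `|x ord0 i| < n%:R.
  exists (Num.bound (\sum_(i < d) `|x ord0 i|)) => i.
  apply: le_lt_trans (archi_boundP _); last by apply: sumr_ge0.
  by rewrite (bigD1 i)//= lerDl sumr_ge0.
move=> [n xn]; exists n => //; apply/QbP => i; rewrite mxE sub0r add0r.
by have := xn i; rewrite ltr_norml => /andP[/ltW -> ->].
Qed.

End lebesgue_sigma_finite.

(** A name that can carry the sigma-finite structure on which Tonelli's theorem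
    rests. *)
Definition leb {R : realType} d : set 'rV[R]_d -> \bar R := lebesgue_rV d.
HB.instance Definition _ (R : realType) d :=
  Measure.copy (@leb R d) (lebesgue_rV d).
HB.instance Definition _ (R : realType) d :=
  @Measure_isSigmaFinite.Build _ _ _ (@leb R d) (lebesgue_rV_sigma_finite d).

Lemma tonelli_rV (R : realType) n m (f : 'rV[R]_n * 'rV[R]_m -> \bar R) :
  measurable_fun setT f -> (forall z, (0 <= f z)%E) ->
  (\int[lebesgue_rV n]_x \int[lebesgue_rV m]_y f (x, y) =
   \int[lebesgue_rV m]_y \int[lebesgue_rV n]_x f (x, y))%E.
Proof. exact: (@fubini_tonelli _ _ _ _ _ (@leb R n) (@leb R m)). Qed.

Lemma measurable_integral_rV (R : realType) n m (f : 'rV[R]_n * 'rV[R]_m -> \bar R) :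
  measurable_fun setT f -> (forall z, (0 <= f z)%E) ->
  measurable_fun setT (fun x => \int[lebesgue_rV m]_y f (x, y))%E.
Proof.
exact: (@measurable_fun_fubini_tonelli_F _ _ _ _ _ (@leb R m)).
Qed.

Lemma measurable_integral_rV_l (R : realType) n m (f : 'rV[R]_n * 'rV[R]_m -> \bar R) :
  measurable_fun setT f -> (forall z, (0 <= f z)%E) ->
  measurable_fun setT (fun y => \int[lebesgue_rV n]_x f (x, y))%E.
Proof.
exact: (@measurable_fun_fubini_tonelli_G _ _ _ _ _ (@leb R n)).
Qed.

(** * Smooth cut-offs on the line and test functions *)

Section smooth_real.
Context {R : realType}.
Implicit Types (f g : R -> R).

(** The derivative is quantified inside the definition, so that the closure
    properties below follow by induction on [n]. *)
Fixpoint Ck (n : nat) (f : R -> R) : Prop :=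
  if n is m.+1 then exists2 g, (forall x : R, is_derive x (1 : R) f (g x)) & Ck m g
  else True.

Definition smooth f := forall n, Ck n f.

Lemma CkS n f : Ck n.+1 f -> Ck n f.
Proof.
by elim: n f => // n IH f [g fg Cg]; exists g => //; exact: IH.
Qed.

Lemma smooth_derive f : smooth f ->
  (forall x : R, is_derive x (1 : R) f ((derive1 f) x)) /\ smooth (derive1 f).
Proof.
move=> sf; have df (x : R) : is_derive x (1 : R) f ((derive1 f) x).
  have [g fg _] := sf 1%N; apply: is_derive_eq (fg x) _.
  by rewrite derive1E; have := fg x => -[_ ->].
split=> // n; have [g fg Cg] := sf n.+1.
suff -> : (derive1 f) = g by [].
by apply/funext => x; rewrite derive1E; have := fg x => -[_ ->].
Qed.

Lemma Ck_cst n (c : R) : Ck n (fun=> c).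
Proof.
elim: n c => // n IH c; exists (fun=> 0); last exact: IH.
by move=> x; exact: is_derive_cst.
Qed.

Lemma CkD n f g : Ck n f -> Ck n g -> Ck n (fun x => f x + g x).
Proof.
elim: n f g => // n IH f g [f' ff' Cf'] [g' gg' Cg'].
exists (fun x => f' x + g' x); last exact: IH.
by move=> x; exact: is_deriveD.
Qed.

Lemma CkM n f g : Ck n f -> Ck n g -> Ck n (fun x => f x * g x).
Proof.
elim: n f g => // n IH f g Cf Cg.
have := Cf => -[f' ff' Cf']; have := Cg => -[g' gg' Cg'].
exists (fun x => f x * g' x + g x * f' x); last first.
  by apply: CkD; apply: IH => //; exact: CkS.
by move=> x; exact: is_deriveM.
Qed.

Lemma Ck_affine n f (a b : R) : Ck n f -> Ck n (fun x => f (a * x + b)).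
Proof.
elim: n f => // n IH f [g fg Cg].
exists (fun x => a * g (a * x + b)); last first.
  by apply: CkM; [exact: Ck_cst|exact: IH].
move=> x; have -> : (fun x => f (a * x + b)) = f \o (fun x => a * x + b) by [].
have dl : is_derive x (1 : R) (fun x => a * x + b) a.
  have -> : (fun x : R => a * x + b) = (a \*: (@id R : R^o -> R^o)) + cst b by [].
  by apply: is_derive_eq; rewrite addr0 /GRing.scale/= mulr1.
by apply: is_derive_eq; rewrite mulrC.
Qed.

Lemma is_derive_invf f (x df : R) : f x != 0 -> is_derive x (1 : R) f df ->
  is_derive x (1 : R) (fun y => (f y)^-1) (- df * ((f x)^-1 * (f x)^-1)).
Proof.
move=> fx0 [dfx <-]; apply: DeriveDef; first exact: derivableV.
rewrite deriveV// /GRing.scale/= expr2 invfM; ring.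
Qed.

Lemma CkV n f : (forall x, f x != 0) -> Ck n f -> Ck n (fun x => (f x)^-1).
Proof.
move=> f0; elim: n => // n IH Cf; have Cf1 := IH (CkS Cf).
have := Cf => -[g fg Cg].
exists (fun x => - g x * ((f x)^-1 * (f x)^-1)); last first.
  apply: CkM; last by apply: CkM.
  have -> : (fun x => - g x) = (fun x => -1 * g x) by apply/funext => x; rewrite mulN1r.
  by apply: CkM => //; exact: Ck_cst.
by move=> x; exact: is_derive_invf.
Qed.

Lemma Ck_id n : Ck n (@id R).
Proof.
case: n => // n; exists (fun=> 1); last exact: Ck_cst.
by move=> x; exact: is_derive_id.
Qed.

(** The functions vanishing on the left half-line and equal to
    [p(1/t) exp(-1/t)] on the right one, for a polynomial [p]: this class is
    stable under derivation. *)
Definition flat (p : {poly R}) (t : R) : R :=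
  if 0 < t then p.[t^-1] * expR (- t^-1) else 0.

(** Since [t^-(i+1) <= (i+1)! exp (1/t)] for [t > 0]. This is the decay that
    makes [flat p] differentiable at [0]. *)
Lemma flat_bound p : exists2 C, 0 <= C & forall t, `|flat p t| <= C * `|t|.
Proof.
pose C := \sum_(i < size p) `|p`_i| * (i.+1)`!%:R.
have C0 : 0 <= C by apply: sumr_ge0 => i _; rewrite mulr_ge0.
exists C => // t; rewrite /flat; case: ifPn => t0; last by rewrite normr0 mulr_ge0.
rewrite horner_coef mulr_suml; apply: le_trans (ler_norm_sum _ _ _) _.
rewrite mulr_suml ler_sum// => i _; rewrite !normrM -!mulrA ler_wpM2l//.
rewrite !gtr0_norm ?exprn_gt0 ?invr_gt0 ?expR_gt0//.
rewrite expRN ler_pdivrMr ?expR_gt0//.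
have y0 : 0 <= t^-1 by rewrite invr_ge0 ltW.
have := expR_ge1Dxn i y0; set e := expR _ => he.
have : (t^-1) ^+ i.+1 / i.+1`!%:R <= e by apply: le_trans he; rewrite lerDr.
rewrite ler_pdivrMr ?ltr0n ?fact_gt0// => he2.
have : t * t^-1 ^+ i.+1 <= t * (e * i.+1`!%:R) by rewrite ler_wpM2l// ltW.
rewrite exprS mulVKf ?gt_eqF// => h; apply: le_trans h _.
by rewrite [leLHS]mulrA [leLHS]mulrC mulrA.
Qed.

(** At [0] the difference quotient of [flat p] is [flat ('X * p)], which tends
    to [0] by [flat_bound]. *)
Lemma is_derive_flat p (t : R) :
  is_derive t (1 : R) (flat p) (flat ('X^2 * (p - deriv p)) t).
Proof.
have [t0|t0|->] := ltgtP t 0.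
- rewrite [X in is_derive _ _ _ X]/flat ltNge (ltW t0)/=.
  have d0 : is_derive t (1 : R) (cst (0 : R)) 0 by exact: is_derive_cst.
  apply: near_eq_is_derive d0; near=> s; rewrite /flat ifN// -leNgt; near: s.
  by apply: (@cvgr_le _ _ _ _ (@id R) t _ 0 t0); exact: cvg_id.
- rewrite [X in is_derive _ _ _ X]/flat t0.
  have t0' : t != 0 by rewrite gt_eqF.
  have dV : is_derive t (1 : R) (fun s : R => s^-1) (- (t^-1 * t^-1)).
    by have := @is_derive_invf id t 1 t0' (is_derive_id _ _); rewrite mulN1r.
  have dp : is_derive t (1 : R) (fun s => p.[s^-1]) (- (t^-1 * t^-1) * (deriv p).[t^-1]).
    by have := @is_derive1_comp _ (horner p) (fun s : R => s^-1) t _ _ (is_derive_poly p _) dV; rewrite mulrC.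
  have de : is_derive t (1 : R) (fun s : R => expR (- s^-1)) ((t^-1 * t^-1) * expR (- t^-1)).
    have dN : is_derive t (1 : R) (fun s : R => - s^-1) (t^-1 * t^-1).
      by have := is_deriveN dV; rewrite opprK.
    by have := @is_derive1_comp _ expR (fun s : R => - s^-1) t _ _ (is_derive_expR _) dN; rewrite mulrC.
  have dpe : is_derive t (1 : R) (fun s : R => p.[s^-1] * expR (- s^-1))
      (('X^2 * (p - deriv p)).[t^-1] * expR (- t^-1)).
    have := is_deriveM dp de => /is_derive_eq; apply.
    rewrite hornerM hornerXn !hornerE /GRing.scale/=; ring.
  apply: near_eq_is_derive dpe; near=> s; rewrite /flat ifT//; near: s.
  by apply: (@cvgr_gt _ _ _ _ (@id R) t _ 0 t0); exact: cvg_id.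
have [C C0 hC] := flat_bound ('X * p).
have E h : (flat p h - flat p 0) = h * flat ('X * p) h.
  rewrite /flat ltxx subr0; case: ifPn => h0; last by rewrite mulr0.
  by rewrite hornerM hornerX !mulrA divff ?gt_eqF// mul1r.
have L : (fun h : R => h^-1 *: ((flat p \o shift 0) (h *: (1 : R)) - flat p 0)) h @[h --> 0^'] --> (0 : R).
  apply/cvgr0Pnorm_lt => e e0; near=> h.
  have h0 : h != 0 by near: h; exact: nbhs_dnbhs_neq.
  rewrite /= addr0 [_ *: 1]mulr1 E /GRing.scale/= mulKf//.
  apply: le_lt_trans (hC h) _.
  have : `|h| < e / (C + 1).
    near: h; apply: dnbhs0_lt; rewrite divr_gt0//.
    by rewrite ltr_wpDl.
  rewrite ltr_pdivlMr ?ltr_wpDl// => /(le_lt_trans _); apply.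
  by rewrite mulrC ler_wpM2l// lerDl.
rewrite [X in is_derive _ _ _ X](_ : _ = 0); last by rewrite /flat ltxx.
by apply: DeriveDef; [apply/cvg_ex; exists 0|exact/cvg_lim].
Unshelve. all: by end_near. Qed.

Lemma smooth_flat p : smooth (flat p).
Proof.
move=> n; elim: n p => // n IH p; exists (flat ('X^2 * (p - deriv p))) => //.
by move=> x; exact: is_derive_flat.
Qed.

(** A smooth step from [0] on the negative half-line to [1] on [[1, +oo[]. *)
Definition ramp (t : R) : R := flat 1 t / (flat 1 t + flat 1 (1 - t)).

Lemma flat1_ge0 t : 0 <= flat 1 t.
Proof. by rewrite /flat; case: ifP => // _; rewrite hornerC mul1r expR_ge0. Qed.

Lemma flat1_gt0 t : 0 < t -> 0 < flat 1 t.
Proof. by move=> t0; rewrite /flat t0 hornerC mul1r expR_gt0. Qed.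

Lemma flat_le0 p t : t <= 0 -> flat p t = 0.
Proof. by rewrite /flat leNgt => /negbTE ->. Qed.

Lemma ramp_den t : 0 < flat 1 t + flat 1 (1 - t).
Proof.
have [t0|t0] := ltP 0 t; first by rewrite ltr_pwDl ?flat1_gt0 ?flat1_ge0.
by rewrite ltr_wpDl ?flat1_ge0// flat1_gt0// subr_gt0 (le_lt_trans t0).
Qed.

Lemma smooth_ramp : smooth ramp.
Proof.
move=> n; apply: CkM; first exact: smooth_flat.
apply: CkV; first by move=> x; rewrite gt_eqF ?ramp_den.
apply: CkD; first exact: smooth_flat.
have := @Ck_affine n (flat 1) (-1) 1 (@smooth_flat 1 n).
by congr Ck; apply/funext => x; congr flat; ring.
Qed.

Lemma ramp_le0 t : t <= 0 -> ramp t = 0.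
Proof. by move=> t0; rewrite /ramp flat_le0// mul0r. Qed.

Lemma ramp_ge1 t : 1 <= t -> ramp t = 1.
Proof.
move=> t1; rewrite /ramp [flat 1 (1 - t)]flat_le0 ?subr_le0// addr0 divff//.
by rewrite gt_eqF// flat1_gt0// (lt_le_trans ltr01).
Qed.

Lemma ramp_ge0 t : 0 <= ramp t.
Proof. by rewrite divr_ge0 ?flat1_ge0// ltW// ramp_den. Qed.

Lemma ramp_le1 t : ramp t <= 1.
Proof. by rewrite ler_pdivrMr ?ramp_den// mul1r lerDl flat1_ge0. Qed.

End smooth_real.

Section tensor_products.
Context {R : realType} (d : nat).
Implicit Types (F : 'I_d -> R -> R).

Definition tensor F : 'rV[R]_d -> R^o := fun x => \prod_(i < d) F i (x ord0 i).

Definition upd T (F : 'I_d -> T) (i : 'I_d) (f : T) (j : 'I_d) : T :=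
  if j == i then f else F j.

Lemma differentiable_tensor F x : (forall i, smooth (F i)) ->
  differentiable (tensor F) x.
Proof.
move=> sF; rewrite /tensor.
elim: (index_enum _) => [|i s IH].
  under eq_fun do rewrite big_nil.
  exact: differentiable_cst.
rewrite (_ : (fun y : 'rV[R]_d => _) =
  (fun y : 'rV[R]_d => F i (y ord0 i) : R^o) * (fun y => \prod_(j <- s) F j (y ord0 j) : R^o)); last first.
  by apply/funext => y; rewrite big_cons.
apply: differentiableM => //.
apply: (@differentiable_comp _ _ _ _ (fun y : 'rV[R]_d => y ord0 i : R^o) (F i : R^o -> R^o)).
  exact: differentiable_coord.
apply/derivable1_diffP.
by have [/(_ (x ord0 i))[]] := smooth_derive (sF i).
Qed.

Lemma partial_tensor F i : (forall i, smooth (F i)) ->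
  partial i (tensor F) = tensor (upd F i (derive1 (F i))).
Proof.
move=> sF; apply/funext => x; rewrite /partial.
pose c := \prod_(j < d | j != i) F j (x ord0 j).
have -> : tensor (upd F i (derive1 (F i))) x = c * derive1 (F i) (x ord0 i).
  rewrite /tensor (bigD1 i)//= /upd eqxx mulrC; congr (_ * _).
  by apply: eq_bigr => j /negbTE ->.
have [/(_ (x ord0 i)) dF _] := smooth_derive (sF i).
rewrite -[RHS]/(c *: (derive1 (F i)) (x ord0 i)).
have := @is_deriveZ _ _ _ (F i) c _ _ _ dF => -[_ <-].
rewrite /derive; set f1 := (f in lim (f @ _)); set f2 := (f in _ = lim (f @ _)).
suff -> : f1 = f2 by [].
apply/funext => h; rewrite /f1 /f2 /=; congr (_ *: _).
rewrite /tensor (bigD1 i)//= [X in _ - X](bigD1 i)//= !mxE !eqxx.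
rewrite [X in _ * X - _](_ : _ = c); last first.
  apply: eq_bigr => j ji; congr (F j _); rewrite !mxE eqxx (negbTE ji)/=.
  by rewrite mulr0 add0r.
by rewrite /GRing.scale/= /c; ring.
Qed.

(** A partial derivative of a product of smooth functions of one variable is
    again such a product, so all the iterated ones are differentiable. *)
Lemma tensor_test_function F (a b : 'rV[R]_d) : (forall i, smooth (F i)) ->
  (forall i t, F i t != 0 -> a ord0 i <= t <= b ord0 i) ->
  test_function (tensor F).
Proof.
move=> sF Fab; split.
  move=> s x; suff [G sG ->] : exists2 G, (forall i, smooth (G i)) &
      foldr (@partial R d) (tensor F) s = tensor G by exact: differentiable_tensor.
  elim: s => [|i s [G sG IH]] /=; first by exists F.
  rewrite IH partial_tensor//; exists (upd G i (derive1 (G i))) => // j.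
  by rewrite /upd; case: eqP => // _; have [] := smooth_derive (sG i).
have K := @compact_closed_box R d a b.
apply: subclosed_compact K _; first exact: closed_closure.
have /closure_id Kc : closed (rect (fun i => `[a ord0 i, b ord0 i]%classic)).
  rewrite (_ : rect _ = \bigcap_(i in [set: 'I_d])
      ((fun x : 'rV[R]_d => x ord0 i) @^-1` `[a ord0 i, b ord0 i])); last first.
    by apply/seteqP; split => x xab i *; exact: xab.
  apply: closed_bigI => i _; apply: closed_comp; last exact: itv_closed.
  by move=> x _; exact: coord_continuous.
rewrite [X in _ `<=` X]Kc.
apply: closure_subset => x /= Fx i /=; rewrite in_itv/=; apply: Fab.
by apply: contra_neq Fx => Fx; rewrite /tensor (bigD1 i)//= Fx mul0r.
Qed.

End tensor_products.

Section cutoffs.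
Context {R : realType}.
Implicit Types (t s e : R).

(** A smooth version of the positive part, whose derivative is [0] on the left
    of [0] and [1] on the right of [1]. *)
Definition cut (t : R) : R := t * ramp t.

Lemma smooth_cut : smooth cut.
Proof. by move=> n; apply: CkM; [exact: Ck_id|exact: smooth_ramp]. Qed.

Lemma is_derive_cut (t : R) : is_derive t (1 : R) cut (derive1 cut t).
Proof. by have [] := smooth_derive smooth_cut. Qed.

Lemma dcut_lt0 t : t < 0 -> derive1 cut t = 0.
Proof.
move=> t0; rewrite derive1E.
have d0 : is_derive t (1 : R) (cst (0 : R)) 0 by exact: is_derive_cst.
have : is_derive t (1 : R) cut 0; last by move=> [].
apply: near_eq_is_derive d0; near=> s; rewrite /cut ramp_le0 ?mulr0//; near: s.
by apply: (@cvgr_le _ _ _ _ (@id R) t _ 0 t0); exact: cvg_id.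
Unshelve. all: by end_near. Qed.

Lemma dcut_gt1 t : 1 < t -> derive1 cut t = 1.
Proof.
move=> t1; rewrite derive1E.
have d0 : is_derive t (1 : R) (@id R) 1 by exact: is_derive_id.
have : is_derive t (1 : R) cut 1; last by move=> [].
apply: near_eq_is_derive d0; near=> s; rewrite /cut ramp_ge1 ?mulr1//; near: s.
by apply: (@cvgr_ge _ _ _ _ (@id R) t _ 1 t1); exact: cvg_id.
Unshelve. all: by end_near. Qed.

Lemma smooth_continuous (f : R -> R) : smooth f -> continuous f.
Proof.
move=> sf x; apply: differentiable_continuous; apply/derivable1_diffP.
by have [/(_ x)[]] := smooth_derive sf.
Qed.

Lemma smooth_measurable (f : R -> R) : smooth f -> measurable_fun setT f.
Proof. by move=> sf; apply: continuous_measurable_fun; exact: smooth_continuous. Qed.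

Lemma dcut_bounded : exists2 M : R, 1 <= M & forall t, `|derive1 cut t| <= M.
Proof.
have [_ sc] := smooth_derive smooth_cut.
have cc : {within `[(0 : R), 1], continuous (fun t => `|derive1 cut t|)}.
  apply: continuous_subspaceT => x; apply: cvg_norm; exact: smooth_continuous.
have [c _ hc] := EVT_max ler01 cc.
exists (1 + `|derive1 cut c|); first by rewrite lerDl.
move=> t; have [t0|t0] := ltP t 0.
  by rewrite dcut_lt0// normr0 addr_ge0.
have [t1|t1] := leP t 1.
  by apply: le_trans (hc t _) _; rewrite ?in_itv/= ?t0// lerDr.
by rewrite dcut_gt1// normr1 lerDl.
Qed.

Lemma cut_approx t : `|cut t - Num.max t 0| <= 1.
Proof.
rewrite /cut; have [t0|t0] := leP t 0; first by rewrite ramp_le0// mulr0 subrr normr0.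
have [t1|t1] := leP 1 t; first by rewrite ramp_ge1// mulr1 subrr normr0.
have -> : t * ramp t - t = - (t * (1 - ramp t)) by ring.
rewrite normrN ger0_norm ?mulr_ge0 ?subr_ge0 ?ramp_le1 ?(ltW t0)//.
by rewrite mulr_ile1 ?subr_ge0 ?ramp_le1 ?(ltW t0) ?(ltW t1)// gerBl ramp_ge0.
Qed.

(** Smooth approximation of the indicator of [[a, b[] at scale [e]. The shift by
    [2] places the transition near [c] strictly to the left of [c], between
    [c - 2e] and [c - e]; the limit as [e] tends to [0] is then the half-open
    indicator at every point, end points included. *)
Definition box_cut e a b t : R := ramp (e^-1 * t + (2 - e^-1 * a)) - ramp (e^-1 * t + (2 - e^-1 * b)).

(** Smooth approximation of the tent over [[a, b[], a second difference of the
    positive part: its derivative approximates the indicator of the left half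
    minus the one of the right half. *)
Definition tent_cut e a b t : R :=
  e * cut (e^-1 * t + (2 - e^-1 * a)) - 2 * (e * cut (e^-1 * t + (2 - e^-1 * ((a + b) / 2))))
  + e * cut (e^-1 * t + (2 - e^-1 * b)).

Definition dtent_cut e a b t : R :=
  derive1 cut (e^-1 * t + (2 - e^-1 * a)) - 2 * derive1 cut (e^-1 * t + (2 - e^-1 * ((a + b) / 2)))
  + derive1 cut (e^-1 * t + (2 - e^-1 * b)).

Definition tent a b t : R :=
  Num.max (t - a) 0 - 2 * Num.max (t - (a + b) / 2) 0 + Num.max (t - b) 0.

Lemma smooth_box_cut e a b : smooth (box_cut e a b).
Proof.
move=> n; apply: CkD; first by apply: Ck_affine; exact: smooth_ramp.
have -> : (fun x : R => - ramp (e^-1 * x + (2 - e^-1 * b))) =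
   (fun x => -1 * ramp (e^-1 * x + (2 - e^-1 * b))).
  by apply/funext => x; rewrite mulN1r.
by apply: CkM; [exact: Ck_cst|apply: Ck_affine; exact: smooth_ramp].
Qed.

Lemma smooth_tent_cut e a b : smooth (tent_cut e a b).
Proof.
have sc c : smooth (fun t => e * cut (e^-1 * t + (2 - e^-1 * c))).
  move=> n; apply: CkM; first exact: Ck_cst.
  by apply: Ck_affine; exact: smooth_cut.
move=> n; apply: CkD; last exact: sc.
apply: CkD; first exact: sc.
set f := (fun x : R => _).
have -> : f = (fun x => -2 * (e * cut (e^-1 * x + (2 - e^-1 * ((a + b) / 2))))).
  by apply/funext => x; rewrite /f mulNr.
by apply: CkM; [exact: Ck_cst|exact: sc].
Qed.

Lemma derive_tent_cut e a b : e != 0 -> derive1 (tent_cut e a b) = dtent_cut e a b.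
Proof.
move=> e0; apply/funext => t; rewrite derive1E.
have dc c : is_derive t (1 : R) (fun t : R => e * cut (e^-1 * t + (2 - e^-1 * c)))
    (derive1 cut (e^-1 * t + (2 - e^-1 * c))).
  have dl : is_derive t (1 : R) (fun x => e^-1 * x + (2 - e^-1 * c)) e^-1.
    have -> : (fun x : R => e^-1 * x + (2 - e^-1 * c)) =
      (e^-1 \*: (@id R : R^o -> R^o)) + cst (2 - e^-1 * c) by [].
    by apply: is_derive_eq; rewrite addr0 /GRing.scale/= mulr1.
  have := @is_deriveZ _ _ _ _ e _ _ _
    (@is_derive1_comp _ cut (fun x => e^-1 * x + (2 - e^-1 * c)) t _ _ (is_derive_cut _) dl).
  by move=> /is_derive_eq; apply; rewrite /GRing.scale/= mulrCA mulfV// mulr1.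
have := is_deriveD (is_deriveB (dc a) (is_deriveZ 2 (dc ((a + b) / 2)))) (dc b).
by move=> [_ h]; exact: h.
Qed.

Lemma box_cut_bound e a b t : `|box_cut e a b t| <= 1.
Proof.
rewrite /box_cut ler_norml; set x := ramp _; set y := ramp _.
have := @ramp_ge0 R (e^-1 * t + (2 - e^-1 * a)).
have := @ramp_le1 R (e^-1 * t + (2 - e^-1 * a)).
have := @ramp_ge0 R (e^-1 * t + (2 - e^-1 * b)).
have := @ramp_le1 R (e^-1 * t + (2 - e^-1 * b)).
rewrite -/x -/y; lra.
Qed.

Lemma cut_argE e c t : e^-1 * t + (2 - e^-1 * c) = 2 + e^-1 * (t - c).
Proof. by ring. Qed.

Lemma arg_ge e c t : 0 < e -> c <= t -> 2 <= e^-1 * t + (2 - e^-1 * c).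
Proof. by move=> e0 ct; rewrite cut_argE lerDl mulr_ge0 ?subr_ge0// invr_ge0 ltW. Qed.

Lemma arg_lt e c t : 0 < e -> t < c - 2 * e -> e^-1 * t + (2 - e^-1 * c) < 0.
Proof.
move=> e0 tc; rewrite cut_argE -ltrBrDl sub0r ltr_pdivrMl// mulrN.
by rewrite ltrBlDr; move: tc; rewrite mulrC [- _ + _]addrC.
Qed.

Lemma box_cut_supp e a b t : 0 < e -> a <= b -> box_cut e a b t != 0 ->
  a - 2 * e <= t < b.
Proof.
move=> e0 ab; apply: contra_neqT; rewrite negb_and -ltNge -leNgt => /orP[h|h].
- rewrite /box_cut !ramp_le0 ?subrr//; apply/ltW/arg_lt => //.
  by apply: lt_le_trans h _; rewrite lerB.
- have h1 : 2 <= e^-1 * t + (2 - e^-1 * b) by exact: arg_ge.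
  have h2 : 2 <= e^-1 * t + (2 - e^-1 * a) by apply: arg_ge => //; exact: le_trans h.
  by rewrite /box_cut !ramp_ge1 ?subrr//; lra.
Qed.

Lemma tent_cut_supp e a b t : 0 < e -> a <= b -> tent_cut e a b t != 0 ->
  a - 2 * e <= t < b.
Proof.
move=> e0 ab; apply: contra_neqT; rewrite negb_and -ltNge -leNgt => /orP[h|h].
  have h0 c : a <= c -> e^-1 * t + (2 - e^-1 * c) <= 0.
    by move=> ac; apply/ltW/arg_lt => //; lra.
  by rewrite /tent_cut /cut !ramp_le0 ?h0//; [ring|lra].
have h2 c : c <= b -> 1 <= e^-1 * t + (2 - e^-1 * c).
  move=> cb; apply: le_trans (_ : 2 <= _); first by lra.
  by apply: arg_ge => //; exact: le_trans h.
by rewrite /tent_cut /cut !ramp_ge1 ?h2//; [field; rewrite gt_eqF|lra].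
Qed.

Lemma dtent_cut_supp e a b t : 0 < e -> a <= b -> dtent_cut e a b t != 0 ->
  a - 2 * e <= t < b.
Proof.
move=> e0 ab; apply: contra_neqT; rewrite negb_and -ltNge -leNgt => /orP[h|h].
  have h0 c : a <= c -> e^-1 * t + (2 - e^-1 * c) < 0.
    by move=> ac; apply/arg_lt => //; lra.
  by rewrite /dtent_cut !dcut_lt0 ?h0//; [ring|lra].
have h2 c : c <= b -> 1 < e^-1 * t + (2 - e^-1 * c).
  move=> cb; apply: lt_le_trans (_ : 2 <= _); first by lra.
  by apply: arg_ge => //; exact: le_trans h.
by rewrite /dtent_cut !dcut_gt1 ?h2//; [ring|lra].
Qed.

(** Each of the three terms is within [3 e] of its limit: [e] from [cut_approx]
    and [2 e] from the shift; the middle one counts twice. *)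
Lemma tent_cut_approx e a b t : 0 < e -> `|tent_cut e a b t - tent a b t| <= 12 * e.
Proof.
move=> e0.
have key c : `|e * cut (e^-1 * t + (2 - e^-1 * c)) - Num.max (t - c) 0| <= 3 * e.
  set x := e^-1 * t + (2 - e^-1 * c); have := cut_approx x.
  have -> : Num.max (t - c) 0 = e * Num.max (x - 2) 0.
    rewrite maxr_pMr ?(ltW e0)// mulr0; congr Num.max.
    by rewrite /x; field; rewrite gt_eqF.
  move=> h; rewrite -mulrBr normrM gtr0_norm// mulrC ler_wpM2r ?(ltW e0)//.
  have : `|Num.max x 0 - Num.max (x - 2) 0| <= 2.
    by have [h1|h1] := leP x 0; have [h2|h2] := leP (x - 2) 0; rewrite ler_norml; lra.
  move: h; rewrite !ler_norml; lra.
rewrite /tent_cut /tent.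
move: (key a) (key b) (key ((a + b) / 2)); rewrite !ler_norml; lra.
Qed.

Lemma tentP a b t : a <= b ->
  0 <= tent a b t <= (b - a) / 2 /\ (~~ (a <= t < b) -> tent a b t = 0).
Proof.
move=> ab; rewrite /tent.
have [h1|h1] := leP (t - a) 0; have [h2|h2] := leP (t - (a + b) / 2) 0;
  have [h3|h3] := leP (t - b) 0; split; try lra.
all: rewrite negb_and -ltNge -leNgt => /orP[h|h]; lra.
Qed.

End cutoffs.

(** * Weak derivatives tested on boxes *)

Section tensor_limits.
Context {R : realType} (d : nat).
Local Notation mu := (lebesgue_rV d).

Lemma measurable_tensor (F : 'I_d -> R -> R) :
  (forall i, measurable_fun setT (F i)) -> measurable_fun setT (tensor F).
Proof.
move=> mF; rewrite /tensor; elim: (index_enum _) => [|i s IH].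
  by under eq_fun do rewrite big_nil; exact: measurable_cst.
under eq_fun do rewrite big_cons; apply: measurable_funM => //.
by apply: (measurableT_comp (mF i)); exact: measurable_coord.
Qed.

Lemma tensor_cvg (F_ : nat -> 'I_d -> R -> R) (G : 'I_d -> R -> R) x :
  (forall i t, F_ n i t @[n --> \oo] --> G i t) ->
  tensor (F_ n) x @[n --> \oo] --> tensor G x.
Proof.
move=> FG; rewrite /tensor; elim: (index_enum _) => [|i s IH].
  by under eq_fun do rewrite big_nil; rewrite big_nil; exact: cvg_cst.
by under eq_fun do rewrite big_cons; rewrite big_cons; exact: cvgM.
Qed.

Lemma tensor_dominated (u : 'rV[R]_d -> R) (F_ : nat -> 'I_d -> R -> R)
    (G : 'I_d -> R -> R) (C : R) (A B : 'rV[R]_d) :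
  measurable_fun setT u -> mu.-integrable (hbox A B) (EFin \o u) -> 1 <= C ->
  (forall n i, measurable_fun setT (F_ n i)) ->
  (forall n i t, `|F_ n i t| <= C) ->
  (forall n i t, F_ n i t != 0 -> A ord0 i <= t < B ord0 i) ->
  (forall i t, F_ n i t @[n --> \oo] --> G i t) ->
  (\int[mu]_x (u x * tensor (F_ n) x)%:E)%E @[n --> \oo] -->
  (\int[mu]_x (u x * tensor G x)%:E)%E.
Proof.
move=> mu_ iu C1 mF FC FAB FG.
have mG i : measurable_fun setT (G i).
  by apply: (@measurable_fun_cvg _ _ _ _ (fun n => F_ n i)) => // t _; exact: FG.
pose g (x : 'rV[R]_d) := ((C ^+ d)%:E * `|(EFin \o u) \_ (hbox A B) x|)%E.
have C0 : 0 <= C by exact: le_trans C1.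
have [] // := @dominated_convergence _ _ _ mu setT measurableT
  (fun n x => (u x * tensor (F_ n) x)%:E) (fun x => (u x * tensor G x)%:E) g.
- by move=> n; apply/measurable_EFinP; apply: measurable_funM => //; exact: measurable_tensor.
- by apply/measurable_EFinP; apply: measurable_funM => //; exact: measurable_tensor.
- apply: aeW => x _; apply/cvg_EFin; first by apply: nearW.
  by apply: cvgM; [exact: cvg_cst|exact: tensor_cvg].
- apply: integrableZl => //; apply: integrable_abse.
  by apply/(integrable_mkcond _ (measurable_hbox _ _)).1.
apply: aeW => x n _; rewrite /g /patch/= normrM EFinM muleC.
case: ifPn => [xAB|xAB]/=.
  rewrite -!EFinM lee_fin; apply: ler_wpM2r => //.
  rewrite /tensor normr_prod; apply: le_trans (_ : \prod_(i < d) C <= _).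
    by apply: ler_prod => i _; rewrite normr_ge0/=.
  by rewrite prodr_const card_ord.
rewrite normr0 mule0 -EFinM lee_fin.
suff -> : tensor (F_ n) x = 0 by rewrite normr0 mul0r.
have : ~ (forall i, A ord0 i <= x ord0 i < B ord0 i).
  by move=> /hboxP h; move: xAB; rewrite notin_setE; apply.
move=> /existsNP[i Fi]; rewrite /tensor (bigD1 i)//=.
by have [->|/FAB] := eqVneq (F_ n i (x ord0 i)) 0; [rewrite mul0r|].
Qed.

End tensor_limits.

Section half_boxes.
Context {R : realType} (d : nat).
Local Notation mu := (lebesgue_rV d).
Implicit Types (a b x : 'rV[R]_d).

Definition setc (x : 'rV[R]_d) (i : 'I_d) (v : R) : 'rV[R]_d :=
  \row_j (if j == i then v else x ord0 j).

Definition mid a b i : R := (a ord0 i + b ord0 i) / 2.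

Definition inI (s t : R) : R -> R := fun v => ((s <= v < t)%R)%:R.

Lemma indic_hbox a b x :
  \1_(hbox a b) x = tensor (fun j => inI (a ord0 j) (b ord0 j)) x :> R.
Proof.
rewrite indicE /tensor /inI; have [xab|xab] := boolP (x \in hbox a b).
  rewrite big1// => j _; move: xab; rewrite inE => /hboxP ->//.
move: xab; rewrite notin_setE => /hboxP/existsNP[j /negP/negbTE h].
by rewrite (bigD1 j)//= h mul0r.
Qed.

Lemma heaviside_cvg (f : R -> R) c t : (forall s, s < 0 -> f s = 0) ->
  (forall s, 1 < s -> f s = 1) ->
  f ((n.+1%:R^-1)^-1 * t + (2 - (n.+1%:R^-1)^-1 * c)) @[n --> \oo] --> ((c <= t)%R%:R : R).
Proof.
move=> f0 f1; apply: cvg_near_cst; have [ct|tc] := leP c t.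
  apply: nearW => n; apply: f1; apply: lt_le_trans (_ : 2 <= _); first by lra.
  by apply: arg_ge.
have ct2 : 0 < (c - t) / 2 by rewrite divr_gt0// subr_gt0.
near=> n; apply: f0; apply: arg_lt => //.
have : n.+1%:R^-1 < (c - t) / 2 by near: n; exact: near_infty_natSinv_lt (PosNum ct2).
by set k := n.+1%:R^-1; lra.
Unshelve. all: by end_near. Qed.

Lemma ramp_lt0 (s : R) : s < 0 -> ramp s = 0.
Proof. by move=> /ltW; exact: ramp_le0. Qed.

Lemma ramp_gt1 (s : R) : 1 < s -> ramp s = 1.
Proof. by move=> /ltW; exact: ramp_ge1. Qed.

Lemma inIE (s t v : R) : s <= t -> inI s t v = (s <= v)%R%:R - (t <= v)%R%:R.
Proof.
by move=> st; rewrite /inI; have [h1|h1] := leP s v; have [h2|h2] := leP t v;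
  rewrite /= ?subrr ?subr0//; lra.
Qed.

Lemma box_cut_cvg (s t v : R) : s <= t ->
  box_cut n.+1%:R^-1 s t v @[n --> \oo] --> inI s t v.
Proof.
move=> st; rewrite inIE//; apply: cvgB.
  exact: heaviside_cvg ramp_lt0 ramp_gt1.
exact: heaviside_cvg ramp_lt0 ramp_gt1.
Qed.

Lemma dtent_cut_cvg (s t v : R) : s <= t -> dtent_cut n.+1%:R^-1 s t v @[n --> \oo] -->
  inI s ((s + t) / 2) v - inI ((s + t) / 2) t v.
Proof.
move=> st; rewrite !inIE; try lra.
set x : R := (X in X - _ - _); set y : R := (X in _ - X - _); set z : R := (X in _ - (_ - X)).
have -> : x - y - (y - z) = x - 2 * y + z by ring.
apply: cvgD; last exact: heaviside_cvg (@dcut_lt0 R) (@dcut_gt1 R).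
apply: cvgB; first exact: heaviside_cvg (@dcut_lt0 R) (@dcut_gt1 R).
apply: cvgM; first exact: cvg_cst.
exact: heaviside_cvg (@dcut_lt0 R) (@dcut_gt1 R).
Qed.

Lemma tent_cut_cvg (s t v : R) :
  tent_cut n.+1%:R^-1 s t v @[n --> \oo] --> tent s t v.
Proof.
apply/cvgrPdist_le => e e0; have e12 : 0 < e / 12 by rewrite divr_gt0.
near=> n.
rewrite distrC; apply: le_trans (tent_cut_approx _ _ _ _) _ => //.
have : n.+1%:R^-1 < e / 12 by near: n; exact: near_infty_natSinv_lt (PosNum e12).
by set k := n.+1%:R^-1; lra.
Unshelve. all: by end_near. Qed.

Lemma dtent_cut_bound (M e s t v : R) : (forall v, `|derive1 cut v| <= M) ->
  `|dtent_cut e s t v| <= 4 * M.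
Proof.
move=> hM; rewrite /dtent_cut; apply: le_trans (ler_normD _ _) _.
have -> : 4 * M = M + 2 * M + M by ring.
rewrite lerD//; apply: le_trans (ler_normB _ _) _; rewrite lerD//.
by rewrite normrM gtr0_norm// ler_wpM2l.
Qed.

Lemma tensor_upd (F : 'I_d -> R -> R) i (f : R -> R) x :
  tensor (upd F i f) x = f (x ord0 i) * \prod_(j < d | j != i) F j (x ord0 j).
Proof.
rewrite /tensor (bigD1 i)//= /upd eqxx; congr (_ * _).
by apply: eq_bigr => j /negbTE ->.
Qed.

Lemma tensor_updB (F : 'I_d -> R -> R) i (f g : R -> R) x :
  tensor (upd F i (fun v => f v - g v)) x = tensor (upd F i f) x - tensor (upd F i g) x.
Proof.
by rewrite !tensor_upd mulrBl.
Qed.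

Lemma tensor_indic_setc a b i (m : R) x : 
  tensor (upd (fun j => inI (a ord0 j) (b ord0 j)) i (inI (a ord0 i) m)) x =
    \1_(hbox a (setc b i m)) x /\
  tensor (upd (fun j => inI (a ord0 j) (b ord0 j)) i (inI m (b ord0 i))) x =
    \1_(hbox (setc a i m) b) x.
Proof.
by split; rewrite indic_hbox /tensor; apply: eq_bigr => j _; rewrite /upd !mxE;
  case: eqP => [->|].
Qed.

Lemma Rintegral_indic_mul (f : 'rV[R]_d -> R) (A : set 'rV[R]_d) :
  Rintegral mu setT (fun x => f x * \1_A x) = Rintegral mu A f.
Proof.
rewrite [RHS]Rintegral_mkcond; apply: eq_Rintegral => x _.
by rewrite /patch indicE; case: ifP; rewrite ?mulr1 ?mulr0.
Qed.

Lemma integrable_indic_mul (f : 'rV[R]_d -> R) (A : set 'rV[R]_d) : measurable A ->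
  mu.-integrable A (EFin \o f) -> mu.-integrable setT (EFin \o (fun x => f x * \1_A x)).
Proof.
move=> mA /(integrable_mkcond _ mA).1; congr (_.-integrable _ _).
by apply/funext => x; rewrite /patch/= indicE; case: ifP; rewrite ?mulr1 ?mulr0.
Qed.

(** The weak formulation tested on the product of the tent in the variable [i]
    with the indicators of the sides of the box in the other variables. The
    derivative of the tent is the indicator of the left half minus the one of
    the right half, and the tent is at most half a side. This product is the
    pointwise limit of the test functions built from [box_cut] and [tent_cut]. *)
Lemma half_box_le (u g : 'rV[R]_d -> R) (i : 'I_d) :
  measurable_fun setT u -> measurable_fun setT g ->
  (forall a b, mu.-integrable (hbox a b) (EFin \o u)) ->
  (forall a b, mu.-integrable (hbox a b) (EFin \o g)) ->
  (forall f, test_function f ->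
     (\int[mu]_x (u x * partial i f x)%:E = - \int[mu]_x (g x * f x)%:E)%E) ->
  forall a b, (forall j, a ord0 j <= b ord0 j) ->
  `|Rintegral mu (hbox a (setc b i (mid a b i))) u -
    Rintegral mu (hbox (setc a i (mid a b i)) b) u|
    <= (b ord0 i - a ord0 i) / 2 * Rintegral mu (hbox a b) (fun x => `|g x|).
Proof.
move=> mu_ mg iu ig weak a b ab; set m := mid a b i.
pose chi j := inI (a ord0 j) (b ord0 j).
pose e n : R := n.+1%:R^-1.
have e0 n : 0 < e n by rewrite /e invr_gt0.
have e1 n : e n <= 1 by rewrite /e invf_le1// ler1n.
pose bc n j := box_cut (e n) (a ord0 j) (b ord0 j).
pose F n := upd (bc n) i (tent_cut (e n) (a ord0 i) (b ord0 i)).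
pose D n := upd (bc n) i (dtent_cut (e n) (a ord0 i) (b ord0 i)).
pose G := upd chi i (tent (a ord0 i) (b ord0 i)).
pose H := upd chi i (fun v => inI (a ord0 i) m v - inI m (b ord0 i) v).
have sF n j : smooth (F n j).
  by rewrite /F /upd; case: ifP => _; [exact: smooth_tent_cut|exact: smooth_box_cut].
pose A : 'rV[R]_d := \row_j (a ord0 j - 2).
have suppE j c : forall n, a ord0 j - 2 * e n <= c < b ord0 j -> A ord0 j <= c < b ord0 j.
  by move=> n; rewrite mxE; move: (e1 n); lra.
have FAB n j t : F n j t != 0 -> A ord0 j <= t < b ord0 j.
  rewrite /F /upd; case: (j =P i) => [->|_] h; apply: (suppE _ _ n).
    exact: tent_cut_supp h.
  exact: box_cut_supp h.
have DAB n j t : D n j t != 0 -> A ord0 j <= t < b ord0 j.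
  rewrite /D /upd; case: (j =P i) => [->|_] h; apply: (suppE _ _ n).
    exact: dtent_cut_supp h.
  exact: box_cut_supp h.
have DE n : partial i (tensor (F n)) = tensor (D n).
  rewrite partial_tensor//; apply/funext => x; rewrite /tensor.
  apply: eq_bigr => j _; rewrite /D /F /upd eqxx derive_tent_cut; last by rewrite gt_eqF.
  by case: (j =P i).
have weakn n : (\int[mu]_x (u x * tensor (D n) x)%:E = - \int[mu]_x (g x * tensor (F n) x)%:E)%E.
  rewrite -DE; apply: weak; apply: (@tensor_test_function _ _ _ A b) => // j t /FAB.
  by move=> /andP[-> /ltW ->].
have [M M1 hM] := @dcut_bounded R.
have tab := tentP _ (ab i).
have limD : (\int[mu]_x (u x * tensor (D n) x)%:E)%E @[n --> \oo] -->
    (\int[mu]_x (u x * tensor H x)%:E)%E.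
  apply: (@tensor_dominated _ _ _ _ _ (4 * M) A b) => //.
  - by lra.
  - move=> n j; rewrite /D /upd; case: ifP => _; last by apply: smooth_measurable; exact: smooth_box_cut.
    rewrite -derive_tent_cut; last by rewrite gt_eqF.
    apply: smooth_measurable.
    by have [] := smooth_derive (@smooth_tent_cut R (e n) (a ord0 i) (b ord0 i)).
  - move=> n j t; rewrite /D /upd; case: ifP => _; last first.
      by apply: le_trans (box_cut_bound _ _ _ _) _; lra.
    exact: dtent_cut_bound.
  - move=> j t; rewrite /D /H /upd; case: (j =P i) => [_|_].
      exact: dtent_cut_cvg.
    exact: box_cut_cvg.
have limF : (\int[mu]_x (g x * tensor (F n) x)%:E)%E @[n --> \oo] -->
    (\int[mu]_x (g x * tensor G x)%:E)%E.
  apply: (@tensor_dominated _ _ _ _ _ (1 + (b ord0 i - a ord0 i) / 2 + 12) A b) => //.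
  - by move: (ab i); lra.
  - by move=> n j; exact: smooth_measurable.
  - move=> n j t; rewrite /F /upd; case: ifP => _; last first.
      by apply: le_trans (box_cut_bound _ _ _ _) _; move: (ab i); lra.
    have := @tent_cut_approx R (e n) (a ord0 i) (b ord0 i) t (e0 n).
    by have [] := tab t; move: (e1 n); rewrite !ler_norml; lra.
  - move=> j t; rewrite /F /G /upd; case: (j =P i) => [_|_].
      exact: tent_cut_cvg.
    exact: box_cut_cvg.
have XY : (\int[mu]_x (u x * tensor H x)%:E = - \int[mu]_x (g x * tensor G x)%:E)%E.
  apply: (cvg_unique _ limD) => //.
  by rewrite (_ : (fun n => _) = (fun n => - \int[mu]_x (g x * tensor (F n) x)%:E)%E);
    [exact: cvgeN|apply/funext => n].
have am : a ord0 i <= m <= b ord0 i by rewrite /m /mid; move: (ab i); lra.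
have -> : Rintegral mu (hbox a (setc b i m)) u - Rintegral mu (hbox (setc a i m) b) u
   = fine (\int[mu]_x (u x * tensor H x)%:E)%E.
  rewrite -(Rintegral_indic_mul u (hbox a (setc b i m))).
  rewrite -(Rintegral_indic_mul u (hbox (setc a i m) b)) -RintegralB//; last 2 first.
  - by apply: integrable_indic_mul => //; exact: measurable_hbox.
  - by apply: integrable_indic_mul => //; exact: measurable_hbox.
  congr fine; apply: eq_integral => x _; congr EFin.
  by rewrite -mulrBr /H tensor_updB; have [-> ->] := tensor_indic_setc a b i m x.
rewrite XY.
have GP x : 0 <= tensor G x <= (b ord0 i - a ord0 i) / 2 * \1_(hbox a b) x.
  have -> : \1_(hbox a b) x = tensor (upd chi i (chi i)) x :> R.
    rewrite indic_hbox /tensor; apply: eq_bigr => j _.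
    by rewrite /upd; case: eqP => [->|].
  rewrite /G !tensor_upd.
  have c0 : 0 <= \prod_(j < d | j != i) chi j (x ord0 j) by apply: prodr_ge0.
  have [/andP[t0 t1] t2] := tab (x ord0 i).
  rewrite mulr_ge0//= mulrA ler_wpM2r// /chi /inI.
  by case: (boolP (_ <= _ < _)) t2 => [_ _|_ ->//]; rewrite ?mulr1 ?mulr0.
have mG : measurable_fun setT (tensor G).
  apply: measurable_tensor => j; rewrite /G /upd; case: ifP => _.
    apply: (@measurable_fun_cvg _ _ _ _ (fun n => tent_cut (e n) (a ord0 i) (b ord0 i))) => [n|t _].
      by apply: smooth_measurable; exact: smooth_tent_cut.
    exact: tent_cut_cvg.
  apply: (@measurable_fun_cvg _ _ _ _ (fun n => box_cut (e n) (a ord0 j) (b ord0 j))) => [n|t _].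
    by apply: smooth_measurable; exact: smooth_box_cut.
  exact: box_cut_cvg.
have i1 : mu.-integrable setT (EFin \o (fun x => `|g x| * \1_(hbox a b) x)).
  apply: integrable_indic_mul; first exact: measurable_hbox.
  exact: integrable_norm.
have i2 : mu.-integrable setT (EFin \o (fun x => (b ord0 i - a ord0 i) / 2 * (`|g x| * \1_(hbox a b) x))).
  exact: (@integrableZl _ _ _ mu setT measurableT ((b ord0 i - a ord0 i) / 2)) i1.
have bnd x : `|g x * tensor G x| <= (b ord0 i - a ord0 i) / 2 * (`|g x| * \1_(hbox a b) x).
  have /andP[h0 h1] := GP x; rewrite normrM (ger0_norm h0) mulrCA.
  by rewrite ler_wpM2l.
have i3 : mu.-integrable setT (EFin \o (fun x => g x * tensor G x)).
  apply: le_integrable i2 => //.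
    by apply/measurable_EFinP; exact: measurable_funM.
  move=> x _ /=; rewrite lee_fin; apply: le_trans (bnd x) _; exact: ler_norm.
rewrite fineN normrN.
have := le_normr_Rintegral measurableT i3; move=> /le_trans; apply.
rewrite -(Rintegral_indic_mul _ (hbox a b)) -RintegralZl//.
apply: le_Rintegral => //; exact: integrable_norm.
Qed.

End half_boxes.

(** * A Poincare inequality on boxes by repeated halving *)

Section halving.
Context {R : realType} (d : nat).
Local Notation mu := (lebesgue_rV d).
Implicit Types (a b x : 'rV[R]_d) (i : 'I_d) (s : seq 'I_d).

Definition vol a b : R := \prod_(i < d) (b ord0 i - a ord0 i).

Definition box_lt a b := forall i, a ord0 i < b ord0 i.

Lemma box_ltW a b : box_lt a b -> forall i, a ord0 i <= b ord0 i.
Proof. by move=> ab i; exact: ltW. Qed.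

Lemma vol_gt0 a b : box_lt a b -> 0 < vol a b.
Proof. by move=> ab; apply: prodr_gt0 => i _; rewrite subr_gt0. Qed.

Lemma box_lt_mid a b i : box_lt a b -> a ord0 i < mid a b i < b ord0 i.
Proof. by move=> /(_ i); rewrite /mid; lra. Qed.

Lemma box_lt_left a b i : box_lt a b -> box_lt a (setc b i (mid a b i)).
Proof.
move=> ab j; rewrite mxE; case: eqP => [->|//].
by have /andP[] := box_lt_mid i ab.
Qed.

Lemma box_lt_right a b i : box_lt a b -> box_lt (setc a i (mid a b i)) b.
Proof.
move=> ab j; rewrite mxE; case: eqP => [->|//].
by have /andP[] := box_lt_mid i ab.
Qed.

Lemma vol_left a b i : vol a (setc b i (mid a b i)) = vol a b / 2.
Proof.
rewrite /vol (bigD1 i)//= [in RHS](bigD1 i)//= !mxE eqxx.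
rewrite (eq_bigr (fun j => b ord0 j - a ord0 j)); last first.
  by move=> j /negbTE ji; rewrite !mxE ji.
by rewrite /mid; field.
Qed.

Lemma vol_right a b i : vol (setc a i (mid a b i)) b = vol a b / 2.
Proof.
rewrite /vol (bigD1 i)//= [in RHS](bigD1 i)//= !mxE eqxx.
rewrite (eq_bigr (fun j => b ord0 j - a ord0 j)); last first.
  by move=> j /negbTE ji; rewrite !mxE ji.
by rewrite /mid; field.
Qed.

(** The sum of the side lengths: a bound that drops by half a side at each
    halving. *)
Definition perim a b : R := \sum_(i < d) (b ord0 i - a ord0 i).

Lemma perim_left a b i :
  perim a (setc b i (mid a b i)) = perim a b - (b ord0 i - a ord0 i) / 2.
Proof.
rewrite /perim (bigD1 i)//= [in RHS](bigD1 i)//= !mxE eqxx.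
rewrite (eq_bigr (fun j => b ord0 j - a ord0 j)); last first.
  by move=> j /negbTE ji; rewrite !mxE ji.
by rewrite /mid; field.
Qed.

Lemma perim_right a b i :
  perim (setc a i (mid a b i)) b = perim a b - (b ord0 i - a ord0 i) / 2.
Proof.
rewrite /perim (bigD1 i)//= [in RHS](bigD1 i)//= !mxE eqxx.
rewrite (eq_bigr (fun j => b ord0 j - a ord0 j)); last first.
  by move=> j /negbTE ji; rewrite !mxE ji.
by rewrite /mid; field.
Qed.

Lemma perim_ge0 a b : box_lt a b -> 0 <= perim a b.
Proof. by move=> ab; apply: sumr_ge0 => i _; rewrite subr_ge0 ltW. Qed.

Lemma hbox_left a b i : box_lt a b ->
  hbox a (setc b i (mid a b i)) = hbox a b `&` [set x | x ord0 i < mid a b i].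
Proof.
move=> ab; apply/seteqP; split => x /=.
  move=> /hboxP h; split.
    apply/hboxP => j; have := h j; rewrite mxE; case: (j =P i) => [->|//].
    by move=> /andP[-> /lt_trans]; apply; have /andP[] := box_lt_mid i ab.
  by have := h i; rewrite mxE eqxx => /andP[].
move=> [/hboxP h xm]; apply/hboxP => j; have := h j; rewrite mxE.
by case: (j =P i) => [->|//] /andP[-> _].
Qed.

Lemma hbox_right a b i : box_lt a b ->
  hbox (setc a i (mid a b i)) b = hbox a b `&` [set x | mid a b i <= x ord0 i].
Proof.
move=> ab; apply/seteqP; split => x /=.
  move=> /hboxP h; split.
    apply/hboxP => j; have := h j; rewrite mxE; case: (j =P i) => [->|//].
    move=> /andP[h1 ->]; rewrite andbT; apply: le_trans h1; apply/ltW.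
    by have /andP[] := box_lt_mid i ab.
  by have := h i; rewrite mxE eqxx => /andP[].
move=> [/hboxP h xm]; apply/hboxP => j; have := h j; rewrite mxE.
by case: (j =P i) => [->|//] /andP[_ ->]; rewrite xm.
Qed.

Fixpoint piece s a b x : 'rV[R]_d * 'rV[R]_d :=
  if s is i :: s' then
    if x ord0 i < mid a b i then piece s' a (setc b i (mid a b i)) x
    else piece s' (setc a i (mid a b i)) b x
  else (a, b).

Lemma piece_mem s a b x : box_lt a b -> hbox a b x ->
  hbox (piece s a b x).1 (piece s a b x).2 x.
Proof.
elim: s a b => // i s IH a b ab xab /=; case: ltP => h; apply: IH.
- exact: box_lt_left.
- by rewrite hbox_left.
- exact: box_lt_right.
- by rewrite hbox_right.
Qed.

Lemma piece_side s a b x j :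
  (piece s a b x).2 ord0 j - (piece s a b x).1 ord0 j =
  (b ord0 j - a ord0 j) / 2 ^+ (count_mem j s).
Proof.
elim: s a b => [|i s IH] a b /=; first by rewrite divr1.
rewrite exprD; case: ltP => h; rewrite IH !mxE eq_sym; case: (i =P j) => [->|_] /=.
all: rewrite /mid ?expr1 ?expr0 ?invfM; field.
all: by rewrite ?expf_neq0.
Qed.

(** A union of pieces, described at each point by the piece that contains it, so
    that no family of boxes has to be handled. *)
Definition selected (S : 'rV[R]_d * 'rV[R]_d -> bool) s a b : set 'rV[R]_d :=
  hbox a b `&` [set x | S (piece s a b x)].

Lemma selected_nil S a b : selected S [::] a b = if S (a, b) then hbox a b else set0.
Proof.
rewrite /selected/=; case: ifP => h; apply/seteqP; split => x //=.
- by case.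
- by case.
Qed.

Lemma selected_cons S i s a b : box_lt a b ->
  selected S (i :: s) a b = selected S s a (setc b i (mid a b i)) `|`
    selected S s (setc a i (mid a b i)) b.
Proof.
move=> ab; rewrite /selected hbox_left// hbox_right//; apply/seteqP; split => x /=.
  by move=> [xab]; case: ltP => h Sx; [left|right].
by move=> [] [[xab h] Sx]; split => //; [rewrite h|rewrite ltNge h].
Qed.

Lemma measurable_selected S s a b : box_lt a b -> measurable (selected S s a b).
Proof.
elim: s a b => [|i s IH] a b ab.
  by rewrite selected_nil; case: ifP => // _; exact: measurable_hbox.
by rewrite selected_cons//; apply: measurableU; apply: IH;
  [exact: box_lt_left|exact: box_lt_right].
Qed.

Lemma selected_sub S s a b : selected S s a b `<=` hbox a b.
Proof. by move=> x []. Qed.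

Lemma hbox_halves_disj a b i (A B : set 'rV[R]_d) : box_lt a b ->
  A `<=` hbox a (setc b i (mid a b i)) -> B `<=` hbox (setc a i (mid a b i)) b ->
  [disjoint A & B].
Proof.
rewrite /= => ab AL BR; apply/disj_setPS => x [/AL + /BR].
rewrite hbox_left// hbox_right// => -[_ /= h] [_ /=].
by rewrite leNgt h.
Qed.

Lemma hbox_halves a b i : box_lt a b ->
  hbox a b = hbox a (setc b i (mid a b i)) `|` hbox (setc a i (mid a b i)) b.
Proof.
move=> ab; rewrite hbox_left// hbox_right// -setIUr; apply/esym/setIidPl => x _ /=.
by case: (ltP (x ord0 i) (mid a b i)); [left|right].
Qed.

Lemma fine_lebesgue_hbox a b : box_lt a b -> fine (mu (hbox a b)) = vol a b.
Proof. by move=> ab; rewrite lebesgue_hbox//; exact: box_ltW. Qed.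

Lemma fin_sub_hbox a b (A : set 'rV[R]_d) : box_lt a b -> measurable A -> A `<=` hbox a b ->
  mu A \is a fin_num /\ 0 <= fine (mu A) <= vol a b.
Proof.
move=> ab mA AE.
have le : (mu A <= (vol a b)%:E)%E.
  rewrite -lebesgue_hbox; last exact: box_ltW.
  by apply: le_measure => //; rewrite inE//; exact: measurable_hbox.
have fA : mu A \is a fin_num by rewrite ge0_fin_numE// (le_lt_trans le)// ltry.
by split=> //; rewrite fine_ge0//= -lee_fin fineK.
Qed.

End halving.

Section poincare.
Context {R : realType} (d : nat).
Local Notation mu := (lebesgue_rV d).
Implicit Types (a b x : 'rV[R]_d) (i : 'I_d) (s : seq 'I_d).
Variables (u gam : 'rV[R]_d -> R).
Hypothesis mu_ : measurable_fun setT u.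
Hypothesis iu : forall a b, mu.-integrable (hbox a b) (EFin \o u).
Hypothesis ig : forall a b, mu.-integrable (hbox a b) (EFin \o gam).
Hypothesis g0 : forall x, 0 <= gam x.
Hypothesis half : forall i a b, (forall j, a ord0 j <= b ord0 j) ->
  `|Rintegral mu (hbox a (setc b i (mid a b i))) u -
    Rintegral mu (hbox (setc a i (mid a b i)) b) u|
    <= (b ord0 i - a ord0 i) / 2 * Rintegral mu (hbox a b) gam.

Definition avg a b : R := Rintegral mu (hbox a b) u / vol a b.

Lemma integrable_sub a b (f : 'rV[R]_d -> R) (A : set 'rV[R]_d) : measurable A -> A `<=` hbox a b ->
  mu.-integrable (hbox a b) (EFin \o f) -> mu.-integrable A (EFin \o f).
Proof.
by move=> mA AE; apply: integrableS => //; exact: measurable_hbox.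
Qed.

(** Halving along [i] changes the average by at most half of the side [i] times
    the integral of [gam], and the sum of the sides of each half is smaller by
    exactly that amount, so the induction closes without loss. The bound does
    not depend on the number of halvings. *)
Lemma poincare_selected S s a b : box_lt a b ->
  `|Rintegral mu (selected S s a b) u - fine (mu (selected S s a b)) * avg a b|
    <= perim a b * Rintegral mu (hbox a b) gam.
Proof.
elim: s a b => [|i s IH] a b ab.
  have r0 : 0 <= perim a b * Rintegral mu (hbox a b) gam.
    by rewrite mulr_ge0 ?perim_ge0// Rintegral_ge0.
  rewrite selected_nil; case: ifP => _; last first.
    by rewrite Rintegral_set0 measure0/= mul0r subrr normr0.
  rewrite fine_lebesgue_hbox// /avg mulrCA.
  by rewrite divff ?gt_eqF ?vol_gt0// mulr1 subrr normr0.
have aL := box_lt_left i ab; have aR := box_lt_right i ab.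
have hL := IH _ _ aL; have hR := IH _ _ aR.
rewrite selected_cons//.
set AL := selected S s a _; set AR := selected S s _ b.
have mAL : measurable AL by exact: measurable_selected.
have mAR : measurable AR by exact: measurable_selected.
have dA : [disjoint AL & AR] by apply: (hbox_halves_disj ab); exact: selected_sub.
have subU : AL `|` AR `<=` hbox a b.
  by rewrite /AL /AR -selected_cons//; exact: selected_sub.
have dE := hbox_halves_disj ab (@subset_refl _ _) (@subset_refl _ (hbox (setc a i (mid a b i)) b)).
rewrite Rintegral_setU//; last by apply: integrable_sub subU _ => //; exact: measurableU.
have [fL bL] := fin_sub_hbox aL mAL (@selected_sub _ _ _ _ _ _).
have [fR bR] := fin_sub_hbox aR mAR (@selected_sub _ _ _ _ _ _).
rewrite measureU//; last exact/disj_set2P.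
rewrite fineD//.
have eG : Rintegral mu (hbox a b) gam = Rintegral mu (hbox a (setc b i (mid a b i))) gam +
   Rintegral mu (hbox (setc a i (mid a b i)) b) gam.
  rewrite [in LHS](hbox_halves i ab) Rintegral_setU//; try exact: measurable_hbox.
  by rewrite -hbox_halves.
have eu : Rintegral mu (hbox a b) u = Rintegral mu (hbox a (setc b i (mid a b i))) u +
   Rintegral mu (hbox (setc a i (mid a b i)) b) u.
  rewrite [in LHS](hbox_halves i ab) Rintegral_setU//; try exact: measurable_hbox.
  by rewrite -hbox_halves.
have := half i (box_ltW ab); have V0 := vol_gt0 ab.
move: hL hR bL bR; rewrite -/AL -/AR /avg eu eG vol_left vol_right perim_left perim_right.
have GL0 : 0 <= Rintegral mu (hbox a (setc b i (mid a b i))) gam by exact: Rintegral_ge0.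
have GR0 : 0 <= Rintegral mu (hbox (setc a i (mid a b i)) b) gam by exact: Rintegral_ge0.
move: GL0 GR0.
set GL := Rintegral mu (hbox a _) gam; set GR := Rintegral mu _ gam.
set IL := Rintegral mu (hbox a _) u; set IR := Rintegral mu (hbox _ b) u.
set XL := Rintegral mu AL u; set XR := Rintegral mu AR u.
set vL := fine (mu AL); set vR := fine (mu AR).
have l0 : 0 < b ord0 i - a ord0 i by rewrite subr_gt0.
move: V0 l0; set V := vol a b; set l := b ord0 i - a ord0 i; set P := perim a b.
move=> V0 l0 GL0 GR0 hL hR bL bR hI.
have -> : XL + XR - (vL + vR) * ((IL + IR) / V) =
  (XL - vL * (IL / (V / 2))) + (XR - vR * (IR / (V / 2))) + (vL - vR) / V * (IL - IR).
  by field; rewrite gt_eqF.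
have hv : `|(vL - vR) / V| <= 1.
  rewrite normrM normfV (gtr0_norm V0) ler_pdivrMr// mul1r ler_norml.
  by move: bL bR V0 {hL hR}; lra.
apply: le_trans (ler_normD _ _) _; apply: le_trans (lerD (ler_normD _ _) (lexx _)) _.
apply: le_trans (lerD (lerD hL hR) (_ : _ <= l / 2 * (GL + GR))) _.
  by rewrite normrM; apply: le_trans hI; rewrite ler_piMl.
by rewrite le_eqVlt; apply/orP; left; apply/eqP; ring.
Qed.

(** Halving along every coordinate in turn, so that all sides shrink. *)
Definition rounds n : seq 'I_d := flatten (nseq n (enum 'I_d)).

Lemma count_rounds n i : count_mem i (rounds n) = n.
Proof.
elim: n => // n IH; rewrite /rounds/= count_cat -/(rounds n) IH.
by rewrite count_uniq_mem ?enum_uniq// mem_enum.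
Qed.

Lemma piece_small a b x (e : R) : box_lt a b -> hbox a b x -> 0 < e ->
  \forall n \near \oo, forall i,
    let c := piece (rounds n) a b x in
    [/\ c.1 ord0 i <= x ord0 i, x ord0 i < c.2 ord0 i &
        c.2 ord0 i - c.1 ord0 i < e].
Proof.
move=> ab xab e0.
have P0 : 0 < perim a b + 1 by rewrite ltr_pwDr// perim_ge0.
near=> n => i /=.
have /hboxP/(_ i)/andP[-> ->] := piece_mem (rounds n) ab xab; split => //.
rewrite piece_side count_rounds.
have h : (perim a b + 1) / 2 ^+ n < e.
  have : (perim a b + 1) / e < n%:R by near: n; exact: nbhs_infty_gtr.
  rewrite ltr_pdivrMr// => h; rewrite ltr_pdivrMr ?exprn_gt0//.
  apply: lt_trans h _; rewrite mulrC ltr_pM2l// -natrX ltr_nat.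
  exact: ltn_expl.
apply: le_lt_trans h; rewrite ler_pM2r ?invr_gt0 ?exprn_gt0//.
apply: le_trans (_ : perim a b <= _); last by rewrite lerDl.
rewrite /perim (bigD1 i)//= lerDl sumr_ge0// => j _.
by rewrite subr_ge0 ltW.
Unshelve. all: by end_near. Qed.

(** The pieces shrink to points, so if [S] ends up deciding membership in [A]
    then the selected sets converge to [A], by dominated convergence. *)
Lemma poincare_limit (A : set 'rV[R]_d) S a b : box_lt a b ->
  measurable A -> A `<=` hbox a b ->
  (forall x, hbox a b x -> \forall n \near \oo, S (piece (rounds n) a b x) = (x \in A)) ->
  `|Rintegral mu A u - fine (mu A) * avg a b|
    <= perim a b * Rintegral mu (hbox a b) gam.
Proof.
move=> ab mA AE hS.
have conv (f : 'rV[R]_d -> R) : measurable_fun setT f ->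
    mu.-integrable (hbox a b) (EFin \o f) ->
    Rintegral mu (selected S (rounds n) a b) f @[n --> \oo] --> Rintegral mu A f.
  move=> mf intf.
  have key (B : set 'rV[R]_d) : B `<=` hbox a b ->
      Rintegral mu B f = Rintegral mu (hbox a b) (f \_ B).
    by move=> BE; rewrite -Rintegral_mkcondr setIidr.
  rewrite (key A)//.
  rewrite (_ : (fun n => _) = (fun n => Rintegral mu (hbox a b)
      (f \_ (selected S (rounds n) a b)))); last first.
    by apply/funext => n; rewrite key//; exact: selected_sub.
  have mE := measurable_hbox a b.
  have mr (B : set 'rV[R]_d) : measurable B -> measurable_fun (hbox a b) (EFin \o (f \_ B)).
    move=> mB; apply/measurable_EFinP; apply: (measurable_funS measurableT) => //.
    by apply/measurable_restrict => //; rewrite ?setTI; exact: measurable_funTS.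
  have [] // := @dominated_convergence _ _ _ mu (hbox a b) mE
    (fun n => EFin \o (f \_ (selected S (rounds n) a b))) (EFin \o (f \_ A)) (abse \o (EFin \o f)).
  - by move=> n; apply: mr; exact: measurable_selected.
  - exact: mr.
  - apply: aeW => x xE; apply: cvg_near_cst.
    have := hS x xE; apply: filterS => n hn; rewrite /patch/=.
    suff -> : (x \in selected S (rounds n) a b) = (x \in A) by [].
    rewrite -hn; apply/idP/idP; first by rewrite inE => -[].
    by move=> h; rewrite inE; split.
  - exact: integrable_abse.
  - apply: aeW => x n xE; rewrite /patch/=; case: ifP => _; first by [].
    by rewrite (_ : point = 0 :> R)// normr0 lee_fin.
  move=> intA _ cvI; apply: fine_cvg; rewrite fineK//.
  exact: integrable_fin_num.
have c1 := conv _ mu_ (iu a b).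
have c2 : fine (mu (selected S (rounds n) a b)) @[n --> \oo] --> fine (mu A).
  have h1 (B : set 'rV[R]_d) : measurable B -> Rintegral mu B (fun=> 1) = fine (mu B).
    by move=> mB; rewrite Rintegral_cst// mul1r.
  rewrite -(h1 A)// (_ : (fun n => _) = (fun n =>
      Rintegral mu (selected S (rounds n) a b) (fun=> 1))); last first.
    by apply/funext => n; rewrite h1//; exact: measurable_selected.
  apply: conv; first exact: measurable_cst.
  apply/integrableP; split; first exact: measurable_cst.
  under eq_integral do rewrite /= normr1.
  rewrite integral_cst ?mul1e; last exact: measurable_hbox.
  by rewrite lebesgue_hbox ?ltry//; exact: box_ltW.
have c3 : `|Rintegral mu (selected S (rounds n) a b) u -
    fine (mu (selected S (rounds n) a b)) * avg a b| @[n --> \oo] -->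
  `|Rintegral mu A u - fine (mu A) * avg a b|.
  by apply: cvg_norm; apply: cvgB => //; apply: cvgM => //; exact: cvg_cst.
apply: (cvgr_to_le c3); apply: nearW => n.
exact: poincare_selected.
Qed.

Lemma poincare_hbox a b a' b' : box_lt a b -> hbox a' b' `<=` hbox a b ->
  `|Rintegral mu (hbox a' b') u - fine (mu (hbox a' b')) * avg a b|
    <= perim a b * Rintegral mu (hbox a b) gam.
Proof.
move=> ab sub.
(* testing the upper corner makes the choice exact on half-open boxes *)
apply: (@poincare_limit _ (fun c => [forall i, a' ord0 i <= c.2 ord0 i < b' ord0 i])) => //.
  exact: measurable_hbox.
move=> x xab; have [xin|xout] := boolP (x \in hbox a' b').
  move: xin; rewrite inE => /hboxP xin.
  pose e := \big[Num.min/1]_(i < d) (b' ord0 i - x ord0 i).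
  have e0 : 0 < e by apply: lt_bigmin => // i _; rewrite subr_gt0; have /andP[] := xin i.
  have := piece_small ab xab e0; apply: filterS => n h; apply/forallP => i.
  have [h1 h2 h3] := h i.
  have /andP[h4 h5] := xin i; rewrite (le_trans h4 (ltW h2))/=.
  have : e <= b' ord0 i - x ord0 i by apply: bigmin_le_cond.
  by move: h1 h2 h3; lra.
move: xout; rewrite notin_setE => /hboxP/existsNP[i /negP]; rewrite negb_and -ltNge -leNgt.
move=> /orP[h|h].
  have e0 : 0 < a' ord0 i - x ord0 i by rewrite subr_gt0.
  have := piece_small ab xab e0; apply: filterS => n /(_ i)[h1 h2 h3].
  by apply/negbTE/forallPn; exists i; rewrite negb_and -ltNge; apply/orP; left; lra.
have := piece_small ab xab ltr01; apply: filterS => n /(_ i)[h1 h2 h3].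
by apply/negbTE/forallPn; exists i; rewrite negb_and -leNgt; apply/orP; right; lra.
Qed.

(** An open set is the increasing union of the pieces that it contains. *)
Lemma poincare_open a b (A : set 'rV[R]_d) : box_lt a b -> measurable A -> open A ->
  A `<=` hbox a b ->
  `|Rintegral mu A u - fine (mu A) * avg a b|
    <= perim a b * Rintegral mu (hbox a b) gam.
Proof.
move=> ab mA oA AE.
apply: (@poincare_limit _ (fun c => `[< hbox c.1 c.2 `<=` A >])) => //.
move=> x xab; have [xin|xout] := boolP (x \in A).
  move: xin; rewrite inE => xin.
  have /nbhs_ballP[e /= e0 xeA] : nbhs x A by apply: open_nbhs_nbhs.
  have := piece_small ab xab e0; apply: filterS => n h; apply/asboolP => y /hboxP yc.
  apply: xeA; split => //= i j; rewrite ord1; have [h1 h2 h3] := h j.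
  by have /andP[h4 h5] := yc j; rewrite /ball/= ltr_norml; move: h1 h2 h3 h4 h5; lra.
apply: nearW => n; apply/negbTE; apply: contra xout => /asboolP h; rewrite inE.
by apply: h; exact: piece_mem.
Qed.

End poincare.

(** * Averages over balls and a dyadic Riesz potential *)

Section euclidean_balls.
Context {R : realType} (d : nat).
Local Notation mu := (lebesgue_rV d).
Implicit Types (x y : 'rV[R]_d) (r s : R).

Lemma coord_le_enorm x i : `|x ord0 i| <= enorm x.
Proof.
rewrite /enorm -sqrtr_sqr ler_sqrt; last by apply: sumr_ge0 => j _; exact: sqr_ge0.
by rewrite (bigD1 i)//= lerDl sumr_ge0// => j _; exact: sqr_ge0.
Qed.

Lemma enorm_le x s : 0 <= s -> (forall i, `|x ord0 i| <= s) -> enorm x <= d%:R * s.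
Proof.
move=> s0 xs; have ds0 : 0 <= d%:R * s by rewrite mulr_ge0.
rewrite -[leRHS]ger0_norm// -sqrtr_sqr ler_sqrt ?sqr_ge0//.
apply: le_trans (_ : \sum_(i < d) s ^+ 2 <= _).
  by apply: ler_sum => i _; rewrite -real_normK ?num_real// lerXn2r ?nnegrE.
rewrite sumr_const card_ord -[X in X <= _]mulr_natl exprMn ler_wpM2r ?sqr_ge0//.
by rewrite -natrX ler_nat; case: (d) => // m; rewrite leq_pmulr.
Qed.

Lemma eball_sub_Qb x r : eball x r `<=` Qb x r.
Proof.
move=> y /= yr; apply/QbP => i.
have := le_lt_trans (coord_le_enorm (y - x) i) yr.
by rewrite !mxE ltr_norml; lra.
Qed.

Lemma Qb_sub_eball x r s : 0 <= s -> d%:R * s < r -> Qb x s `<=` eball x r.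
Proof.
move=> s0 sr y /QbP yQ; apply: le_lt_trans sr; apply: enorm_le => // i.
by rewrite !mxE ler_norml; have := yQ i; lra.
Qed.

Lemma sum_sqr_continuous x :
  continuous (fun z : 'rV[R]_d => \sum_(i < d) (z - x) ord0 i ^+ 2).
Proof.
move=> y; apply: differentiable_continuous.
elim: (index_enum _) => [|i J IH].
  by under eq_fun do rewrite big_nil; exact: differentiable_cst.
rewrite (_ : (fun z : 'rV[R]_d => _) =
  (fun z : 'rV[R]_d => z ord0 i - x ord0 i : R^o) * (fun z => z ord0 i - x ord0 i : R^o) +
  (fun z => \sum_(i <- J) (z - x) ord0 i ^+ 2 : R^o)); last first.
  by apply/funext => z; rewrite big_cons !mxE expr2.
have dc : differentiable (fun z : 'rV[R]_d => z ord0 i - x ord0 i : R^o) y.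
  apply: (@differentiableB _ _ _ (fun z : 'rV[R]_d => z ord0 i : R^o) (fun=> x ord0 i : R^o)).
    exact: differentiable_coord.
  exact: differentiable_cst.
apply: differentiableD => //; exact: differentiableM.
Qed.

Lemma enorm_sub_continuous x : continuous (fun y : 'rV[R]_d => enorm (y - x)).
Proof.
move=> y; rewrite /enorm.
apply: (@continuous_comp _ _ _ (fun y : 'rV[R]_d => \sum_(i < d) (y - x) ord0 i ^+ 2) Num.sqrt);
  last exact: sqrt_continuous.
exact: sum_sqr_continuous.
Qed.

Lemma open_eball x r : open (eball x r).
Proof.
rewrite (_ : eball x r = (fun y => enorm (y - x)) @^-1` `]-oo, r[); last first.
  by apply/seteqP; split => y /=; rewrite in_itv.
apply: open_comp; last exact: lray_open.
by move=> y _; exact: enorm_sub_continuous.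
Qed.

Lemma measurable_eball x r : measurable (eball x r).
Proof.
have mf : measurable_fun setT (fun y : 'rV[R]_d => enorm (y - x)).
  apply: (measurableT_comp (continuous_measurable_fun (@sqrt_continuous R))).
  apply: measurable_sum => i.
  under eq_fun do rewrite !mxE.
  apply: measurable_funX; apply: measurable_funB => //.
  exact: measurable_coord.
rewrite (_ : eball x r = (fun y => enorm (y - x)) @^-1` `]-oo, r[); last first.
  by apply/seteqP; split => y /=; rewrite in_itv.
by rewrite -[X in measurable X]setTI; apply: mf => //; exact: measurable_itv.
Qed.

Lemma eball_measure x r : 0 < r ->
  mu (eball x r) \is a fin_num /\
  ((2 * r / d.+1%:R) ^+ d <= fine (mu (eball x r)) <= (2 * r) ^+ d).
Proof.
move=> r0; have s0 : 0 <= r / d.+1%:R by rewrite divr_ge0// ltW.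
have le1 : (((2 * (r / d.+1%:R)) ^+ d)%:E <= mu (eball x r))%E.
  rewrite -(lebesgue_Qb x)//; apply: le_measure; rewrite ?inE.
  - exact: measurable_Qb.
  - exact: measurable_eball.
  apply: Qb_sub_eball => //; rewrite mulrCA gtr_pMr//.
  by rewrite ltr_pdivrMr// mul1r ltr_nat.
have le2 : (mu (eball x r) <= ((2 * r) ^+ d)%:E)%E.
  rewrite -(lebesgue_Qb x); last exact: ltW.
  by apply: le_measure; rewrite ?inE; [exact: measurable_eball|exact: measurable_Qb|
    exact: eball_sub_Qb].
have fin : mu (eball x r) \is a fin_num by rewrite ge0_fin_numE// (le_lt_trans le2)// ltry.
by split => //; move: le1 le2; rewrite -(fineK fin) !lee_fin mulrA => -> ->.
Qed.

End euclidean_balls.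

Section chain.
Context {R : realType} (d : nat).
Local Notation mu := (lebesgue_rV d).
Implicit Types (x y : 'rV[R]_d) (r s : R).

Lemma box_lt_Qb x r : 0 < r ->
  box_lt (\row_i (x ord0 i - r)) (\row_i (x ord0 i + r)).
Proof. by move=> r0 i; rewrite !mxE; lra. Qed.

Lemma Qb_mono x r s : r <= s -> Qb x r `<=` Qb x s.
Proof. by move=> rs y /QbP h; apply/QbP => i; have := h i; lra. Qed.

Definition rk (k : nat) : R := 2^-1 ^+ k.

Lemma rk_gt0 k : 0 < rk k. Proof. by rewrite exprn_gt0. Qed.
Lemma rk_ge0 k : 0 <= rk k. Proof. by rewrite ltW// rk_gt0. Qed.
Lemma rk_le1 k : rk k <= 1.
Proof. by rewrite /rk exprn_ile1// invf_le1// ler1n. Qed.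
Lemma rkS k : 2 * rk k.+1 = rk k.
Proof. by rewrite /rk exprS mulrA divff// mul1r. Qed.

(** What a Sobolev function [u] contributes to the argument, with [gam] in the
    place of the length of its gradient: Borel measurability, local
    integrability and the halving inequality, from which every Poincare
    inequality below is derived. *)
Record gradient_bound (u gam : 'rV[R]_d -> R) : Prop := GradientBound {
  gb_mu : measurable_fun setT u ;
  gb_mg : measurable_fun setT gam ;
  gb_iu : forall a b, mu.-integrable (hbox a b) (EFin \o u) ;
  gb_ig : forall a b, mu.-integrable (hbox a b) (EFin \o gam) ;
  gb_g0 : forall x, 0 <= gam x ;
  gb_half : forall i (a b : 'rV[R]_d), (forall j, a ord0 j <= b ord0 j) ->
    `|Rintegral mu (hbox a (setc b i (mid a b i))) u -
      Rintegral mu (hbox (setc a i (mid a b i)) b) u|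
      <= (b ord0 i - a ord0 i) / 2 * Rintegral mu (hbox a b) gam }.

Variables (u gam : 'rV[R]_d -> R) (H : gradient_bound u gam).

Definition avgQ x r : R := Rintegral mu (Qb x r) u / (2 * r) ^+ d.

Definition avgB x r : R := Rintegral mu (eball x r) u / fine (mu (eball x r)).

Lemma volQ x r : vol (\row_i (x ord0 i - r)) (\row_i (x ord0 i + r)) = (2 * r) ^+ d.
Proof.
rewrite /vol (eq_bigr (fun=> 2 * r)) ?prodr_const ?card_ord// => i _.
by rewrite !mxE; ring.
Qed.

Lemma perimQ x r : perim (\row_i (x ord0 i - r)) (\row_i (x ord0 i + r)) = d%:R * (2 * r).
Proof.
rewrite /perim (eq_bigr (fun=> 2 * r)) ?sumr_const ?card_ord ?mulr_natl// => i _.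
by rewrite !mxE; ring.
Qed.

Lemma avg_Qb_diff x y r s : 0 < r -> 0 < s -> Qb y r `<=` Qb x s ->
  `|avgQ y r - avgQ x s| <= d%:R * (2 * s) / (2 * r) ^+ d * Rintegral mu (Qb x s) gam.
Proof.
move=> r0 s0 sub; have v0 : 0 < (2 * r) ^+ d by rewrite exprn_gt0// mulr_gt0.
have := poincare_hbox (gb_mu H) (gb_iu H) (gb_ig H) (gb_g0 H) (gb_half H) (box_lt_Qb x s0) sub.
rewrite -/(Qb x s) -/(Qb y r) lebesgue_Qb ?(ltW r0)// /avg volQ perimQ /= -/(Qb x s) => h.
rewrite mulrAC ler_pdivlMr// -[X in _ * X]gtr0_norm// -normrM mulrBl /avgQ.
by rewrite divfK ?gt_eqF// mulrC.
Qed.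

Lemma avg_eball_diff x y r s : 0 < r -> 0 < s -> eball y r `<=` Qb x s ->
  `|avgB y r - avgQ x s| <= d%:R * (2 * s) / (2 * r / d.+1%:R) ^+ d * Rintegral mu (Qb x s) gam.
Proof.
move=> r0 s0 sub.
have [fin /andP[v1 _]] := eball_measure y r0.
have w0 : 0 < (2 * r / d.+1%:R) ^+ d by rewrite exprn_gt0// divr_gt0// mulr_gt0.
have v0 := lt_le_trans w0 v1.
have := poincare_open (gb_mu H) (gb_iu H) (gb_ig H) (gb_g0 H) (gb_half H) (box_lt_Qb x s0)
  (measurable_eball y r) (@open_eball _ _ y r) sub.
rewrite -/(Qb x s) /avg volQ perimQ -/(Qb x s) => h.
have G0 : 0 <= d%:R * (2 * s) * Rintegral mu (Qb x s) gam.
  by rewrite mulr_ge0 ?Rintegral_ge0// => [|z _]; [rewrite mulr_ge0// mulr_ge0// ltW|exact: (gb_g0 H)].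
rewrite mulrAC; apply: le_trans (_ : d%:R * (2 * s) * Rintegral mu (Qb x s) gam / fine (mu (eball y r)) <= _).
  rewrite ler_pdivlMr// -[X in _ * X]gtr0_norm// -normrM mulrBl /avgB.
  by rewrite divfK ?gt_eqF// [X in _ - X]mulrC.
by rewrite ler_wpM2l// lef_pV2 ?posrE.
Qed.

(** [r^(1-d)] times the integral of [gam] over the cube of radius [r = rk k]:
    the sum over [k] is the dyadic form of the Riesz potential of order one. *)
Definition Gterm x k : R := rk k / rk k ^+ d * Rintegral mu (Qb x (rk k)) gam.

Lemma Gterm_ge0 x k : 0 <= Gterm x k.
Proof.
rewrite /Gterm mulr_ge0 ?Rintegral_ge0// ?divr_ge0 ?exprn_ge0 ?rk_ge0// => z _.
exact: (gb_g0 H).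
Qed.

Definition Cd : R := (2 * d)%:R * d.+1%:R ^+ d.

Lemma Cd_ge : (2 * d)%:R <= Cd.
Proof.
by rewrite /Cd ler_peMr// exprn_ege1// ler1n.
Qed.

Lemma Cd_ge0 : 0 <= Cd.
Proof. by rewrite mulr_ge0// exprn_ge0. Qed.

Lemma avgQ_chain x n : `|avgQ x (rk n) - avgQ x 1| <= Cd * \sum_(k < n) Gterm x k.
Proof.
elim: n => [|n IH].
  by rewrite /rk expr0 subrr normr0 big_ord0 mulr0.
rewrite big_ord_recr/= mulrDr.
have -> : avgQ x (rk n.+1) - avgQ x 1 =
  (avgQ x (rk n) - avgQ x 1) + (avgQ x (rk n.+1) - avgQ x (rk n)) by ring.
apply: le_trans (ler_normD _ _) (lerD IH _).
have le : rk n.+1 <= rk n by rewrite -(rkS n); have := rk_ge0 n.+1; lra.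
apply: le_trans (avg_Qb_diff (rk_gt0 _) (rk_gt0 _) (Qb_mono le)) _.
rewrite rkS; apply: le_trans (_ : (2 * d)%:R * Gterm x n <= _); last first.
  by rewrite ler_wpM2r ?Gterm_ge0// Cd_ge.
rewrite le_eqVlt; apply/orP; left; apply/eqP; rewrite /Gterm natrM.
by ring.
Qed.

Lemma dyadic_scale r : 0 < r <= 1 -> exists n, rk n.+1 < r <= rk n.
Proof.
move=> /andP[r0 r1]; have ex : exists n, rk n.+1 < r.
  exists (Num.bound r^-1); rewrite /rk exprVn invf_plt ?posrE ?exprn_gt0//.
  apply: lt_trans (archi_boundP _) _; first by rewrite invr_ge0 ltW.
  by rewrite -natrX ltr_nat; apply: ltn_trans (ltn_expl _ _); rewrite // ltnS.
case: (ex_minnP ex) => -[|n] nr nmin.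
  by exists 0%N; rewrite nr /rk expr0.
exists n.+1; rewrite nr/= leNgt; apply/negP => /nmin.
by rewrite ltnn.
Qed.

(** Telescoping over the dyadic cubes centred at [x]: each step costs one term
    of the dyadic Riesz potential, and a ball of radius [r] is compared with
    the smallest dyadic cube of radius at least [r]. *)
Lemma avgB_bound x (A : R) : (forall n, \sum_(k < n) Gterm x k <= A) ->
  forall r, 0 < r <= 1 -> `|avgB x r - avgQ x 1| <= Cd * A.
Proof.
move=> GA r r01; have [n /andP[rn1 rn]] := dyadic_scale r01.
have /andP[r0 r1] := r01.
apply: le_trans (_ : Cd * \sum_(k < n.+1) Gterm x k <= _); last first.
  by rewrite ler_wpM2l ?Cd_ge0.
rewrite big_ord_recr/= mulrDr.
have -> : avgB x r - avgQ x 1 =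
  (avgQ x (rk n) - avgQ x 1) + (avgB x r - avgQ x (rk n)) by ring.
apply: le_trans (ler_normD _ _) (lerD (avgQ_chain _ _) _).
have sub : eball x r `<=` Qb x (rk n).
  by apply: subset_trans (Qb_mono rn); exact: eball_sub_Qb.
apply: le_trans (avg_eball_diff r0 (rk_gt0 _) sub) _.
rewrite /Gterm [leRHS]mulrA ler_wpM2r//; first by apply: Rintegral_ge0 => z _; exact: (gb_g0 H).
have d0 : (0 : R) < d.+1%:R by rewrite ltr0n.
have -> : Cd * (rk n / rk n ^+ d) = d%:R * (2 * rk n) / (rk n / d.+1%:R) ^+ d.
  rewrite /Cd natrM expr_div_n; field.
  by rewrite !expf_neq0 ?gt_eqF ?rk_gt0.
rewrite ler_wpM2l ?mulr_ge0 ?rk_ge0// lef_pV2 ?posrE ?exprn_gt0 ?divr_gt0 ?mulr_gt0 ?rk_gt0//.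
rewrite lerXn2r ?nnegrE ?divr_ge0 ?mulr_ge0 ?rk_ge0 ?(ltW r0)// ler_pM2r ?invr_gt0//.
by rewrite -rkS ler_pM2l// ltW.
Qed.

End chain.

(** * Muckenhoupt weights *)

Section weights.
Context {R : realType} (d : nat).
Local Notation mu := (lebesgue_rV d).
Implicit Types (x y : 'rV[R]_d) (r s : R).

(** A pointwise form of Hoelder's inequality with three factors. If [t] is the
    sum of the three terms on the right, then [g^p w <= H t],
    [be^(q-1) <= t^(q-1)] and [1 <= (e t)^(p-q)], and the product of these
    bounds is a multiple of [t^p]. It is used with terms that integrate to at
    most [1] each. *)
Lemma three_term_bound (p q g w be D H e : R) : 1 <= q -> q < p ->
  0 <= g -> 0 < w -> 0 <= be -> 0 < D -> 0 < H -> 0 < e ->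
  1 <= D * w * be `^ (q - 1) ->
  g <= (H * D * e `^ (p - q)) `^ p^-1 * (g `^ p * w / H + be + e^-1).
Proof.
move=> q1 qp g0 w0 be0 D0 H0 e0 h.
have p0 : 0 < p by lra.
pose t := g `^ p * w / H + be + e^-1.
have a0 : 0 <= g `^ p * w / H by rewrite divr_ge0 ?mulr_ge0 ?powR_ge0 ?ltW.
have ei0 : 0 < e^-1 by rewrite invr_gt0.
have t0 : 0 < t by rewrite /t; lra.
have et : 1 <= e * t by rewrite -ler_pdivrMl// mulr1 /t; lra.
have rootK (z : R) : 0 <= z -> (z `^ p) `^ p^-1 = z.
  by move=> z0; rewrite -powRrM divff ?gt_eqF// powRr1.
have K0 : 0 <= H * D * e `^ (p - q) by rewrite !mulr_ge0 ?powR_ge0 ?ltW.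
rewrite -/t -[leLHS]rootK// -[X in _ * X](rootK t) ?(ltW t0)//.
rewrite -powRM ?powR_ge0//.
apply: ge0_ler_powR; rewrite ?nnegrE ?invr_ge0 ?mulr_ge0 ?powR_ge0 ?(ltW p0)//; try exact: ltW.
have -> : t `^ p = t `^ q * t `^ (p - q).
  by rewrite -powRD ?(gt_eqF t0) ?implybT//; congr (_ `^ _); ring.
have -> : H * D * e `^ (p - q) * (t `^ q * t `^ (p - q)) =
   H * D * t `^ q * (e * t) `^ (p - q).
  by rewrite powRM ?(ltW e0) ?(ltW t0)//; ring.
apply: le_trans (_ : H * D * t `^ q <= _); last first.
  rewrite ler_peMr ?mulr_ge0 ?powR_ge0 ?(ltW H0) ?(ltW D0)//.
  by rewrite -[leLHS](powRr0 (e * t)); apply: ler_powR => //; lra.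
have tq : t `^ q = t * t `^ (q - 1).
  by rewrite mulr_powRB1 ?(ltW t0)//; lra.
have b1 : be `^ (q - 1) <= t `^ (q - 1).
  by apply: ge0_ler_powR; rewrite ?nnegrE ?subr_ge0 ?(ltW t0)// /t; lra.
have b2 : g `^ p * w <= H * t by rewrite -ler_pdivrMl// mulrC /t; lra.
apply: le_trans (_ : g `^ p * (D * w * be `^ (q - 1)) <= _).
  by rewrite ler_peMr ?powR_ge0.
rewrite tq; have -> : g `^ p * (D * w * be `^ (q - 1)) = D * ((g `^ p * w) * be `^ (q - 1)) by ring.
have -> : H * D * (t * t `^ (q - 1)) = D * ((H * t) * t `^ (q - 1)) by ring.
rewrite ler_wpM2l ?(ltW D0)// ler_pM ?powR_ge0 ?mulr_ge0 ?powR_ge0//.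
exact: ltW.
Qed.

(** The dual form of the Muckenhoupt condition, in one statement for [q = 1]
    and [q > 1]. For [q > 1], [be] is the power [w^(-1/(q-1))] divided by a bound
    for its integral over the ball; for [q = 1] the factor [be^(q-1)] equals [1]
    and the inequality bounds [w] from below by its average. *)
Record dual_weight (q C : R) (w : 'rV[R]_d -> R) : Prop := DualWeight {
  dw_C : 0 < C ;
  dw_m : measurable_fun setT w ;
  dw_gt0 : forall x, 0 < w x ;
  dw_int : forall a b, mu.-integrable (hbox a b) (EFin \o w) ;
  dw_dual : forall (x : 'rV[R]_d) (r : R) (F : set 'rV[R]_d), 0 < r ->
    measurable F -> F `<=` eball x r -> 0 < Rintegral mu F w ->
    exists be : 'rV[R]_d -> R, [/\ measurable_fun setT be, forall y, 0 <= be y,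
      (\int[mu]_(y in eball x r) (be y)%:E <= 1)%E &
      {ae mu, forall y, eball x r y ->
        1 <= C * fine (mu (eball x r)) `^ q / Rintegral mu F w * w y * be y `^ (q - 1)}] }.

(** Up to constants, [(int_E gam)^p w(F) <= |E|^(p-q) |B|^q int_E gam^p w] for
    subsets [E] and [F] of a ball [B]. Keeping [F] apart from [E] is what allows
    the mass of the weight to be read off a whole block while [gam] is
    integrated over a small cube. The factor [3] counts the three terms of
    [three_term_bound]. *)
Lemma weighted_holder (p q C : R) (w gam : 'rV[R]_d -> R) (x : 'rV[R]_d) (r H : R)
    (E F : set 'rV[R]_d) : dual_weight q C w -> 1 <= q -> q < p -> 0 < r ->
  measurable_fun setT gam -> (forall y, 0 <= gam y) ->
  measurable E -> E `<=` eball x r -> 0 < fine (mu E) ->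
  measurable F -> F `<=` eball x r -> 0 < Rintegral mu F w -> 0 < H ->
  (\int[mu]_(y in E) (gam y `^ p * w y)%:E <= H%:E)%E ->
  (\int[mu]_(y in E) (gam y)%:E <=
   (3 * (H * (C * fine (mu (eball x r)) `^ q / Rintegral mu F w)
         * fine (mu E) `^ (p - q)) `^ p^-1)%:E)%E.
Proof.
move=> dw q1 qp r0 mg g0 mE Er e0 mF Fr W0 H0 hH.
have [be [mb b0 ib hb]] := dw_dual dw r0 mF Fr W0.
have [finB /andP[B0 _]] := eball_measure x r0.
have B1 : 0 < fine (mu (eball x r)).
  by apply: lt_le_trans B0; rewrite exprn_gt0// divr_gt0// mulr_gt0.
set D := C * _ / _.
have D0 : 0 < D by rewrite divr_gt0// mulr_gt0 ?(dw_C dw)// powR_gt0.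
set e := fine (mu E); rewrite -/e in e0.
have finE : mu E \is a fin_num.
  rewrite ge0_fin_numE//; apply: le_lt_trans (_ : mu (eball x r) < +oo)%E.
    by apply: le_measure => //; rewrite inE//; exact: measurable_eball.
  by rewrite -ge0_fin_numE.
set M := (H * D * e `^ (p - q)) `^ p^-1.
have M0 : 0 <= M by exact: powR_ge0.
have mh : measurable_fun setT (fun y => gam y `^ p * w y).
  apply: measurable_funM; last exact: dw_m dw.
  exact: (measurableT_comp (measurable_powR p)).
pose a y := gam y `^ p * w y / H.
have ma : measurable_fun setT a by apply: measurable_funM.
have a0 y : 0 <= a y.
  by rewrite divr_ge0 ?(ltW H0)// mulr_ge0 ?powR_ge0// ltW// (dw_gt0 dw).
have e1 : 0 <= e^-1 by rewrite invr_ge0 ltW.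
apply: (@le_trans _ _ (\int[mu]_(y in E) (M%:E * ((a y)%:E + (be y)%:E + e^-1%:E)))%E).
  apply: ae_ge0_le_integral => //.
  - by move=> y _; rewrite lee_fin.
  - by apply/measurable_EFinP; exact: measurable_funTS.
  - by move=> y _; rewrite mule_ge0 ?lee_fin// !addr_ge0.
  - apply: measurable_funeM; apply: emeasurable_funD; last exact: measurable_cst.
    by apply: emeasurable_funD; apply/measurable_EFinP; exact: measurable_funTS.
  apply: filterS hb => y hy Ey; rewrite -!EFinD -EFinM lee_fin.
  apply: three_term_bound => //; first exact: dw_gt0 dw _.
  exact/hy/Er.
rewrite ge0_integralZl//; last first.
- by move=> y _; rewrite !adde_ge0 ?lee_fin.
- apply: emeasurable_funD; last exact: measurable_cst.
  by apply: emeasurable_funD; apply/measurable_EFinP; exact: measurable_funTS.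
rewrite mulrC EFinM lee_wpmul2l ?lee_fin//.
rewrite ge0_integralD//; last first.
- by apply: emeasurable_funD; apply/measurable_EFinP; exact: measurable_funTS.
- by move=> y _; rewrite adde_ge0 ?lee_fin.
rewrite ge0_integralD//; try (by move=> y _; rewrite lee_fin);
  try (by apply/measurable_EFinP; exact: measurable_funTS).
have -> : 3%:E = (1 + 1 + 1)%:E%E :> \bar R by congr EFin; ring.
rewrite !EFinD; apply: leeD; first apply: leeD.
- rewrite /a; under eq_integral do rewrite mulrC EFinM.
  have mhE : measurable_fun E (fun y => (gam y `^ p * w y)%:E).
    by apply/measurable_EFinP; exact: measurable_funTS.
  have hp y : E y -> (0 <= (gam y `^ p * w y)%:E)%E.
    by rewrite lee_fin mulr_ge0 ?powR_ge0// ltW// (dw_gt0 dw).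
  rewrite ge0_integralZl ?lee_fin ?invr_ge0 ?(ltW H0)//.
  rewrite -lee_pdivlMl ?invr_gt0// invrK mule1 //.
- apply: le_trans ib; apply: ge0_subset_integral => //.
  + exact: measurable_eball.
  + by apply/measurable_EFinP; exact: measurable_funTS.
  + by move=> y _; rewrite lee_fin.
- by rewrite integral_cst// -(fineK finE) -EFinM lee_fin mulVf ?gt_eqF.
Qed.

End weights.

(** * Integrals over moving cubes *)

Section moving_cubes.
Context {R : realType}.

Lemma geometric_nneseries (c z : R) : 0 <= z < 1 ->
  (\sum_(k <oo) (c * z ^+ k)%:E = (c / (1 - z))%:E)%E.
Proof.
move=> /andP[z0 z1]; apply: cvg_lim => //.
have := @cvg_geometric_series R c z; rewrite ger0_norm// => /(_ z1) hc.
rewrite (_ : (fun k => _) = EFin \o series (geometric c z))%R.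
  by apply/cvg_EFin; [exact: nearW|exact: hc].
by apply/funext => k /=; rewrite sumEFin.
Qed.

Lemma measurable_near m l (phi : 'I_m -> 'I_l) (s : R) :
  measurable [set v : 'rV[R]_m * 'rV[R]_l | forall i,
    v.1 ord0 i - s <= v.2 ord0 (phi i) < v.1 ord0 i + s].
Proof.
rewrite (_ : mkset _ = \big[setI/setT]_(i < m)
  ((fun v : 'rV[R]_m * 'rV[R]_l => v.2 ord0 (phi i) - v.1 ord0 i) @^-1` `[- s, s[)).
  apply: bigsetI_measurable => i _; rewrite -[X in measurable X]setTI.
  have mf : measurable_fun setT (fun v : 'rV[R]_m * 'rV[R]_l =>
     v.2 ord0 (phi i) - v.1 ord0 i).
    apply: measurable_funB.
      by apply: (measurableT_comp (measurable_coord _)); exact: measurable_snd.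
    by apply: (measurableT_comp (measurable_coord _)); exact: measurable_fst.
  by apply: mf => //; exact: measurable_itv.
rewrite -bigcap_seq; apply/seteqP; split => -[x y] /=.
  by move=> h i _ /=; have := h i; rewrite in_itv/=; lra.
move=> h i; have := h i; rewrite /= mem_index_enum in_itv/=.
by move=> /(_ isT); lra.
Qed.

Definition cube_rel d (s : R) : set ('rV[R]_d * 'rV[R]_d) := [set v | Qb v.1 s v.2].

Lemma measurable_cube_rel d s : measurable (@cube_rel d s).
Proof.
have := @measurable_near d d id s; congr measurable.
by apply/seteqP; split => v /QbP.
Qed.

Local Open Scope ereal_scope.

Lemma integral_Qb_indic d (f : 'rV[R]_d -> R) s x :
  \int[lebesgue_rV d]_(y in Qb x s) (f y)%:E =
  \int[lebesgue_rV d]_y (f y * \1_(cube_rel s) (x, y))%:E.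
Proof.
rewrite integral_mkcond; apply: eq_integral => y _; rewrite /patch indicE.
have -> : ((x, y) \in cube_rel s) = (y \in Qb x s) by apply/idP/idP; rewrite !inE.
by case: ifP; rewrite ?mulr1 ?mulr0.
Qed.

Lemma measurable_integral_Qb d (f : 'rV[R]_d -> R) s : measurable_fun setT f ->
  (forall y, (0 <= f y)%R) ->
  measurable_fun setT (fun x => \int[lebesgue_rV d]_(y in Qb x s) (f y)%:E).
Proof.
move=> mf f0; under eq_fun do rewrite integral_Qb_indic.
apply: (@measurable_integral_rV _ _ _ (fun v => (f v.2 * \1_(cube_rel s) v)%:E)).
  apply/measurable_EFinP; apply: measurable_funM.
    by apply: (measurableT_comp mf); exact: measurable_snd.
  by apply: measurable_indic; exact: measurable_cube_rel.
by move=> v; rewrite lee_fin mulr_ge0.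
Qed.

Lemma measurable_Rintegral_Qb d (f : 'rV[R]_d -> R) s : measurable_fun setT f ->
  (forall y, (0 <= f y)%R) ->
  measurable_fun setT (fun x => Rintegral (lebesgue_rV d) (Qb x s) f).
Proof.
by move=> mf f0; apply: (measurableT_comp (fine_measurable measurableT)); exact: measurable_integral_Qb.
Qed.

End moving_cubes.

(** * Fractional integrals along vertical lines *)

Section vertical.
Context {R : realType} (n : nat).
Local Notation mu := (lebesgue_rV n.+1).
Local Notation nu := (lebesgue_rV n).

Definition hor (y : 'rV[R]_n.+1) : 'rV[R]_n := \row_i y ord0 (widen_ord (leqnSn n) i).

Lemma vcat_widen (x : 'rV[R]_n) (t : R) i :
  @vcat R n.+1 x t ord0 (widen_ord (leqnSn n) i) = x ord0 i.
Proof.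
rewrite /vcat mxE/= insubT//= => lt.
by congr (x _ _); apply/val_inj.
Qed.

Lemma vcat_last (x : 'rV[R]_n) (t : R) : @vcat R n.+1 x t ord0 ord_max = t.
Proof. by rewrite /vcat mxE/= insubF//= ltnn. Qed.

Lemma ord_widen_max (i : 'I_n.+1) : i = ord_max \/ exists j : 'I_n, i = widen_ord (leqnSn n) j.
Proof.
have [ni|ni] := ltnP i n; last first.
  by left; apply/val_inj/eqP; rewrite eqn_leq/= ni -ltnS ltn_ord.
by right; exists (Ordinal ni); apply/val_inj.
Qed.

Lemma Qb_vcat (x : 'rV[R]_n) (t r : R) y :
  Qb (@vcat R n.+1 x t) r y <-> Qb x r (hor y) /\ t - r <= y ord0 ord_max < t + r.
Proof.
split.
  move=> /QbP h; split; last by have := h ord_max; rewrite vcat_last.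
  by apply/QbP => i; have := h (widen_ord (leqnSn n) i); rewrite vcat_widen mxE.
move=> [/QbP h1 h2]; apply/QbP => i; have [->|[j ->]] := ord_widen_max i.
  by rewrite vcat_last.
by have := h1 j; rewrite vcat_widen mxE.
Qed.

Definition nearset (r : R) : set ('rV[R]_n * 'rV[R]_n.+1) := [set z | Qb z.1 r (hor z.2)].

Lemma measurable_nearset r : measurable (nearset r).
Proof.
have := @measurable_near R _ _ (widen_ord (leqnSn n)) r; congr measurable.
by apply/seteqP; split => v; [move=> h; apply/QbP => i; rewrite mxE
  |move=> /QbP h i; have := h i; rewrite mxE].
Qed.

Local Open Scope ereal_scope.

Definition upper (N : nat) := [set y : 'rV[R]_n.+1 | (N%:R <= y ord0 ord_max)%R].

Lemma measurable_upper N : measurable (upper N).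
Proof.
rewrite (_ : upper N = (fun y : 'rV[R]_n.+1 => y ord0 ord_max) @^-1` `[N%:R, +oo[).
  by rewrite -[X in measurable X]setTI; apply: measurable_coord => //; exact: measurable_itv.
by apply/seteqP; split => y /=; rewrite in_itv/= andbT.
Qed.

Lemma tail_small (F : 'rV[R]_n.+1 -> \bar R) (e : R) : measurable_fun setT F ->
  (forall y, 0 <= F y) -> \int[mu]_y F y < +oo -> (0 < e)%R ->
  exists N, \int[mu]_(y in upper N) F y <= e%:E.
Proof.
move=> mF F0 finx e0.
have iF : mu.-integrable setT F.
  by apply/integrableP; split => //; under eq_integral => y _ do rewrite gee0_abs//.
have mFA N : measurable_fun setT (F \_ (upper N)).
  by apply/(measurable_restrictT _ _).1; [exact: measurable_upper|exact: measurable_funTS].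
have [] // := @dominated_convergence _ _ _ mu setT measurableT
    (fun N => F \_ (upper N)) (cst 0) F mFA (@measurable_cst _ _ _ _ _ _) _ iF _.
- apply: aeW => y _; apply: cvg_near_cst; near=> N.
  rewrite /patch ifF//; apply/negbTE; rewrite notin_setE /upper/=; apply/negP.
  rewrite -ltNge; near: N; exact: nbhs_infty_gtr.
- apply: aeW => y N _; rewrite /patch; case: ifP => _; first by rewrite gee0_abs.
  by rewrite (_ : point = 0 :> \bar R)// abse0.
move=> _ _ cv.
have cv0 : \int[mu]_y (F \_ (upper N)) y @[N --> \oo] --> 0%:E by rewrite integral0 in cv.
have /fine_cvgP[finN cvN] := cv0.
have hlt := cvgr0_norm_lt _ cvN _ e0.
have [N [fN hN]] := filter_ex (filterI finN (hlt _)).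
exists N; rewrite integral_mkcond -(fineK fN) lee_fin; apply/ltW; apply: le_lt_trans hN.
exact: ler_norm.
Unshelve. all: by end_near. Qed.

Variables (b : R) (h : 'rV[R]_n.+1 -> R).
Hypothesis b0 : (0 < b)%R.
Hypothesis bn : (b < 2 ^+ n)%R.
Hypothesis mh : measurable_fun setT h.
Hypothesis h0 : forall y, (0 <= h y)%R.
Hypothesis ih : \int[mu]_y (h y)%:E < +oo.

(** The kernel does not depend on the height of the second point, so a single
    integral against it controls a whole vertical line. *)
Definition kern (z : 'rV[R]_n * 'rV[R]_n.+1) : \bar R :=
  \sum_(k <oo) (b ^+ k * \1_(nearset (rk k)) z)%:E.

Lemma kern_term_ge0 k z : 0 <= (b ^+ k * \1_(nearset (rk k)) z)%:E.
Proof. by rewrite lee_fin mulr_ge0// exprn_ge0// ltW. Qed.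

Lemma kern_ge0 z : 0 <= kern z.
Proof. by apply: nneseries_ge0 => k _ _; exact: kern_term_ge0. Qed.

Lemma measurable_kern_term k : measurable_fun setT (fun z => (b ^+ k * \1_(nearset (rk k)) z)%:E).
Proof.
apply/measurable_EFinP; apply: measurable_funM => //.
by apply: measurable_indic; exact: measurable_nearset.
Qed.

Lemma measurable_kern : measurable_fun setT kern.
Proof.
apply: ge0_emeasurable_sum => [k z _ _|k _]; first exact: kern_term_ge0.
exact: measurable_kern_term.
Qed.

(** The [x] that see [y] at scale [rk k] form a cube of volume of order [2^(-n k)],
    and [b < 2^n]. *)
Lemma integral_kern_le (y : 'rV[R]_n.+1) :
  \int[nu]_x kern (x, y) <= (4 ^+ n * (1 - b / 2 ^+ n)^-1)%:E.
Proof.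
have m1 : measurable_fun setT (fun x : 'rV[R]_n => (x, y)) by exact: measurable_pair2.
rewrite /kern integral_nneseries//; last 2 first.
- by move=> k; exact: (measurableT_comp (measurable_kern_term k) m1).
- by move=> k x _; exact: kern_term_ge0.
have q01 : (0 <= b / 2 ^+ n < 1)%R.
  by rewrite divr_ge0 ?(ltW b0) ?exprn_ge0//= ltr_pdivrMr ?exprn_gt0// mul1r.
apply: le_trans (_ : \sum_(k <oo) (4 ^+ n * (b / 2 ^+ n) ^+ k)%:E <= _); last first.
  by rewrite geometric_nneseries.
apply: lee_nneseries => [k _ _|k _].
  by apply: integral_ge0 => x _; exact: kern_term_ge0.
under eq_integral do rewrite EFinM.
have mA : measurable [set x | nearset (rk k) (x, y)].
  rewrite -[X in measurable X]setTI.
  exact: (m1 measurableT _ (measurable_nearset (rk k))).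
have bk0 : (0 <= b ^+ k)%R by rewrite exprn_ge0// ltW.
rewrite ge0_integralZl ?lee_fin//; last 1 first.
  by apply/measurable_EFinP; exact: (measurableT_comp (measurable_indic (measurable_nearset (rk k))) m1).
rewrite (_ : (fun x => _) = (fun x => (\1_[set x | nearset (rk k) (x, y)] x)%:E)); last first.
  by apply/funext => x; rewrite !indicE; congr (_%:R%:E)%R; apply/idP/idP; rewrite !inE.
rewrite integral_indic// setIT.
have le : nu [set x | nearset (rk k) (x, y)] <= ((2 * (2 * rk k)) ^+ n)%:E.
  rewrite -(lebesgue_Qb (hor y)); last by rewrite mulr_ge0// rk_ge0.
  apply: le_measure; rewrite ?inE//; first exact: measurable_Qb.
  move=> x /= /QbP hx; apply/QbP => i; have := hx i; have := @rk_gt0 R k; lra.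
apply: le_trans (lee_wpmul2l _ le) _; first by rewrite lee_fin.
rewrite -EFinM lee_fin le_eqVlt; apply/orP; left; apply/eqP.
rewrite mulrA -natrM/= exprMn mulrCA; congr (_ * _)%R.
by rewrite expr_div_n -exprM mulnC /rk -exprM exprVn.
Qed.

Lemma kern_finite_ae : {ae nu, forall x, \int[mu]_y ((h y)%:E * kern (x, y)) < +oo}.
Proof.
pose f (z : 'rV[R]_n * 'rV[R]_n.+1) := (h z.2)%:E * kern z.
have mf : measurable_fun setT f.
  apply: emeasurable_funM; last exact: measurable_kern.
  by apply/measurable_EFinP; apply: (measurableT_comp mh); exact: measurable_snd.
have f0 z : 0 <= f z by rewrite mule_ge0 ?lee_fin ?kern_ge0.
have fin : \int[nu]_x \int[mu]_y f (x, y) < +oo.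
  rewrite tonelli_rV//.
  apply: (@le_lt_trans _ _ (\int[mu]_y ((h y)%:E * (4 ^+ n * (1 - b / 2 ^+ n)^-1)%:E))).
    apply: ge0_le_integral => //.
    - by move=> y _; apply: integral_ge0.
    - exact: measurable_integral_rV_l.
    - by apply: emeasurable_funM => //; exact/measurable_EFinP.
    - move=> y _; rewrite /f/= ge0_integralZl ?lee_fin//; last 2 first.
      + apply: (measurableT_comp measurable_kern); exact: measurable_pair2.
      + by move=> x _; exact: kern_ge0.
      by rewrite lee_wpmul2l ?lee_fin// integral_kern_le.
  rewrite ge0_integralZr//; last 3 first.
  - exact/measurable_EFinP.
  - by move=> y _; rewrite lee_fin.
  - by rewrite lee_fin mulr_ge0 ?exprn_ge0// invr_ge0 subr_ge0 ltW// ltr_pdivrMr ?exprn_gt0// mul1r.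
  have : \int[mu]_y (h y)%:E \is a fin_num.
    by rewrite ge0_fin_numE//; apply: integral_ge0 => y _; rewrite lee_fin.
  by move=> /fineK <-; rewrite -EFinM ltry.
have iF : nu.-integrable setT (fun x => \int[mu]_y f (x, y)).
  apply/integrableP; split; first exact: measurable_integral_rV.
  under eq_integral => x _ do rewrite gee0_abs ?integral_ge0//.
  exact: fin.
have := integrable_ae measurableT iF; apply: filterS => x /(_ Logic.I).
by rewrite ge0_fin_numE//; exact: integral_ge0.
Qed.

(** For almost every [x], a kernel-weighted integral of [h] is finite over the
    whole space, so its tails above height [t] vanish, and they control the
    integrals of [h] over all cubes centred at [(x, t)]. *)
Lemma small_cubes_ae : {ae nu, forall x, forall e : R, (0 < e)%R ->
  exists T : R, forall t, (T <= t)%R -> forall k,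
    (b ^+ k)%:E * \int[mu]_(y in Qb (@vcat R n.+1 x t) (rk k)) (h y)%:E <= e%:E}.
Proof.
have := kern_finite_ae; apply: filterS => x finx e e0.
pose F y := (h y)%:E * kern (x, y).
have mF : measurable_fun setT F.
  apply: emeasurable_funM; first exact/measurable_EFinP.
  by apply: (measurableT_comp measurable_kern); exact: measurable_pair1.
have F0 y : 0 <= F y by rewrite mule_ge0 ?lee_fin ?kern_ge0.
have iF : mu.-integrable setT F.
  by apply/integrableP; split => //; under eq_integral => y _ do rewrite gee0_abs//.
have [N hN] := tail_small mF F0 finx e0.
exists (N%:R + 1)%R => t Nt k.
have bk0 : (0 <= b ^+ k)%R by rewrite exprn_ge0// ltW.
have mQ := measurable_Qb (@vcat R n.+1 x t) (rk k).
rewrite -ge0_integralZl ?lee_fin//; last 2 first.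
- by apply/measurable_EFinP; exact: measurable_funTS.
- by move=> y _; rewrite lee_fin.
have mFA : measurable_fun setT (F \_ (upper N)).
  by apply/(measurable_restrictT _ _).1; [exact: measurable_upper|exact: measurable_funTS].
apply: le_trans hN; rewrite integral_mkcond [leRHS]integral_mkcond.
apply: ge0_le_integral => //.
- by move=> y _; apply: erestrict_ge0 => z _; rewrite mule_ge0 ?lee_fin.
- apply/(measurable_restrictT _ _).1 => //; apply: measurable_funeM.
  by apply/measurable_EFinP; exact: measurable_funTS.
move=> y _; rewrite /patch; case: ifPn => yQ; last by case: ifP.
move: yQ; rewrite inE => /Qb_vcat[yQ /andP[ty _]].
rewrite ifT; last first.
  rewrite inE /upper/=; apply: le_trans ty.
  have : (rk k <= 1 :> R)%R by exact: rk_le1.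
  by lra.
rewrite muleC /F lee_wpmul2l ?lee_fin//.
apply: le_trans (_ : \sum_(0 <= i < k.+1) (b ^+ i * \1_(nearset (rk i)) (x, y))%:E <= _).
  rewrite big_nat_recr//=; apply: le_trans (_ : (b ^+ k * \1_(nearset (rk k)) (x, y))%:E <= _).
    by rewrite indicE mem_set// mulr1.
  by rewrite leeDr//; apply: sume_ge0 => i _; exact: kern_term_ge0.
by apply: nneseries_lim_ge => i _ _; exact: kern_term_ge0.
Qed.

End vertical.

(** * Oscillation on unit blocks *)

Section blocks.
Context {R : realType} (n : nat).
Local Notation d := n.+1.
Local Notation mu := (lebesgue_rV d).
Implicit Types (a : 'rV[R]_n) (x y : 'rV[R]_d) (z : nat).

Definition ctr a (t : R) : 'rV[R]_d := @vcat R d a t.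

Definition block a z : set 'rV[R]_d := @vblock R d (cube a 1) z.

Lemma blockP a z y : block a z y <->
  cube a 1 (hor y) /\ z%:R <= y ord0 ord_max <= z%:R + 1.
Proof.
split.
  move=> [x [t [xQ tz ->]]]; rewrite vcat_last; split=> //.
  by rewrite (_ : hor _ = x)//; apply/rowP => i; rewrite mxE vcat_widen.
move=> [yQ yz]; exists (hor y), (y ord0 ord_max); split=> //.
apply/rowP => i; have [->|[j ->]] := ord_widen_max i; first by rewrite vcat_last.
by rewrite vcat_widen mxE.
Qed.

Lemma block_rect a z : block a z = rect (fun i =>
  `[ctr a z%:R ord0 i, ctr a z%:R ord0 i + 1]%classic).
Proof.
apply/seteqP; split => y.
  move=> /blockP[yQ yz] i /=; rewrite in_itv/=.
  have [->|[j ->]] := ord_widen_max i; first by rewrite vcat_last.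
  by rewrite vcat_widen; have := yQ j; rewrite mxE.
move=> h; apply/blockP; split.
  by move=> j; have := h (widen_ord (leqnSn n) j); rewrite /= in_itv/= vcat_widen mxE.
by have := h ord_max; rewrite /= in_itv/= vcat_last.
Qed.

Lemma measurable_block a z : measurable (block a z).
Proof. by rewrite block_rect; apply: measurable_rect => i; exact: measurable_itv. Qed.

Lemma block_center a z y : block a z y ->
  forall i, ctr a z%:R ord0 i <= y ord0 i <= ctr a z%:R ord0 i + 1.
Proof. by rewrite block_rect => h i; have := h i; rewrite /= in_itv. Qed.

(** The radius of a ball that contains the cube of radius [2] with the same
    centre, for every dimension. *)
Definition rho : R := (2 * d + 1)%:R.

Lemma rho_gt0 : 0 < rho. Proof. by rewrite ltr0n addn1. Qed.

Lemma Qb2_eball x : Qb x 2 `<=` eball x rho.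
Proof.
apply: Qb_sub_eball => //; rewrite /rho natrD natrM mulrC.
by rewrite ltrDl.
Qed.

Lemma block_Qb2 a z : block a z `<=` Qb (ctr a z%:R) 2.
Proof. by move=> y /block_center h; apply/QbP => i; have := h i; lra. Qed.

Lemma Qb_block a z x r : block a z x -> 0 < r <= 1 -> Qb x r `<=` Qb (ctr a z%:R) 2.
Proof.
move=> /block_center h r01 y /QbP h2; apply/QbP => i.
by have := h i; have := h2 i; lra.
Qed.

Lemma Qb2_upper a z N : (N + 2 <= z)%N -> Qb (ctr a z%:R) 2 `<=` @upper R n N.
Proof.
move=> Nz y /QbP/(_ ord_max); rewrite vcat_last => /andP[h _].
rewrite /upper/=; apply: le_trans h; rewrite lerBrDr -natrD ler_nat.
exact: Nz.
Qed.

Lemma integrable_Qb (f : 'rV[R]_d -> R) x r (A : set 'rV[R]_d) :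
  (forall a b : 'rV[R]_d, mu.-integrable (hbox a b) (EFin \o f)) -> measurable A -> A `<=` Qb x r ->
  mu.-integrable A (EFin \o f).
Proof. by move=> fi mA; move/(integrable_sub mA); apply; exact: fi. Qed.

Variables (p q C : R) (u gam w : 'rV[R]_d -> R).
Hypothesis H : gradient_bound u gam.
Hypothesis dw : dual_weight q C w.
Hypothesis q1 : 1 <= q.
Hypothesis qp : q < p.

Definition energy y : R := gam y `^ p * w y.

Hypothesis ih : (\int[mu]_y (energy y)%:E < +oo)%E.

Lemma energy_ge0 y : 0 <= energy y.
Proof. by rewrite mulr_ge0 ?powR_ge0// ltW// (dw_gt0 dw). Qed.

Lemma measurable_energy : measurable_fun setT energy.
Proof.
apply: measurable_funM; last exact: dw_m dw.
exact: (measurableT_comp (measurable_powR p) (gb_mg H)).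
Qed.

Lemma integrable_energy (A : set 'rV[R]_d) : measurable A -> mu.-integrable A (EFin \o energy).
Proof.
move=> mA; apply: (integrableS measurableT) => //; apply/integrableP; split.
  by apply/measurable_EFinP; exact: measurable_energy.
by under eq_integral => y _ do rewrite /= ger0_norm ?energy_ge0//.
Qed.

Lemma eball_measure_le x r : 0 < r -> 0 < fine (mu (eball x r)) <= (2 * r) ^+ d.
Proof.
move=> r0; have [_ /andP[h ->]] := eball_measure x r0; rewrite andbT.
by apply: lt_le_trans h; rewrite exprn_gt0// divr_gt0// mulr_gt0.
Qed.

(** [weighted_holder] with the volumes of the cube and of the ball made
    explicit. *)
Lemma gradient_on_cube (x y : 'rV[R]_d) (r s Hb m : R) (F : set 'rV[R]_d) :
  0 < r -> 0 < s -> Qb y s `<=` eball x r -> measurable F -> F `<=` eball x r ->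
  0 < m -> m <= Rintegral mu F w -> 0 < Hb -> Rintegral mu (Qb y s) energy <= Hb ->
  Rintegral mu (Qb y s) gam <=
    3 * (Hb * (C * ((2 * r) ^+ d) `^ q / m) * ((2 * s) ^+ d) `^ (p - q)) `^ p^-1.
Proof.
move=> r0 s0 sub mF Fr m0 mW Hb0 hHb.
have mQ := measurable_Qb y s.
have W0 : 0 < Rintegral mu F w by exact: lt_le_trans mW.
have ve : fine (mu (Qb y s)) = (2 * s) ^+ d by rewrite lebesgue_Qb ?(ltW s0).
have e0 : 0 < fine (mu (Qb y s)) by rewrite ve exprn_gt0// mulr_gt0.
have hI : (\int[mu]_(v in Qb y s) (gam v `^ p * w v)%:E <= Hb%:E)%E.
  by rewrite (EFin_Rintegral (f := energy)) ?lee_fin//; exact: integrable_energy.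
have := weighted_holder dw q1 qp r0 (gb_mg H) (gb_g0 H) mQ sub e0 mF Fr W0 Hb0 hI.
have iG : mu.-integrable (Qb y s) (EFin \o gam) by exact: (gb_ig H).
rewrite (EFin_Rintegral mQ iG).
rewrite lee_fin ve => /le_trans; apply; rewrite ler_wpM2l//.
have p0 : 0 < p by move: q1 qp; lra.
have /andP[B0 B1] := eball_measure_le x r0.
have C0 := dw_C dw.
apply: ge0_ler_powR; rewrite ?nnegrE ?invr_ge0 ?(ltW p0)//.
- by rewrite !mulr_ge0 ?powR_ge0 ?invr_ge0 ?(ltW Hb0) ?(ltW C0) ?(ltW W0).
- by rewrite !mulr_ge0 ?powR_ge0 ?invr_ge0 ?(ltW Hb0) ?(ltW C0) ?(ltW m0).
rewrite ler_wpM2r ?powR_ge0// ler_wpM2l ?(ltW Hb0)//.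
rewrite ler_pM ?mulr_ge0 ?powR_ge0 ?invr_ge0 ?(ltW C0) ?(ltW W0)//; last first.
  by rewrite lef_pV2 ?posrE.
rewrite ler_wpM2l ?(ltW C0)//; apply: ge0_ler_powR; rewrite ?nnegrE ?(ltW B0)//.
  by rewrite (le_trans _ q1).
by rewrite exprn_ge0// mulr_ge0// ltW.
Qed.

Lemma p_gt0 : 0 < p. Proof. by move: q1 qp; lra. Qed.

Lemma root_small (K e : R) : 0 <= K -> 0 < e -> exists2 de, 0 < de & K * de `^ p^-1 <= e.
Proof.
move=> K0 e0; have eK : 0 < e / (K + 1) by rewrite divr_gt0// ltr_wpDl.
exists ((e / (K + 1)) `^ p); first by rewrite powR_gt0.
rewrite -powRrM divff ?gt_eqF ?p_gt0// powRr1; last exact: ltW.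
rewrite mulrCA ler_piMr ?(ltW e0)// ler_pdivrMr ?ltr_wpDl//.
by rewrite mul1r lerDl.
Qed.

Lemma energy_tail (e : R) : 0 < e -> exists N, forall z, (N <= z)%N -> forall a,
  Rintegral mu (Qb (ctr a z%:R) 2) energy <= e.
Proof.
move=> e0.
have mE : measurable_fun setT (EFin \o energy).
  by apply/measurable_EFinP; exact: measurable_energy.
have E0 y : (0 <= (EFin \o energy) y)%E by rewrite lee_fin energy_ge0.
have [N hN] := tail_small mE E0 ih e0.
exists (N + 2)%N => z Nz a; rewrite -lee_fin -EFin_Rintegral; last 2 first.
- exact: measurable_Qb.
- by apply: integrable_energy; exact: measurable_Qb.
apply: le_trans hN; apply: ge0_subset_integral => //.
- exact: measurable_Qb.
- exact: measurable_upper.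
- exact: measurable_funTS.
- by move=> y _; exact: E0.
- exact: Qb2_upper.
Qed.

Section fixed_cube.
Variables (a : 'rV[R]_n) (m : R).
Hypothesis m0 : 0 < m.
Hypothesis hm : forall z, m <= Rintegral mu (block a z) w.

(** The reference value on the block [z]. The cube of radius [2] is large enough
    to contain every cube of radius at most [1] centred in the block. *)
Definition mz z : R := avgQ u (ctr a z%:R) 2.

Lemma block_eball z : block a z `<=` eball (ctr a z%:R) rho.
Proof. by apply: subset_trans (@block_Qb2 _ _) _; exact: Qb2_eball. Qed.

(** The weight of the block stays above [m], so the integral of [gam] is
    controlled by the energy, which vanishes at infinity. *)
Lemma gradient_block_small (e : R) : 0 < e -> exists N, forall z, (N <= z)%N ->
  Rintegral mu (Qb (ctr a z%:R) 2) gam <= e.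
Proof.
move=> e0.
pose K := 3 * ((C * ((2 * rho) ^+ d) `^ q / m) * ((2 * 2) ^+ d) `^ (p - q)) `^ p^-1.
have K0 : 0 <= K by rewrite mulr_ge0// powR_ge0.
have [de de0 hde] := root_small K0 e0.
have [N hN] := energy_tail de0.
exists N => z Nz.
have := gradient_on_cube rho_gt0 (ltr0Sn _ 1) (@Qb2_eball _) (measurable_block a z)
  (@block_eball z) m0 (hm z) de0 (hN z Nz a).
move=> /le_trans; apply; apply: le_trans hde.
rewrite /K -[leRHS]mulrA ler_wpM2l// -[X in X `^ _ <= _]mulrA [de * _]mulrC.
set D := _ * _ `^ (p - q).
have D0 : 0 <= D by rewrite !mulr_ge0 ?powR_ge0 ?invr_ge0 ?(ltW (dw_C dw)) ?(ltW m0).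
by rewrite (powRM _ D0 (ltW de0)).
Qed.

Lemma avgQ1_block z x : block a z x ->
  `|avgQ u x 1 - mz z| <= d%:R * 4 * Rintegral mu (Qb (ctr a z%:R) 2) gam.
Proof.
move=> xB; have sub : Qb x 1 `<=` Qb (ctr a z%:R) 2 by apply: Qb_block xB _; lra.
apply: le_trans (avg_Qb_diff H ltr01 (ltr0Sn _ 1) sub) _.
rewrite ler_wpM2r//; first by apply: Rintegral_ge0 => y _; exact: (gb_g0 H).
rewrite (_ : 2 * 2 = 4); last by ring.
by rewrite ler_pdivrMr ?exprn_gt0// ler_peMr ?mulr_ge0// exprn_ege1//; lra.
Qed.

Hypothesis hp1 : q * d%:R - d%:R + 1 < p.

(** The midpoint between [d q - p] and [d - 1]; the hypothesis on [p] says that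
    these numbers are in this order. Below [d - 1] the fractional integrals of
    the energy are finite on almost every vertical line; above [d q - p] they
    control the dyadic Riesz potential. *)
Definition beta : R := (d%:R * q - p + n%:R) / 2.
Definition sig : R := (p - d%:R * q + beta) / p.

Lemma sig_gt0 : 0 < sig.
Proof.
rewrite divr_gt0 ?p_gt0// /beta; move: hp1; rewrite -(natr1 n); lra.
Qed.

Lemma beta_lt : (2 : R) `^ beta < 2 ^+ n.
Proof.
rewrite -powR_mulrn//; rewrite /powR !gt_eqF// ltr_expR ltr_pM2r; last first.
  by rewrite ln_gt0//; lra.
by move: hp1; rewrite /beta -(natr1 n); lra.
Qed.

Definition K1 : R :=
  3 * ((C * ((2 * rho) ^+ d) `^ q / m) * (2 ^+ d) `^ (p - q)) `^ p^-1.

Lemma K1_ge0 : 0 <= K1. Proof. by rewrite mulr_ge0// powR_ge0. Qed.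

Lemma rk_powR k : rk k = 2 `^ (- k%:R) :> R.
Proof. by rewrite /rk powRN powR_mulrn// exprVn. Qed.

Lemma two_powRD (s t : R) : 2 `^ s * 2 `^ t = 2 `^ (s + t) :> R.
Proof. by rewrite powRD// pnatr_eq0 implybT. Qed.

Lemma two_powRX (s : R) k : (2 `^ s) ^+ k = 2 `^ (s * k%:R) :> R.
Proof. by rewrite powRrM powR_mulrn// powR_ge0. Qed.

(** With [F] the whole block in [weighted_holder], the exponent of [rk k] is
    [1 - d + (beta + d (p - q)) / p = sig > 0]: the terms decay geometrically. *)
Lemma Gterm_small z x k (de : R) : block a z x -> 0 < de ->
  (2 `^ beta) ^+ k * Rintegral mu (Qb x (rk k)) energy <= de ->
  Gterm gam x k <= K1 * de `^ p^-1 * (2 `^ (- sig)) ^+ k.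
Proof.
move=> xB de0 hde.
have bk0 : 0 < (2 `^ beta : R) ^+ k by rewrite exprn_gt0// powR_gt0.
have Hb0 : 0 < de / (2 `^ beta) ^+ k by rewrite divr_gt0.
have hHb : Rintegral mu (Qb x (rk k)) energy <= de / (2 `^ beta) ^+ k.
  by rewrite ler_pdivlMr// mulrC.
have rk01 : 0 < (rk k : R) <= 1 by rewrite rk_gt0 rk_le1.
have sub : Qb x (rk k) `<=` eball (ctr a z%:R) rho.
  by apply: subset_trans (Qb_block xB rk01) _; exact: Qb2_eball.
have := gradient_on_cube rho_gt0 (@rk_gt0 R k) sub (measurable_block a z)
  (@block_eball z) m0 (hm z) Hb0 hHb.
have r0 : (0 : R) <= rk k / rk k ^+ d by rewrite divr_ge0 ?exprn_ge0 ?rk_ge0.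
move=> /(ler_wpM2l r0)/le_trans; apply.
rewrite le_eqVlt; apply/orP; left; apply/eqP.
rewrite [(2 * rk k) ^+ d]exprMn; set D := C * _ / m.
have D0 : 0 <= D by rewrite !mulr_ge0 ?powR_ge0 ?invr_ge0 ?(ltW (dw_C dw)) ?(ltW m0).
rewrite /K1 -/D; clearbody D; rewrite (powRM (p - q)) ?exprn_ge0 ?rk_ge0//.
have -> : de / (2 `^ beta) ^+ k * D * ((2 ^+ d) `^ (p - q) * (rk k ^+ d) `^ (p - q)) =
  (D * (2 ^+ d) `^ (p - q)) * de * (((2 `^ beta) ^+ k)^-1 * (rk k ^+ d) `^ (p - q)) by ring.
rewrite !(powRM p^-1) ?mulr_ge0 ?invr_ge0 ?powR_ge0 ?(ltW bk0) ?(ltW de0)//.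
set A := D `^ p^-1; set B := _ `^ p^-1; set E := de `^ p^-1.
have -> : rk k / rk k ^+ d * (3 * (A * B * E * ((((2 `^ beta) ^+ k)^-1) `^ p^-1 *
    (rk k ^+ d) `^ (p - q) `^ p^-1))) = 3 * (A * B) * E * (rk k / rk k ^+ d *
    ((((2 `^ beta) ^+ k)^-1) `^ p^-1 * (rk k ^+ d) `^ (p - q) `^ p^-1)) by ring.
congr (_ * _).
rewrite rk_powR !two_powRX -!powRN -!powRrM !two_powRD; congr (_ `^ _).
by rewrite /sig; field; rewrite gt_eqF// p_gt0.
Qed.

(** Uniform convergence in [t] along the vertical line over a good point [xb]:
    the dyadic Riesz potential at [(xb, t)] is a geometric sum times a power
    of the fractional energy above height about [t]. *)
Lemma vertical_avg (xb : 'rV[R]_n) : cube a 1 xb ->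
  (forall e : R, 0 < e -> exists T : R, forall t, T <= t -> forall k,
    (((2 `^ beta) ^+ k)%:E * \int[mu]_(y in Qb (@vcat R n.+1 xb t) (rk k)) (energy y)%:E <= e%:E)%E) ->
  forall e, 0 < e -> exists T : R, forall t z, T <= t -> z%:R <= t <= z%:R + 1 ->
  forall r, 0 < r <= 1 -> `|avgB u (ctr xb t) r - mz z| <= e.
Proof.
move=> xa good e e0.
pose th : R := 2 `^ (- sig).
have th0 : 0 < th by rewrite powR_gt0.
have th1 : th < 1.
  rewrite /th powRN invf_lt1 ?powR_gt0// /powR gt_eqF// expR_gt1 mulr_gt0 ?sig_gt0//.
  by rewrite ln_gt0//; lra.
have e2 : 0 < e / 2 by rewrite divr_gt0.
have K0 : 0 <= Cd d * (K1 / (1 - th)).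
  by rewrite mulr_ge0 ?Cd_ge0// divr_ge0 ?K1_ge0// subr_ge0 ltW.
have [de de0 hde] := root_small K0 e2.
have [T hT] := good de de0.
have e3 : 0 < e / 2 / (d%:R * 4) by rewrite !divr_gt0// mulr_gt0.
have [N hN] := gradient_block_small e3.
exists (Num.max T (N%:R + 1)) => t z; rewrite ge_max => /andP[Tt Nt] zt r r01.
have Nz : (N <= z)%N by rewrite -(ler_nat R); lra.
have xB : block a z (ctr xb t).
  apply/blockP; rewrite vcat_last; split=> //.
  by rewrite (_ : hor _ = xb)//; apply/rowP => i; rewrite mxE vcat_widen.
have GA k : \sum_(i < k) Gterm gam (ctr xb t) i <= K1 * de `^ p^-1 / (1 - th).
  apply: le_trans (_ : \sum_(i < k) K1 * de `^ p^-1 * th ^+ i <= _).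
    apply: ler_sum => i _; apply: Gterm_small xB de0 _.
    rewrite -lee_fin EFinM -EFin_Rintegral; first exact: hT.
      exact: measurable_Qb.
    by apply: integrable_energy; exact: measurable_Qb.
  rewrite -mulr_sumr ler_wpM2l ?mulr_ge0 ?K1_ge0 ?powR_ge0//.
  rewrite -[X in _ <= X]mul1r ler_pdivlMr ?subr_gt0//.
  have -> : (\sum_(i < k) th ^+ i) * (1 - th) = 1 - th ^+ k.
    by rewrite -[1 - th ^+ k]opprB subrX1; ring.
  by rewrite gerBl exprn_ge0// ltW.
have h1 := avgB_bound H GA r01.
have h2 := avgQ1_block xB.
have -> : avgB u (ctr xb t) r - mz z =
  (avgB u (ctr xb t) r - avgQ u (ctr xb t) 1) + (avgQ u (ctr xb t) 1 - mz z) by ring.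
apply: le_trans (ler_normD _ _) _; rewrite [leRHS](splitr e); apply: lerD.
  apply: le_trans h1 (le_trans _ hde); rewrite le_eqVlt; apply/orP; left; apply/eqP.
  by ring.
apply: le_trans h2 _; rewrite mulrC -ler_pdivlMr ?mulr_gt0//.
exact: hN.
Qed.

(** * Averages with respect to the weight *)

Lemma Rintegral_weight_gt0 (A : set 'rV[R]_d) : measurable A ->
  mu.-integrable A (EFin \o w) -> (0 < mu A)%E -> 0 < Rintegral mu A w.
Proof.
move=> mA iA A0; rewrite lt_neqAle Rintegral_ge0 ?andbT; last first.
  by move=> x _; rewrite ltW// (dw_gt0 dw).
apply/eqP => I0.
have wm : measurable_fun A (EFin \o w).
  by apply/measurable_EFinP; apply: measurable_funTS; exact: dw_m dw.
have e0 : (\int[mu]_(x in A) `|(EFin \o w) x| = 0)%E.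
  under eq_integral => x _ do rewrite /= ger0_norm ?(ltW (dw_gt0 dw x))//.
  by rewrite (EFin_Rintegral mA iA) -I0.
have /(ae_eq_integral_abs _ mA wm) := e0.
move=> [N [mN N0 hN]].
have AN : A `<=` N.
  move=> x Ax; apply: hN => /= /(_ Ax)/= [] wx0.
  by have := dw_gt0 dw x; rewrite wx0 ltxx.
have : (mu A <= mu N)%E by apply: le_measure; rewrite ?inE.
by rewrite N0 leNgt A0.
Qed.

Definition cubew x k : R := Rintegral mu (Qb x (2 * rk k)) w.

Definition ratio x k : R := Rintegral mu (Qb x (rk k)) energy / cubew x k.

Lemma cubew_gt0 x k : 0 < cubew x k.
Proof.
apply: Rintegral_weight_gt0; [exact: measurable_Qb|exact: (dw_int dw)|].
rewrite lebesgue_Qb; last by rewrite mulr_ge0// rk_ge0.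
by rewrite lte_fin exprn_gt0// !mulr_gt0// rk_gt0.
Qed.

Lemma ratio_ge0 x k : 0 <= ratio x k.
Proof.
apply: divr_ge0; last by apply: ltW; exact: cubew_gt0.
by apply: Rintegral_ge0 => y _; exact: energy_ge0.
Qed.

(** Concavity of the p-th root, in the form of Young's inequality; [th] trades
    smallness of the constant against the size of the coefficient of [Y]. *)
Lemma root_le (Y th : R) : 0 <= Y -> 0 < th -> (Y + th `^ p) `^ p^-1 <= th + th / th `^ p * Y.
Proof.
move=> Y0 th0; have tp : 0 < th `^ p by rewrite powR_gt0.
have -> : Y + th `^ p = (Y / th `^ p + 1) * th `^ p by field; rewrite gt_eqF.
have a0 : 0 <= Y / th `^ p by rewrite divr_ge0// ltW.
rewrite powRM ?addr_ge0 ?(ltW tp)// -powRrM divff ?gt_eqF ?p_gt0// powRr1; last exact: ltW.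
apply: le_trans (_ : (Y / th `^ p + 1) * th <= _).
  rewrite ler_wpM2r ?(ltW th0)// ler1_powR ?lerDr//.
  by rewrite invf_le1 ?p_gt0//; move: q1 qp; lra.
by rewrite le_eqVlt; apply/orP; left; apply/eqP; field; rewrite gt_eqF.
Qed.

Definition C2 : R :=
  3 * (C * ((2 * rho) ^+ d) `^ q * (2 ^+ d) `^ (p - q)) `^ p^-1.

Lemma C2_ge0 : 0 <= C2. Proof. by rewrite mulr_ge0// powR_ge0. Qed.

(** The Muckenhoupt condition at the scale of the cube itself: the volumes in
    [weighted_holder] combine to [rk k ^ d], which leaves [rk k] times the p-th
    root of an average of the energy with respect to [w]. *)
Lemma Gterm_weight x k (th : R) : 0 < th ->
  Gterm gam x k <= C2 * (rk k * (th + th / th `^ p * ratio x k)).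
Proof.
move=> th0; have W0 := cubew_gt0 x k; have r0 := @rk_gt0 R k.
have tp : 0 < th `^ p by rewrite powR_gt0.
pose Hb := Rintegral mu (Qb x (rk k)) energy + th `^ p * cubew x k.
have I0 : 0 <= Rintegral mu (Qb x (rk k)) energy.
  by apply: Rintegral_ge0 => y _; exact: energy_ge0.
have Hb0 : 0 < Hb by rewrite ltr_wpDl// mulr_gt0.
have hHb : Rintegral mu (Qb x (rk k)) energy <= Hb.
  by rewrite lerDl mulr_ge0 ?powR_ge0// ltW.
have rr0 : 0 < rho * rk k by rewrite mulr_gt0// rho_gt0.
have sub c : 0 <= c <= 2 -> Qb x (c * rk k) `<=` eball x (rho * rk k).
  move=> c02; apply: Qb_sub_eball; first by rewrite mulr_ge0 ?(ltW r0)//; lra.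
  rewrite mulrA ltr_pM2r// /rho natrD natrM mulrC.
  apply: le_lt_trans (_ : 2 * d%:R < _); last by rewrite ltrDl.
  by rewrite ler_wpM2r//; lra.
have sub1 : Qb x (rk k) `<=` eball x (rho * rk k).
  by have := sub 1; rewrite mul1r; apply; lra.
have sub2 : Qb x (2 * rk k) `<=` eball x (rho * rk k) by apply: sub; lra.
have := gradient_on_cube rr0 r0 sub1 (measurable_Qb x (2 * rk k)) sub2 W0 (lexx _) Hb0 hHb.
have c0 : 0 <= rk k / rk k ^+ d :> R by rewrite divr_ge0 ?exprn_ge0 ?rk_ge0.
move=> /(ler_wpM2l c0)/le_trans; apply.
have := root_le (ratio_ge0 x k) th0.
have -> : ratio x k + th `^ p = Hb / cubew x k.
  by rewrite /Hb /ratio; field; rewrite gt_eqF.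
move=> hroot; apply: le_trans (_ : C2 * (rk k * (Hb / cubew x k) `^ p^-1) <= _); last first.
  by rewrite ler_wpM2l ?C2_ge0// ler_wpM2l ?rk_ge0.
rewrite le_eqVlt; apply/orP; left; apply/eqP.
rewrite (_ : 2 * (rho * rk k) = (2 * rho) * rk k); last by rewrite mulrA.
rewrite [((2 * rho) * rk k) ^+ d]exprMn [(2 * rk k) ^+ d]exprMn.
have rho0 : 0 <= (2 * rho) ^+ d by rewrite exprn_ge0// mulr_ge0// ltW// rho_gt0.
have rd0 : 0 < rk k ^+ d :> R by rewrite exprn_gt0.
rewrite (powRM q rho0 (ltW rd0)) (powRM (p - q) _ (ltW rd0)) ?exprn_ge0//.
set A := ((2 * rho) ^+ d) `^ q; set B := (2 ^+ d) `^ (p - q).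
have -> : Hb * (C * (A * (rk k ^+ d) `^ q) / cubew x k) * (B * (rk k ^+ d) `^ (p - q)) =
  (Hb / cubew x k) * (C * A * B) * ((rk k ^+ d) `^ q * (rk k ^+ d) `^ (p - q)) by ring.
rewrite -powRD; last by rewrite (gt_eqF rd0) implybT.
have -> : q + (p - q) = p by ring.
have CAB : 0 <= C * A * B by rewrite !mulr_ge0 ?powR_ge0 ?(ltW (dw_C dw)).
have HW0 : 0 <= Hb / cubew x k by rewrite divr_ge0 ?ltW.
rewrite (powRM _ (mulr_ge0 HW0 CAB)) ?powR_ge0// (powRM _ HW0 CAB).
rewrite -powRrM divff ?gt_eqF ?p_gt0// powRr1 ?(ltW rd0)// /C2 -/A -/B.
by field; rewrite gt_eqF.
Qed.

Lemma measurable_cubewV k : measurable_fun setT (fun x => (cubew x k)^-1).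
Proof.
have mW : measurable_fun setT (cubew^~ k).
  apply: measurable_Rintegral_Qb; first exact: dw_m dw.
  by move=> y; rewrite ltW// (dw_gt0 dw).
rewrite (_ : (fun x => _) = (fun x => cubew x k `^ (-1))); last first.
  by apply/funext => x; rewrite powR_inv1// ltW// cubew_gt0.
exact: (measurableT_comp (measurable_powR (-1)) mW).
Qed.

Lemma measurable_ratio k : measurable_fun setT (ratio^~ k).
Proof.
apply: measurable_funM; last exact: measurable_cubewV.
by apply: measurable_Rintegral_Qb; [exact: measurable_energy|exact: energy_ge0].
Qed.

(** The centres [x] whose cube of radius [rk k] contains [y] form a cube [X] of
    the same size centred at [y], and [X] lies in the cube of radius [2 rk k]
    centred at each of them, so [w x / cubew x k] is at most [w x / w(X)] there.
    This is why [ratio] divides by the weight of the doubled cube. *)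
Lemma weight_swap (y : 'rV[R]_d) (B : set 'rV[R]_d) k : measurable B ->
  (\int[mu]_x (\1_B x * (w x / cubew x k) * \1_(cube_rel (rk k)) (x, y))%:E <= 1)%E.
Proof.
move=> mB; have r0 := @rk_gt0 R k.
pose X : set 'rV[R]_d := rect (fun i => `]y ord0 i - rk k, y ord0 i + rk k]%classic).
have mX : measurable X by apply: measurable_rect => i; exact: measurable_itv.
have XE x : cube_rel (rk k) (x, y) <-> X x.
  split; first by move=> /QbP h i; have := h i; rewrite /= in_itv/=; lra.
  by move=> h; apply/QbP => i; have := h i; rewrite /= in_itv/=; lra.
have Xsub x : X x -> X `<=` Qb x (2 * rk k).
  move=> Xx v Xv; apply/QbP => i; have := Xx i; have := Xv i.
  by rewrite /= !in_itv/=; lra.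
have X0 : (0 < mu X)%E.
  rewrite lebesgue_rect; last by move=> i; exact: measurable_itv.
  rewrite (eq_bigr (fun=> (2 * rk k)%:E)).
    by rewrite prodEFin lte_fin prodr_gt0// => i _; rewrite mulr_gt0.
  move=> i _; rewrite lebesgue_measure_itv/= lte_fin ifT; last by lra.
  by rewrite -EFinD; congr EFin; ring.
have yX : X y by move=> i; rewrite /= in_itv/=; lra.
have iX : mu.-integrable X (EFin \o w).
  by apply: (@integrable_Qb _ y (2 * rk k)) => //; [exact: dw_int dw|exact: Xsub].
have v0 := Rintegral_weight_gt0 mX iX X0.
set v := Rintegral mu X w in v0.
apply: (@le_trans _ _ (\int[mu]_(x in X) (v^-1%:E * (w x)%:E))%E).
  rewrite [leRHS]integral_mkcond; apply: ge0_le_integral => //.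
  - move=> x _; rewrite lee_fin; apply: mulr_ge0 => //; apply: mulr_ge0 => //.
    by apply: divr_ge0; apply: ltW; [exact: dw_gt0 dw _|exact: cubew_gt0].
  - apply/measurable_EFinP; apply: measurable_funM; last first.
      apply: (measurableT_comp (measurable_indic (@measurable_cube_rel R d (rk k)))).
      exact: measurable_pair2.
    apply: measurable_funM; first exact: measurable_indic.
    by apply: measurable_funM; [exact: dw_m dw|exact: measurable_cubewV].
  - apply/(measurable_restrictT _ _).1 => //; apply: measurable_funeM.
    by apply/measurable_EFinP; apply: measurable_funTS; exact: dw_m dw.
  move=> x _; rewrite /patch; have [xX|xX] := boolP (x \in X); last first.
    rewrite [X in (_ * X)%:E]indicE memNset ?mulr0//.
    by move/XE => h; move: xX; rewrite notin_setE.
  move: xX; rewrite inE => xX; rewrite -EFinM lee_fin.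
  rewrite [X in _ * X]indicE mem_set ?mulr1; last exact/XE.
  apply: le_trans (_ : w x / cubew x k <= _).
    have B1 : \1_B x <= 1 :> R by rewrite indicE; case: (_ \in _).
    have wc0 : 0 <= w x / cubew x k.
      by apply: divr_ge0; apply: ltW; [exact: dw_gt0 dw _|exact: cubew_gt0].
    by apply: le_trans (ler_wpM2r wc0 B1) _; rewrite mul1r.
  have vW : v <= cubew x k.
    have iQ : mu.-integrable (Qb x (2 * rk k)) (EFin \o w) by exact: (dw_int dw).
    rewrite /v /cubew -lee_fin -(EFin_Rintegral mX iX).
    rewrite -(EFin_Rintegral (measurable_Qb _ _) iQ).
    apply: ge0_subset_integral => //.
    - exact: measurable_Qb.
    - by apply/measurable_EFinP; apply: measurable_funTS; exact: dw_m dw.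
    - by move=> z _; rewrite lee_fin ltW// (dw_gt0 dw).
    - exact: Xsub.
  rewrite mulrC; apply: ler_wpM2r; first exact: ltW (dw_gt0 dw x).
  by rewrite lef_pV2 ?posrE//; exact: cubew_gt0.
rewrite ge0_integralZl//; last 3 first.
- by apply/measurable_EFinP; apply: measurable_funTS; exact: dw_m dw.
- by move=> z _; rewrite lee_fin ltW// (dw_gt0 dw).
- by rewrite lee_fin invr_ge0 ltW.
by rewrite (EFin_Rintegral mX iX) -/v -EFinM mulVf ?gt_eqF.
Qed.

(** By Tonelli's theorem and [weight_swap]; only the [y] in the enlarged block
    are seen from the block. *)
Lemma integral_ratio_le z k :
  (\int[mu]_(x in block a z) (w x * ratio x k)%:E <=
   (Rintegral mu (Qb (ctr a z%:R) 2) energy)%:E)%E.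
Proof.
have mB := measurable_block a z; have mQ := measurable_Qb (ctr a z%:R) 2.
pose F (v : 'rV[R]_d * 'rV[R]_d) := (\1_(block a z) v.1 * (w v.1 / cubew v.1 k) *
   (energy v.2 * \1_(cube_rel (rk k)) v)).
have m1 : measurable_fun setT (fun x => \1_(block a z) x * (w x / cubew x k)).
  apply: measurable_funM; first exact: measurable_indic.
  by apply: measurable_funM; [exact: dw_m dw|exact: measurable_cubewV].
have mrel : measurable_fun setT (\1_(@cube_rel R d (rk k)) : _ -> R).
  by apply: measurable_indic; exact: measurable_cube_rel.
have mF : measurable_fun setT (EFin \o F).
  apply/measurable_EFinP; apply: measurable_funM.
    by apply: (measurableT_comp m1); exact: measurable_fst.
  apply: measurable_funM => //.
  by apply: (measurableT_comp measurable_energy); exact: measurable_snd.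
have f10 x : 0 <= \1_(block a z) x * (w x / cubew x k).
  apply: mulr_ge0 => //.
  by apply: divr_ge0; apply: ltW; [exact: dw_gt0 dw _|exact: cubew_gt0].
have F0 v : (0 <= (EFin \o F) v)%E.
  by rewrite lee_fin mulr_ge0 ?f10// mulr_ge0// energy_ge0.
have -> : (\int[mu]_(x in block a z) (w x * ratio x k)%:E =
    \int[mu]_x \int[mu]_y (EFin \o F) (x, y))%E.
  rewrite integral_mkcond; apply: eq_integral => x _.
  under eq_integral => y _ do rewrite /F/= EFinM.
  rewrite ge0_integralZl ?lee_fin//; last 2 first.
  - apply/measurable_EFinP; apply: measurable_funM; first exact: measurable_energy.
    by apply: (measurableT_comp mrel); exact: measurable_pair1.
  - by move=> y _; rewrite lee_fin mulr_ge0// energy_ge0.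
  rewrite -integral_Qb_indic EFin_Rintegral; last 2 first.
  - exact: measurable_Qb.
  - by apply: integrable_energy; exact: measurable_Qb.
  rewrite -EFinM /patch indicE; case: ifP => _; last by rewrite !mul0r.
  by rewrite mul1r /ratio mulrA mulrAC.
rewrite tonelli_rV// -EFin_Rintegral//; last exact: integrable_energy.
rewrite [leRHS]integral_mkcond; apply: ge0_le_integral => //.
- by move=> y _; apply: integral_ge0.
- exact: measurable_integral_rV_l.
- apply/(measurable_restrictT _ _).1 => //; apply: measurable_funTS.
  by apply/measurable_EFinP; exact: measurable_energy.
move=> y _; rewrite /patch; have [yQ|yQ] := boolP (y \in Qb (ctr a z%:R) 2); last first.
  rewrite integral0_eq// => x _; rewrite /F/= !indicE.
  have [xB|xB] := boolP (x \in block a z); last by rewrite !mul0r.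
  rewrite [(x, y) \in _]memNset ?mulr0//= => xy.
  have rk01 : 0 < (rk k : R) <= 1 by rewrite rk_gt0 rk_le1.
  move: xB yQ; rewrite inE notin_setE => xB; apply.
  exact: (Qb_block xB rk01).
under eq_integral => x _ do rewrite /F/= mulrCA EFinM.
rewrite ge0_integralZl ?lee_fin ?energy_ge0//; last 2 first.
- apply/measurable_EFinP; apply: measurable_funM => //.
  by apply: (measurableT_comp mrel); exact: measurable_pair2.
- by move=> x _; rewrite lee_fin mulr_ge0.
rewrite -[leRHS]mule1 lee_wpmul2l ?lee_fin ?energy_ge0//.
exact: weight_swap.
Qed.

Lemma measurable_ratio_sum :
  measurable_fun setT (fun x => \sum_(k <oo) (rk k * ratio x k)%:E)%E.
Proof.
apply: ge0_emeasurable_sum => [k x _ _|k _].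
  by rewrite lee_fin mulr_ge0 ?rk_ge0 ?ratio_ge0.
by apply/measurable_EFinP; apply: measurable_funM => //; exact: measurable_ratio.
Qed.

Lemma sum_rk_le k : \sum_(i < k) rk i <= 2 :> R.
Proof.
suff -> : \sum_(i < k) rk i = 2 - 2 * rk k :> R.
  by rewrite gerBl mulr_ge0// rk_ge0.
elim: k => [|k IH]; first by rewrite big_ord0 /rk expr0 mulr1 subrr.
by rewrite big_ord_recr/= IH -(rkS k); ring.
Qed.

Lemma integral_ratio_sum z :
  (\int[mu]_(x in block a z) ((\sum_(k <oo) (rk k * ratio x k)%:E) * (w x)%:E) <=
   (2 * Rintegral mu (Qb (ctr a z%:R) 2) energy)%:E)%E.
Proof.
have mB := measurable_block a z.
have w0 x : 0 <= w x by rewrite ltW// (dw_gt0 dw).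
under eq_integral => x _.
  rewrite muleC -nneseriesZl//; last by move=> k _; rewrite lee_fin mulr_ge0 ?rk_ge0 ?ratio_ge0.
  over.
rewrite integral_nneseries//; last 2 first.
- move=> k; apply: emeasurable_funM; apply/measurable_EFinP.
    by apply: measurable_funTS; exact: dw_m dw.
  by apply: measurable_funTS; apply: measurable_funM => //; exact: measurable_ratio.
- by move=> k x _; rewrite mule_ge0 ?lee_fin// mulr_ge0 ?rk_ge0 ?ratio_ge0.
set eta := Rintegral mu _ energy.
have -> : (2 * eta)%:E%E = (\sum_(k <oo) (eta * 2^-1 ^+ k)%:E)%E.
  rewrite geometric_nneseries; first by congr EFin; field.
  by rewrite invr_ge0 ler0n/= invf_lt1// ltr1n.
apply: lee_nneseries => [k _ _|k _].
  by apply: integral_ge0 => x _; rewrite mule_ge0 ?lee_fin// mulr_ge0 ?rk_ge0 ?ratio_ge0.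
have -> : (\int[mu]_(x in block a z) ((w x)%:E * (rk k * ratio x k)%:E) =
    \int[mu]_(x in block a z) ((rk k)%:E * (w x * ratio x k)%:E))%E.
  by apply: eq_integral => x _; rewrite -!EFinM mulrCA.
rewrite ge0_integralZl//; last 3 first.
- apply/measurable_EFinP; apply: measurable_funTS; apply: measurable_funM; first exact: dw_m dw.
  exact: measurable_ratio.
- by move=> x _; rewrite lee_fin mulr_ge0 ?ratio_ge0.
- by rewrite lee_fin rk_ge0.
rewrite mulrC EFinM lee_wpmul2l ?lee_fin ?rk_ge0//.
exact: integral_ratio_le.
Qed.

(** All that is used about the values of [u], as opposed to its integrals. *)
Hypothesis ulim : {ae mu, forall x, forall c e : R,
  (forall r, 0 < r <= 1 -> `|avgB u x r - c| <= e) -> `|u x - c| <= e}.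

(** The Riesz potential is bounded through [Gterm_weight] by a small constant
    plus a multiple of the sum of the [ratio]s, which need not be finite
    everywhere but has a small integral with respect to the weight. *)
Lemma oscillation_ae z (e th : R) : 0 < th ->
  d%:R * 4 * Rintegral mu (Qb (ctr a z%:R) 2) gam <= e / 3 ->
  Cd d * C2 * (2 * th) <= e / 3 ->
  {ae mu, forall x, block a z x -> (`|u x - mz z|%:E <= (2 * e / 3)%:E +
    (Cd d * C2 * (th / th `^ p) + 1)%:E * \sum_(k <oo) (rk k * ratio x k)%:E)%E}.
Proof.
move=> th0 hG hth; apply: filterS ulim => x hx xB.
set tau := th / th `^ p; set K := Cd d * C2; set S := (\sum_(k <oo) _)%E.
have K0 : 0 <= K by rewrite mulr_ge0 ?Cd_ge0 ?C2_ge0.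
have tau0 : 0 <= tau by rewrite divr_ge0 ?powR_ge0// ltW.
have M0 : 0 < K * tau + 1 by rewrite ltr_wpDl// mulr_ge0.
have S0 : (0 <= S)%E.
  by apply: nneseries_ge0 => k _ _; rewrite lee_fin mulr_ge0 ?rk_ge0 ?ratio_ge0.
have [Sfin|] := boolP (S \is a fin_num); last first.
  rewrite ge0_fin_numE// -leNgt leye_eq => /eqP ->.
  by rewrite mulry gtr0_sg// mul1e addey// leey.
rewrite -(fineK Sfin) -EFinM -EFinD lee_fin; set s := fine S.
have s0 : 0 <= s by rewrite fine_ge0.
apply: hx => r r01.
have GA k : \sum_(i < k) Gterm gam x i <= C2 * (2 * th + tau * s).
  apply: le_trans (_ : \sum_(i < k) C2 * (rk i * (th + tau * ratio x i)) <= _).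
    by apply: ler_sum => i _; exact: Gterm_weight.
  rewrite -mulr_sumr ler_wpM2l ?C2_ge0//.
  have -> : \sum_(i < k) rk i * (th + tau * ratio x i) =
     (\sum_(i < k) rk i) * th + tau * \sum_(i < k) rk i * ratio x i.
    rewrite mulr_suml mulr_sumr -big_split/=; apply: eq_bigr => i _; ring.
  apply: lerD; first by rewrite ler_wpM2r ?sum_rk_le// ltW.
  rewrite ler_wpM2l// -lee_fin -sumEFin fineK//.
  rewrite -(big_mkord xpredT (fun i => (rk i * ratio x i)%:E)).
  by apply: nneseries_lim_ge => i _ _; rewrite lee_fin mulr_ge0 ?rk_ge0 ?ratio_ge0.
have h1 := avgB_bound H GA r01.
have h2 := le_trans (avgQ1_block xB) hG.
have -> : avgB u x r - mz z = (avgB u x r - avgQ u x 1) + (avgQ u x 1 - mz z) by ring.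
apply: le_trans (ler_normD _ _) _; apply: le_trans (lerD h1 h2) _.
have -> : Cd d * (C2 * (2 * th + tau * s)) = K * (2 * th) + K * tau * s by rewrite /K; ring.
have : (K * tau + 1) * s = K * tau * s + s by ring.
move: hth s0; rewrite -/K; set X := K * (2 * th); set Y := K * tau * s; lra.
Qed.

(** Integrate [oscillation_ae] against [w] over the block: the sum of the
    [ratio]s contributes the energy of the enlarged block, which tends to [0],
    while the weight of the block stays above [m]. *)
Lemma weighted_close (e : R) : 0 < e -> exists N, forall z, (N <= z)%N ->
  mu.-integrable (block a z) (EFin \o (fun x => u x * w x)) /\
  `|Rintegral mu (block a z) (fun x => u x * w x) / Rintegral mu (block a z) w - mz z| <= e.
Proof.
move=> e0; pose K : R := Cd d * C2.
have K0 : 0 <= K by rewrite mulr_ge0 ?Cd_ge0 ?C2_ge0.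
pose th := e / (6 * (K + 1)).
have K1 : 0 < 6 * (K + 1) by rewrite mulr_gt0// ltr_wpDl.
have th0 : 0 < th by rewrite divr_gt0.
have hth : Cd d * C2 * (2 * th) <= e / 3.
  rewrite -/K /th; have -> : K * (2 * (e / (6 * (K + 1)))) = e / 3 * (K / (K + 1)).
    by field; rewrite gt_eqF// ltr_wpDl.
  by rewrite ler_piMr ?divr_ge0 ?(ltW e0)// ler_pdivrMr ?ltr_wpDl// mul1r lerDl.
pose M := Cd d * C2 * (th / th `^ p) + 1.
have M0 : 0 < M by rewrite ltr_wpDl// mulr_ge0// divr_ge0 ?powR_ge0// ltW.
have e3 : 0 < e / 3 / (d%:R * 4) by rewrite !divr_gt0// mulr_gt0.
have [N1 hN1] := gradient_block_small e3.
have e4 : 0 < m * e / 3 / (2 * M) by rewrite !divr_gt0 ?mulr_gt0.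
have [N2 hN2] := energy_tail e4.
exists (maxn N1 N2) => z; rewrite geq_max => /andP[Nz1 Nz2].
have hG : d%:R * 4 * Rintegral mu (Qb (ctr a z%:R) 2) gam <= e / 3.
  by rewrite mulrC -ler_pdivlMr ?mulr_gt0//; exact: hN1.
have hE : M * (2 * Rintegral mu (Qb (ctr a z%:R) 2) energy) <= m * e / 3.
  by rewrite mulrCA mulrA -ler_pdivlMl ?mulr_gt0// mulrC; exact: hN2.
have osc := oscillation_ae th0 hG hth; rewrite -/M in osc.
have mB := measurable_block a z.
set B := block a z in mB osc *; set c := mz z in osc *.
have w0 x : 0 <= w x by rewrite ltW// (dw_gt0 dw).
have iw : mu.-integrable B (EFin \o w).
  by apply: (@integrable_Qb _ (ctr a z%:R) 2) => //; [exact: dw_int dw|exact: block_Qb2].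
have mw : measurable_fun B (EFin \o w).
  by apply/measurable_EFinP; apply: measurable_funTS; exact: dw_m dw.
set W := Rintegral mu B w.
have Wm : m <= W by exact: hm.
have W0 : 0 < W by exact: lt_le_trans Wm.
have mS : measurable_fun B (fun x => \sum_(k <oo) (rk k * ratio x k)%:E)%E.
  by apply: measurable_funTS; exact: measurable_ratio_sum.
have S0 x : (0 <= \sum_(k <oo) (rk k * ratio x k)%:E)%E.
  by apply: nneseries_ge0 => k _ _; rewrite lee_fin mulr_ge0 ?rk_ge0 ?ratio_ge0.
have muw : measurable_fun setT (fun x => (u x - c) * w x).
  apply: measurable_funM; last exact: dw_m dw.
  by apply: measurable_funB => //; exact: gb_mu H.
have e23 : 0 <= 2 * e / 3 by rewrite divr_ge0// mulr_ge0// ltW.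
have bound : (\int[mu]_(x in B) `|(u x - c) * w x|%:E <= (W * e)%:E)%E.
  apply: (@le_trans _ _ (\int[mu]_(x in B) ((2 * e / 3)%:E * (w x)%:E +
     M%:E * ((\sum_(k <oo) (rk k * ratio x k)%:E) * (w x)%:E)))%E).
    apply: ae_ge0_le_integral => //.
    - by apply/measurable_EFinP; apply: measurableT_comp => //; exact: measurable_funTS.
    - by move=> x _; rewrite adde_ge0 ?mule_ge0 ?lee_fin ?(ltW M0).
    - apply: emeasurable_funD; apply: measurable_funeM => //.
      exact: emeasurable_funM.
    apply: filterS osc => x hx xB; have := hx xB.
    rewrite normrM (ger0_norm (w0 x)) [(_ * w x)%:E]EFinM muleA -muleDl//.
    by move=> h; rewrite lee_wpmul2r ?lee_fin.
  rewrite ge0_integralD//; last 4 first.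
  - by move=> x _; rewrite -EFinM lee_fin mulr_ge0.
  - by apply: measurable_funeM.
  - by move=> x _; rewrite !mule_ge0 ?lee_fin// ltW.
  - by apply: measurable_funeM; exact: emeasurable_funM.
  rewrite ge0_integralZl//; last by move=> x _; rewrite lee_fin.
  rewrite ge0_integralZl ?lee_fin ?(ltW M0)//; last 2 first.
  - exact: emeasurable_funM.
  - by move=> x _; rewrite mule_ge0 ?lee_fin.
  rewrite (EFin_Rintegral mB iw) -/W.
  have hS := integral_ratio_sum z.
  apply: le_trans (leeD2l _ (lee_wpmul2l _ hS)) _; first by rewrite lee_fin ltW.
  rewrite -!EFinM -EFinD lee_fin; apply: le_trans (lerD (lexx _) hE) _.
  have : m * e <= W * e by rewrite ler_wpM2r// ltW.
  by rewrite (_ : 2 * e / 3 * W = 2 / 3 * (W * e)); [lra|ring].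
have id : mu.-integrable B (EFin \o (fun x => (u x - c) * w x)).
  apply/integrableP; split; first by apply/measurable_EFinP; exact: measurable_funTS.
  by apply: le_lt_trans bound _; rewrite ltry.
have ic : mu.-integrable B (EFin \o (fun x => c * w x)).
  exact: (@integrableZl _ _ _ mu B mB c _ iw).
have fE : (fun x => u x * w x) = (fun x => (u x - c) * w x + c * w x).
  by apply/funext => x; ring.
split.
  by rewrite fE; exact: (@integrableD _ _ _ mu B mB _ _ id ic).
rewrite fE RintegralD// RintegralZl// -/W mulrDl mulfK ?gt_eqF// addrK.
rewrite normrM normfV (gtr0_norm W0) ler_pdivrMr//.
apply: le_trans (le_normr_Rintegral mB id) _.
by rewrite -lee_fin -EFin_Rintegral//; [rewrite mulrC|exact: integrable_norm].
Qed.

End fixed_cube.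

End blocks.

(** * Borel versions of the data *)

Section borel_versions.
Context {R : realType}.
Local Open Scope ereal_scope.

Lemma enorm_ge0 d (x : 'rV[R]_d) : (0 <= enorm x)%R.
Proof. exact: sqrtr_ge0. Qed.

(** Local integrability makes a Borel version of [u] finite almost everywhere,
    so that real values can be taken. *)
Lemma L1_loc_borel d (u : 'rV[R]_d -> \bar R) : L1_loc u ->
  exists u1 : 'rV[R]_d -> R, [/\ measurable_fun setT u1,
    {ae lebesgue_rV d, forall x, u x = (u1 x)%:E} &
    forall a b, (lebesgue_rV d).-integrable (hbox a b) (EFin \o u1)].
Proof.
move=> [[g mg ug] hK]; set mu := lebesgue_rV d in ug hK *.
have mcb (a b : 'rV[R]_d) : measurable (rect (fun i => `[a ord0 i, b ord0 i]%classic)).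
  by apply: measurable_rect => i; exact: measurable_itv.
have ig (a b : 'rV[R]_d) : mu.-integrable (rect (fun i => `[a ord0 i, b ord0 i]%classic)) g.
  apply/integrableP; split; first exact: measurable_funTS.
  rewrite (@integral_ae_eq_gen _ _ _ mu _ _ (fun x => `|u x|)).
    by apply: hK; exact: compact_closed_box.
  by apply: filterS ug => x ->.
have sub (a b : 'rV[R]_d) : hbox a b `<=` rect (fun i => `[a ord0 i, b ord0 i]%classic).
  by move=> x /hboxP h i; rewrite /= in_itv/=; have /andP[-> /ltW ->] := h i.
have gfin : {ae mu, forall x, g x \is a fin_num}.
  have : {ae mu, forall x (n : nat), Qb 0 n%:R x -> g x \is a fin_num}.
    apply: ae_foralln => n.
    have := integrable_ae (mcb _ _) (ig (\row_i ((0 : 'rV[R]_d) ord0 i - n%:R))%R (\row_i ((0 : 'rV[R]_d) ord0 i + n%:R))%R).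
    by apply: filterS => x h xQ; apply: h; exact: sub.
  apply: filterS => x h.
  have : (\bigcup_n Qb (0 : 'rV[R]_d) (n%:R : R)) x.
    apply: contrapT => nx.
    have xn : forall i, (`|x ord0 i| < (Num.bound (\sum_(i < d) `|x ord0 i|))%:R)%R.
      move=> i; apply: le_lt_trans (archi_boundP _); last by apply: sumr_ge0.
      by rewrite (bigD1 i)//= lerDl sumr_ge0.
    apply: nx; exists (Num.bound (\sum_(i < d) `|x ord0 i|)%R) => //.
    apply/QbP => i; rewrite mxE sub0r add0r.
    by have := xn i; rewrite ltr_norml => /andP[/ltW -> ->].
  by move=> [n _]; exact: h.
exists (fine \o g); split.
- exact: (measurableT_comp (fine_measurable measurableT) mg).
- by apply: filterS2 ug gfin => x -> fx; rewrite /= fineK.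
move=> a b; have iab : mu.-integrable (hbox a b) g.
  exact: (integrableS (mcb a b) (measurable_hbox a b) (@sub a b) (ig a b)).
have mh := measurable_hbox a b.
apply/integrableP; split.
  apply/measurable_EFinP; apply: measurable_funTS.
  exact: (measurableT_comp (fine_measurable measurableT) mg).
have /integrableP[_] := iab; rewrite (@integral_ae_eq_gen _ _ _ mu _ _ (fun x => `|(EFin \o (fine \o g)) x|)) //.
by apply: filterS gfin => x fx; congr abse; exact/esym/fineK.
Qed.

(** The weight is changed on a null set into a Borel function that is positive
    everywhere. The mass of [F] is at most the mass of the ball, so the
    Muckenhoupt condition bounds the dual factor with [F] in place of the ball. *)
Lemma muckenhoupt_dual d (q : R) (w : 'rV[R]_d -> R) : (1 <= q)%R -> muckenhoupt q w ->
  exists C w1, dual_weight q C w1 /\ {ae lebesgue_rV d, forall x, w x = w1 x}.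
Proof.
move=> q1 [w0 wL wpos wA]; set mu := lebesgue_rV d.
have [w2 [mw2 w2E iw2]] := L1_loc_borel wL.
pose w1 x : R := if (0 < w2 x)%R then w2 x else 1%R.
have ww1 : {ae mu, forall x, w x = w1 x}.
  by apply: filterS2 w2E wpos => x [wE] wx; rewrite /w1 -wE wx.
have w10 x : (0 < w1 x)%R by rewrite /w1; case: ifP.
have mw1 : measurable_fun setT w1.
  apply: measurable_fun_ifT => //.
  by apply: measurable_fun_ltr.
have iw1 a b : mu.-integrable (hbox a b) (EFin \o w1).
  apply/integrableP; split; first by apply/measurable_EFinP; exact: measurable_funTS.
  have /integrableP[_] := iw2 a b.
  rewrite (@integral_ae_eq_gen _ _ _ mu _ _ (fun x => `|(EFin \o w1) x|)) //.
  by apply: filterS2 w2E ww1 => x [/= wE] w1E; rewrite -wE w1E.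
have avgE x r : average (EFin \o w) (eball x r) =
    ((fine (mu (eball x r)))^-1 * Rintegral mu (eball x r) w1)%:E.
  rewrite /average (@integral_ae_eq_gen _ _ _ mu _ _ (EFin \o w1)); last first.
    by apply: filterS ww1 => y /= ->.
  rewrite EFinM; congr (_ * _); apply: EFin_Rintegral; first exact: measurable_eball.
  apply: integrableS (iw1 _ _) => //; [exact: measurable_hbox|exact: measurable_eball|].
  exact: eball_sub_Qb.
have WB x r F : measurable F -> F `<=` eball x r ->
    (Rintegral mu F w1 <= Rintegral mu (eball x r) w1)%R.
  move=> mF Fr; have iB : mu.-integrable (eball x r) (EFin \o w1).
    apply: integrableS (iw1 _ _) => //; [exact: measurable_hbox|exact: measurable_eball|].
    exact: eball_sub_Qb.
  have iF : mu.-integrable F (EFin \o w1).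
    by apply: integrableS iB => //; exact: measurable_eball.
  rewrite -lee_fin -(EFin_Rintegral mF iF) -(EFin_Rintegral (measurable_eball _ _) iB).
  apply: ge0_subset_integral => //; first exact: measurable_eball.
    by apply/measurable_EFinP; exact: measurable_funTS.
  by move=> y _; rewrite lee_fin ltW.
case: ifPn wA => [/eqP q1E|q1N].
  move=> [C C1 hA]; exists C, w1; split => //.
  have C0 : (0 < C)%R by exact: lt_le_trans C1.
  split => // x r F r0 mF Fr W0.
  exists (fun=> 0%R); split => //.
    by rewrite integral0_eq.
  have [fB /andP[B0 _]] := eball_measure x r0.
  have B1 : (0 < fine (mu (eball x r)))%R.
    by apply: lt_le_trans B0; rewrite exprn_gt0// divr_gt0// mulr_gt0.
  apply: filterS2 (hA x r r0) ww1 => y hy wy yB; have := hy yB.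
  rewrite avgE lee_fin wy q1E subrr powRr0 mulr1 powRr1 ?(ltW B1)// => h.
  have -> : (C * fine (mu (eball x r)) / Rintegral mu F w1 * w1 y =
     (C * w1 y) * fine (mu (eball x r)) / Rintegral mu F w1)%R by ring.
  rewrite ler_pdivlMr// mul1r -ler_pdivrMr//.
  apply: le_trans h; rewrite mulrC ler_wpM2l ?invr_ge0 ?(ltW B1)//.
  exact: WB.
have q0 : (0 < q - 1)%R by rewrite subr_gt0 lt_neqAle eq_sym q1N.
move=> [C C1 hA]; exists C, w1; split => //.
have C0 : (0 < C)%R by exact: lt_le_trans C1.
split => // x r F r0 mF Fr W0.
have [fB /andP[B0 _]] := eball_measure x r0.
set bB := fine (mu (eball x r)) in fB B0 *.
have B1 : (0 < bB)%R.
  by apply: lt_le_trans B0; rewrite exprn_gt0// divr_gt0// mulr_gt0.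
set W := Rintegral mu F w1 in W0 *.
pose v y := (w1 y `^ (- (q - 1)^-1))%R.
have mv : measurable_fun setT v by exact: (measurableT_comp (measurable_powR _) mw1).
have v0 y : (0 <= v y)%R by exact: powR_ge0.
(* [V0] is the bound for the integral of [v] over the ball that the
   Muckenhoupt condition gives. *)
pose D : R := (C * bB / W)%R.
have D0 : (0 < D)%R by rewrite divr_gt0// mulr_gt0.
pose V0 : R := (bB * D `^ (q - 1)^-1)%R.
have V00 : (0 < V0)%R by rewrite mulr_gt0// powR_gt0.
have hV : \int[mu]_(y in eball x r) (v y)%:E <= V0%:E.
  have := hA x r r0; rewrite avgE -/bB.
  have -> : average (fun y => ((w y) `^ (- (q - 1)^-1))%R%:E) (eball x r) =
     (bB^-1)%:E * \int[mu]_(y in eball x r) (v y)%:E.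
    rewrite /average -/bB; congr (_ * _); apply: integral_ae_eq_gen.
    by apply: filterS ww1 => y ->.
  set I := \int[mu]_(y in eball x r) (v y)%:E.
  have I0 : 0 <= I by apply: integral_ge0 => y _; rewrite lee_fin.
  set X := (bB^-1 * _)%R.
  have XW : (W / bB <= X)%R by rewrite /X mulrC ler_wpM2l ?invr_ge0 ?(ltW B1)//; exact: WB.
  have WB0 : (0 < W / bB)%R by rewrite divr_gt0.
  have X0 : (0 < X)%R by exact: lt_le_trans XW.
  move: I0; case: I => [y||] // y0.
    rewrite -(EFinM bB^-1 y) poweR_EFin -EFinM !lee_fin => h.
    have h2 : ((bB^-1 * y) `^ (q - 1) <= D)%R.
      rewrite /D -mulrA -ler_pdivrMr ?divr_gt0// invf_div mulrC.
      by apply: le_trans h; rewrite ler_wpM2r ?powR_ge0.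
    have by0 : (0 <= bB^-1 * y)%R by rewrite mulr_ge0 ?invr_ge0 ?(ltW B1).
    have h3 : (bB^-1 * y <= D `^ (q - 1)^-1)%R.
      rewrite -[leLHS](powRr1 by0) -[X in (_ `^ X)%R](@divff _ (q - 1)) ?gt_eqF// powRrM.
      by apply: ge0_ler_powR; rewrite ?nnegrE ?invr_ge0 ?powR_ge0 ?(ltW q0) ?(ltW D0).
    by move: h3; rewrite /V0 -ler_pdivlMl ?invr_gt0// invrK.
  have bi0 : 0 < (bB^-1)%:E by rewrite lte_fin invr_gt0.
  rewrite mulry gtr0_sg ?invr_gt0// mul1e poweRyr ?gt_eqF// mulry gtr0_sg// mul1e.
  by rewrite leye_eq.
exists (fun y => v y / V0)%R; split => //.
- by apply: measurable_funM.
- by move=> y; rewrite divr_ge0// ltW.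
- under eq_integral => y _ do rewrite mulrC EFinM.
  rewrite ge0_integralZl//; last 4 first.
  + exact: measurable_eball.
  + by apply/measurable_EFinP; exact: measurable_funTS.
  + by move=> y _; rewrite lee_fin.
  + by rewrite lee_fin invr_ge0 ltW.
  by rewrite -lee_pdivlMl ?invr_gt0// invrK mule1.
apply: aeW => y _.
rewrite powRM ?invr_ge0 ?(ltW V00)// /v -powRrM mulNr mulVf ?gt_eqF//.
rewrite powR_inv1 ?(ltW (w10 _))//.
have -> : (V0^-1 `^ (q - 1) = (bB `^ (q - 1) * D)^-1)%R.
  rewrite -powR_inv1 ?(ltW V00)// -powRrM mulrC powRrM /V0 powRM ?powR_ge0 ?(ltW B1)//.
  by rewrite -powRrM mulVf ?gt_eqF// powRr1 ?(ltW D0)// powR_inv1// mulr_ge0 ?powR_ge0 ?(ltW D0).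
have -> : (bB `^ q = bB * bB `^ (q - 1))%R.
  by rewrite mulr_powRB1 ?(ltW B1)// (lt_le_trans _ q1).
have bp0 : (0 < bB `^ (q - 1))%R by rewrite powR_gt0.
rewrite /D le_eqVlt; apply/orP; left; apply/eqP; field.
by rewrite !gt_eqF.
Qed.

End borel_versions.

(** * Sobolev functions and their representatives *)

Section extended_reals.
Context {R : realType}.
Local Open Scope ereal_scope.

(** Two inequalities rather than the absolute value of a difference: [f] may be
    infinite, and [eclose] then fails. *)
Definition eclose (f : \bar R) (c e : R) := (c - e)%:E <= f <= (c + e)%:E.

Lemma eclose_dist f c c' e e' : eclose f c e -> eclose f c' e' -> (`|c - c'| <= e + e')%R.
Proof.
move=> /andP[h1 h2] /andP[h3 h4]; have := le_trans h1 h4; have := le_trans h3 h2.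
by rewrite !lee_fin ler_norml; lra.
Qed.

Lemma eclose_trans f c c' e e' : eclose f c e -> (`|c - c'| <= e')%R -> eclose f c' (e + e').
Proof.
rewrite ler_norml => /andP[h1 h2] h; apply/andP; split.
  by apply: le_trans h1; rewrite lee_fin; lra.
by apply: le_trans h2 _; rewrite lee_fin; lra.
Qed.

Lemma eclose_EFin (x c e : R) : eclose x%:E c e = (`|x - c| <= e)%R.
Proof. by rewrite /eclose !lee_fin ler_distl. Qed.

Lemma ecvgP (T : Type) (F : set_system T) {FF : Filter F} (f : T -> \bar R) (c : R) :
  f @ F --> c%:E <-> forall e : R, (0 < e)%R -> \forall x \near F, eclose (f x) c e.
Proof.
split.
  move=> /fine_cvgP[ff /cvgrPdist_le fc] e e0; have := fc e e0; apply: filterS2 ff => x fx.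
  by rewrite -[f x in X in _ -> X](fineK fx) eclose_EFin distrC.
move=> h; apply/fine_cvgP; split.
  have := h 1%R ltr01; apply: filterS => x /andP[h1 h2].
  by rewrite fin_numElt (lt_le_trans _ h1) ?ltNyr// (le_lt_trans h2) ?ltry.
apply/cvgrPdist_le => e e0; have := h e e0; apply: filterS => x hx.
have fx : f x \is a fin_num.
  have /andP[h1 h2] := hx.
  by rewrite fin_numElt (lt_le_trans _ h1) ?ltNyr// (le_lt_trans h2) ?ltry.
by move: hx; rewrite -{1}(fineK fx) eclose_EFin distrC.
Qed.

(** A limsup at [0] only depends on the values on [[set r | 0 < r <= 1]]. *)
Lemma limf_esup_eclose (f : R -> \bar R) c e :
  (forall r, (0 < r <= 1)%R -> eclose (f r) c e) -> eclose (limf_esup f 0^'+) c e.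
Proof.
move=> h; rewrite limf_esupE; apply/andP; split.
  apply: le_ereal_inf_tmp => _ [V FV <-].
  have F1 : (0 : R)^'+ [set r | (0 < r <= 1)%R].
    near=> r; apply/andP; split => //.
    by near: r; exact: nbhs_right_le.
  have [r [Vr r01]] := filter_ex (filterI FV F1).
  have /andP[h1 _] := h r r01.
  by apply: le_trans h1 _; apply: ereal_sup_ubound; exists r.
apply: le_trans (_ : ereal_sup [set f r | r in [set r | (0 < r <= 1)%R]] <= _).
  apply: ereal_inf_lbound; exists [set r : R | (0 < r <= 1)%R] => //.
  near=> r; apply/andP; split => //.
  by near: r; exact: nbhs_right_le.
by apply: ge_ereal_sup => _ [r r01 <-]; have /andP[] := h r r01.
Unshelve. all: by end_near. Qed.

End extended_reals.

Section sobolev_functions.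
Context {R : realType} (d : nat).
Local Notation mu := (lebesgue_rV d).
Local Open Scope ereal_scope.

Lemma average_avgB (u : 'rV[R]_d -> \bar R) (u1 : 'rV[R]_d -> R) x r :
  {ae mu, forall y, u y = (u1 y)%:E} ->
  (forall a b, mu.-integrable (hbox a b) (EFin \o u1)) ->
  average u (eball x r) = (avgB u1 x r)%:E.
Proof.
move=> uE iu; rewrite /average (integral_ae_eq_gen _ uE) /avgB mulrC EFinM.
rewrite EFin_Rintegral//; first exact: measurable_eball.
exact: integrableS (measurable_hbox _ _) (measurable_eball x r) (@eball_sub_Qb _ _ x r) (iu _ _).
Qed.

(** The halving inequality holds with the partial derivative [g1 i], which is
    at most the length of the gradient. *)
Lemma gradient_bound_weak (u1 : 'rV[R]_d -> R) (g1 : 'I_d -> 'rV[R]_d -> R) :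
  measurable_fun setT u1 -> (forall i, measurable_fun setT (g1 i)) ->
  (forall a b, mu.-integrable (hbox a b) (EFin \o u1)) ->
  (forall i a b, mu.-integrable (hbox a b) (EFin \o g1 i)) ->
  (forall i f, test_function f ->
     \int[mu]_x (u1 x * partial i f x)%:E = - \int[mu]_x (g1 i x * f x)%:E) ->
  gradient_bound u1 (fun x => enorm (\row_i g1 i x)).
Proof.
move=> mu1 mg1 iu1 ig1 weak; set gam := fun x => _.
have mgam : measurable_fun setT gam.
  apply: (measurableT_comp (continuous_measurable_fun (@sqrt_continuous R))).
  apply: measurable_sum => i; under eq_fun do rewrite mxE.
  exact: measurable_funX.
have igam a b : mu.-integrable (hbox a b) (EFin \o gam).
  have mh := measurable_hbox a b.
  have is1 : mu.-integrable (hbox a b) (fun x => \sum_(i < d) `|(g1 i x)%:E|).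
    apply: (integrable_sum mh) => i _; exact: (integrable_abse (ig1 i a b)).
  have := integrableZl mh d%:R is1; apply: le_integrable => //.
    by apply/measurable_EFinP; exact: measurable_funTS.
  move=> x _; rewrite /= sumEFin -EFinM lee_fin.
  rewrite !ger0_norm ?enorm_ge0 ?mulr_ge0 ?sumr_ge0//.
  apply: enorm_le; first by apply: sumr_ge0.
  by move=> i; rewrite mxE (bigD1 i)//= lerDl sumr_ge0.
split => //; first by move=> x; exact: enorm_ge0.
move=> i a b ab.
apply: le_trans (half_box_le mu1 (mg1 i) iu1 (ig1 i) (weak i) ab) _.
rewrite ler_wpM2l ?divr_ge0 ?subr_ge0//.
have mh := measurable_hbox a b.
apply: (le_Rintegral mh (integrable_norm (ig1 i a b)) (igam a b)).
move=> x _; have := @coord_le_enorm R d (\row_i g1 i x) i.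
by rewrite mxE.
Qed.

(** The last clause is where the choice of the representative enters: the value
    of [u] at every point is a limsup of averages over balls, and these averages
    do not see null sets. Bounds on the averages thus pass to [u] at every
    point, on null sets such as vertical lines too. *)
Lemma sobolev_gradient_bound (p : R) (w w1 : 'rV[R]_d -> R) (u : 'rV[R]_d -> \bar R) :
  {ae mu, forall x, w x = w1 x} -> sobolev p w u ->
  exists u1 gam, [/\ {ae mu, forall x, u x = (u1 x)%:E}, gradient_bound u1 gam,
    \int[mu]_y (gam y `^ p * w1 y)%:E < +oo &
    forall x c e, (forall r, (0 < r <= 1)%R -> (`|avgB u1 x r - c| <= e)%R) ->
      eclose (u x) c e].
Proof.
move=> wE [_ [g [Lu Lg weak] fin] rep].
have [u1 [mu1 uE iu1]] := L1_loc_borel Lu.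
have [g1 hg1] := choice (fun i => L1_loc_borel (Lg i)).
have mg1 i : measurable_fun setT (g1 i) by have [] := hg1 i.
have ig1 i a b : mu.-integrable (hbox a b) (EFin \o g1 i) by have [_ _] := hg1 i.
have gE i : {ae mu, forall x, g x ord0 i = g1 i x}.
  by have [_ h _] := hg1 i; apply: filterS h => x [].
exists u1, (fun x => enorm (\row_i g1 i x)); split => //.
- apply: gradient_bound_weak => // i f tf.
  rewrite -(@integral_ae_eq_gen _ _ _ mu _ (fun x => u x * (partial i f x)%:E)); last first.
    by apply: filterS uE => x ->; rewrite EFinM.
  rewrite weak//; congr (- _); apply: integral_ae_eq_gen.
  by apply: filterS (gE i) => x ->.
- rewrite -(@integral_ae_eq_gen _ _ _ mu _ (fun x => (enorm (g x) `^ p * w x)%R%:E))//.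
  have gA : {ae mu, forall x i, g x ord0 i = g1 i x} by exact: filter_forall gE.
  apply: filterS2 wE gA => x wx gx; rewrite wx.
  by have -> : g x = \row_i g1 i x by apply/rowP => i; rewrite mxE gx.
move=> x c e h; rewrite rep; apply: limf_esup_eclose => r r01.
by rewrite (average_avgB _ _ uE iu1) eclose_EFin; exact: h.
Qed.

End sobolev_functions.

(** * Block averages and vertical limits *)

Section comparison.
Context {R : realType} (n : nat).
Local Notation d := n.+1.
Local Notation mu := (lebesgue_rV d).
Local Notation nu := (lebesgue_rV n).
Local Open Scope ereal_scope.

Lemma block_mass_ge (w w1 : 'rV[R]_d -> R) q C (a : 'rV[R]_n) :
  {ae mu, forall x, w x = w1 x} -> dual_weight q C w1 ->
  0 < ereal_inf [set weighted_measure w (block a z) | z in [set: nat]] ->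
  exists2 m : R, (0 < m)%R & forall z, (m <= Rintegral mu (block a z) w1)%R.
Proof.
move=> wE dw; have mass z : weighted_measure w (block a z) =
    (Rintegral mu (block a z) w1)%:E.
  rewrite /weighted_measure (@integral_ae_eq_gen _ _ _ mu _ _ (EFin \o w1)).
    apply: EFin_Rintegral; first exact: measurable_block.
    apply: (integrable_Qb (dw_int dw) (measurable_block a z)).
    exact: (@block_Qb2 _ _ a z).
  by apply: filterS wE => x /= ->.
set S := (X in ereal_inf X) => I0.
have Iz z : ereal_inf S <= (Rintegral mu (block a z) w1)%:E.
  by apply: ereal_inf_lbound; exists z.
have If : ereal_inf S \is a fin_num.
  by rewrite fin_numElt (lt_trans _ I0) ?ltNyr// (le_lt_trans (Iz 0%N)) ?ltry.
exists (fine (ereal_inf S)); first by rewrite fine_gt0// I0 ltey_eq If.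
by move=> z; rewrite -lee_fin fineK.
Qed.

Lemma weighted_average_real (w w1 u1 : 'rV[R]_d -> R) (u : 'rV[R]_d -> \bar R) (A : set 'rV[R]_d) :
  {ae mu, forall x, w x = w1 x} -> {ae mu, forall x, u x = (u1 x)%:E} -> measurable A ->
  mu.-integrable A (EFin \o w1) -> mu.-integrable A (EFin \o (fun x => u1 x * w1 x)%R) ->
  weighted_average w u A =
  (Rintegral mu A (fun x => u1 x * w1 x)%R / Rintegral mu A w1)%:E.
Proof.
move=> wE uE mA iw iuw; rewrite /weighted_average /weighted_measure.
rewrite (@integral_ae_eq_gen _ _ _ mu _ (fun x => (w x)%:E) (EFin \o w1)); last first.
  by apply: filterS wE => x /= ->.
rewrite (@integral_ae_eq_gen _ _ _ mu _ (fun x => u x * (w x)%:E)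
  (EFin \o (fun x => u1 x * w1 x)%R)); last first.
  by apply: filterS2 wE uE => x /= -> ->; rewrite EFinM.
by rewrite mulrC EFinM; congr (_ * _); exact: EFin_Rintegral.
Qed.

(** Weighted averages over blocks and values on vertical lines are both compared
    with the same numbers [m a z], plain averages of [u] over cubes that contain
    the blocks. *)
Lemma block_comparison (p q : R) (w : 'rV[R]_d -> R) (u : 'rV[R]_d -> \bar R) :
  (1 <= q)%R -> muckenhoupt q w ->
  (forall a : 'rV[R]_n,
     0 < ereal_inf [set weighted_measure w (block a z) | z in [set: nat]]) ->
  (q * d%:R - d%:R + 1 < p)%R -> sobolev p w u ->
  exists m : 'rV[R]_n -> nat -> R,
    (forall a e, (0 < e)%R -> exists N, forall z, (N <= z)%N ->
       eclose (weighted_average w u (block a z)) (m a z) e) /\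
    {ae nu, forall xb, forall a, cube a 1%R xb -> forall e, (0 < e)%R ->
       exists T : R, forall t z, (T <= t)%R -> (z%:R <= t <= z%:R + 1)%R ->
       eclose (u (@vcat R d xb t)) (m a z) e}.
Proof.
move=> q1 hw hinf hp1 su.
have [C [w1 [dw wE]]] := muckenhoupt_dual q1 hw.
have [u1 [gam [uE H ih lim]]] := sobolev_gradient_bound wE su.
have qp : (q < p)%R.
  have : (0 <= (q - 1) * n%:R)%R by rewrite mulr_ge0// subr_ge0.
  by move: hp1; rewrite -(natr1 n); lra.
exists (mz u1); split.
  move=> a e e0; have [m m0 hm] := block_mass_ge wE dw (hinf a).
  (* [u1] inherits the property of the representative [u] off a null set *)
  have ulim : {ae mu, forall x, forall c e : R,
      (forall r, (0 < r <= 1)%R -> (`|avgB u1 x r - c| <= e)%R) -> (`|u1 x - c| <= e)%R}.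
    by apply: filterS uE => x ux c e' h; have := lim x c e' h; rewrite ux eclose_EFin.
  have [N hN] := weighted_close H dw q1 qp ih m0 hm ulim e0.
  exists N => z Nz; have [iuw h] := hN z Nz.
  have mB := measurable_block a z.
  rewrite (weighted_average_real wE uE mB _ iuw) ?eclose_EFin//.
  by apply: (integrable_Qb (dw_int dw) mB); exact: (@block_Qb2 _ _ a z).
have E0 y : (0 <= energy p gam w1 y)%R by exact: energy_ge0 dw y.
have mE := measurable_energy p H dw.
have b0 : (0 < (2 : R) `^ beta n p q)%R by rewrite powR_gt0.
have := small_cubes_ae b0 (beta_lt hp1) mE E0 ih.
apply: filterS => xb good a xa e e0.
have [m m0 hm] := block_mass_ge wE dw (hinf a).
have [T hT] := vertical_avg H dw q1 qp ih m0 hm hp1 xa good e0.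
exists T => t z Tt zt; apply: lim => r r01.
exact: (hT t z Tt zt r r01).
Qed.

(** A cube has positive measure. *)
Lemma cube_ae_meet (a : 'rV[R]_n) (P : 'rV[R]_n -> Prop) :
  {ae nu, forall x, P x} -> exists2 x, cube a 1%R x & P x.
Proof.
move=> [N [mN N0 PN]]; apply: contrapT => no.
have sub : hbox a (\row_i (a ord0 i + 1)%R) `<=` N.
  move=> x /hboxP xh; apply: PN => Px; apply: no; exists x => // i.
  by have := xh i; rewrite mxE => /andP[-> /ltW ->].
have : nu (hbox a (\row_i (a ord0 i + 1)%R)) <= nu N.
  by apply: le_measure; rewrite ?inE//; exact: measurable_hbox.
rewrite N0 lebesgue_hbox; last by move=> i; rewrite mxE lerDl.
rewrite big1; first by rewrite lee_fin ler10.
by move=> i _; rewrite mxE; ring.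
Qed.

Lemma corner_cube (a : 'rV[R]_n) : cube a 1%R a.
Proof. by move=> i; rewrite lexx lerDl ler01. Qed.

End comparison.

Theorem theorem1p13 (R : realType) (d : nat) (p q : R) (w : 'rV[R]_d -> R)
    (hd : (2 <= d)%N) (hq : 1 <= q) (hqp : q <= p)
    (hw : muckenhoupt q w)
    (hinf : forall (a : 'rV[R]_d.-1) (l : R), 0 < l ->
       (0 < ereal_inf [set weighted_measure w (vblock (cube a l) z) | z in [set: nat]])%E)
    (hp1 : q * d%:R - d%:R + 1 < p) (hp2 : p < d%:R) :
  (forall u : 'rV[R]_d -> \bar R, sobolev p w u ->
     exists c : R, forall a : 'rV[R]_d.-1,
       weighted_average w u (vblock (cube a 1) z) @[z --> \oo] --> c%:E)
  <->
  (forall u : 'rV[R]_d -> \bar R, sobolev p w u -> unique_ae_vertical_limit u).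
Proof.
case: d w hd hw hinf hp1 hp2 => [//|n] w _ hw hinf hp1 _.
have comp u (su : sobolev p w u) :=
  block_comparison hq hw (fun a => hinf a 1 ltr01) hp1 su.
split => h u su; have [m [mW mV]] := comp u su; have [c hc] := h u su; exists c.
  (* the cube with lower corner [xb] serves for the line over [xb] *)
  apply: filterS mV => xb hx; apply/ecvgP => e e0.
  have e3 : 0 < e / 3 by rewrite divr_gt0.
  have [N1 hN1] := mW xb _ e3.
  have [T hT] := hx xb (corner_cube xb) _ e3.
  have /ecvgP/(_ _ e3)[N2 _ hN2] := hc xb.
  (* the line is followed through the block that contains the height [t] *)
  near=> t.
  have t0 : 0 <= t by near: t; exact: nbhs_pinfty_ge.
  have /andP[z1 z2] := truncn_itv t0.
  have tN : (maxn N1 N2)%:R <= t by near: t; exact: nbhs_pinfty_ge.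
  have Nz : (maxn N1 N2 <= Num.truncn t)%N.
    by rewrite -ltnS -(ltr_nat R); exact: le_lt_trans tN z2.
  move: Nz; rewrite geq_max => /andP[Nz1 Nz2].
  have zt : (Num.truncn t)%:R <= t <= (Num.truncn t)%:R + 1 by rewrite z1 natr1 ltW.
  have Tt : T <= t by near: t; apply: nbhs_pinfty_ge; exact: num_real.
  have dist := eclose_dist (hN1 _ Nz1) (hN2 _ Nz2).
  have := eclose_trans (hT t _ Tt zt) dist.
  by congr (is_true (eclose _ _ _)); field.
move=> a; apply/ecvgP => e e0.
have e3 : 0 < e / 3 by rewrite divr_gt0.
(* one good line through the blocks determines the limit *)
have [xb xa [hx hl]] := cube_ae_meet a (filterI mV hc).
have [N1 hN1] := mW a _ e3.
have [T hT] := hx a xa _ e3.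
have /ecvgP/(_ _ e3)[M [_ hM]] := hl.
near=> z.
have Nz1 : (N1 <= z)%N by near: z; exact: nbhs_infty_ge.
have Tz : T <= z%:R by near: z; exact: nbhs_infty_ger.
have Mz : M < z%:R by near: z; exact: nbhs_infty_gtr.
have zt : z%:R <= (z%:R : R) <= z%:R + 1 by rewrite lexx lerDl ler01.
have dist := eclose_dist (hT _ _ Tz zt) (hM _ Mz).
have := eclose_trans (hN1 _ Nz1) dist.
by congr (is_true (eclose _ _ _)); field.
Unshelve. all: by end_near. Qed.
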